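(* Let $M$ be a closed oriented $3$-manifold, $L\subset M$ a framed link, and let $(M^*,L^* )$ be obtained from $(M,L)$ by a change-of-pair operation. Then, both in the $SU(2)$ theory (any integer $r\geqslant 3$, at $q=e^{\pi\sqrt{-1}/r}$) and in the $SO(3)$ theory (any odd integer $r\geqslant3$, at $q=e^{2\pi\sqrt{-1}/r}$), $$\sum_{\mathbf m}\big|\mathrm{RT}_r(M,L,\mathbf m)\big|^2=\sum_{\mathbf n}\big|\mathrm{RT}_r(M^*,L^*,\mathbf n)\big|^2,$$ where $\mathbf m$ and $\mathbf n$ run over all colorings of the components of $L$ and of $L^*$, respectively, by elements of $\mathrm I_r$.
   Context: **Change-of-pair operation.** Let $L=L_1\cup\dots\cup L_n$ be a framed link in a closed oriented $3$-manifold $M$ and $(I,J)$ a partition of $\{1,\dots,n\}$; $L_I=\cup_{i\in I}L_i$, $L_J=\cup_{j\in J}L_j$. For $i\in I$ let $L_i^*$ be a framed knot in $M\setminus L$ (any framing) whose core curve is isotopic to the meridian of a tubular neighborhood of $L_i$; $L_I^*=\cup_{i\in I}L_i^*$. The operation $T_{(L_I;L_I^* )}$ sends $(M,L)$ to $(M^*,L^* )$, where $M^*=M_{L_I}$ is obtained from $M$ by (integral) surgery along $L_I$ and $L^*=L_I^*\cup L_J$. **Relative Reshetikhin-Turaev invariants.** $SU(2)$ theory: $q=e^{\pi\sqrt{-1}/r}$, $A=e^{\pi\sqrt{-1}/(2r)}$, $\mathrm I_r=\{0,1,\dots,r-2\}$, $\mu_r=\frac{\sqrt2\sin(\pi/r)}{\sqrt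 r}$. $SO(3)$ theory: $r$ odd, $q=e^{2\pi\sqrt{-1}/r}$, $A=e^{\pi\sqrt{-1}/r}$, $\mathrm I_r=\{0,2,\dots,r-3\}$, $\mu_r=\frac{2\sin(2\pi/r)}{\sqrt r}$. In both cases $q=A^2$, and $\langle\ \rangle$ is the Kauffman bracket of framed links in $S^3$ (crossing $=A\cdot$ one smoothing $+A^{-1}\cdot$ the other, loop value $-A^2-A^{-2}$, empty link $\mapsto1$). In the skein algebra $\mathbb C[z]$ of the thickened annulus ($z$ the core), $e_0=1$, $e_1=z$, $e_k=ze_{k-1}-e_{k-2}$; $[k]=\frac{q^k-q^{-k}}{q-q^{-1}}$; and the Kirby coloring is $\Omega_r=\mu_r\sum_{k\in \mathrm I_r}(-1)^k[k+1]e_k$. If $M$ is obtained from $S^3$ by surgery along a framed link $L'$ and $L\subset M$ is a framed link with $n$ components colored by $\mathbf m\in\mathrm I_r^n$, $$\mathrm{RT}_r(M,L,\mathbf m)=\mu_r\langle e_{m_1},\dots,e_{m_n},\Omega_r,\dots,\Omega_r\rangle_{D(L\cup L')}\,\langle\Omega_r\rangle_{U_+}^{-\sigma(L')},$$ where $D(L\cup L')$ is a diagram whose blackboard framing is the given framing, $e_{m_k}$ is cabled along the $k$-th component of $L$ and $\Omega_r$ along each component of $L'$, $U_+$ is the unknot with framing $1$, and $\sigma(L')$ is the signature of the linking matrix of $L'$. *)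

(* Defs.v *)
From HB Require Import structures.
From mathcomp Require Import all_boot all_order all_algebra.
From mathcomp Require Import complex.
From mathcomp Require Import reals trigo.
From Stdlib Require Export Relation_Operators.

Set Implicit Arguments.
Unset Strict Implicit.
Unset Printing Implicit Defensive.

Import Order.TTheory GRing.Theory Num.Theory.

Local Open Scope ring_scope.

(* A closed oriented 3-manifold M containing a framed link L is handled through
   surgery: M is S^3 surgered along a framed link L' (Lickorish-Wallace), and
   the pair (M, L) is given by a blackboard-framed diagram of L u L'.  Two such
   diagrams give the same pair (M, L), up to orientation preserving
   diffeomorphism respecting the framing and the numbering of L, exactly when
   they are related by framed isotopy and Kirby moves, here in the local form
   of Fenn and Rourke: this is [same_pair] below.  A pair (M, L) is thus a
   [linkPair] up to [same_pair]. *)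

(* A diagram is cut by horizontal lines into elementary slices and is read
   upwards.  [Cup t p] creates two adjacent strands at positions p and p+1 (the
   annotation t describes the strand at p), [Cap p] joins the strands at p and
   p+1, and [Cross b p] crosses them.  If [b = true], the strand going from
   bottom left to top right is the upper one. *)
Inductive slice (T : Type) : Type :=
  | Cup of T & nat
  | Cap of nat
  | Cross of bool & nat.
Arguments Cap {T} _.
Arguments Cross {T} _ _.

Definition word (T : Type) := seq (slice T).

Definition slice_pos (T : Type) (e : slice T) : nat :=
  match e with Cup _ p | Cap p | Cross _ p => p end.

Definition map_slice (T T' : Type) (g : T -> T') (e : slice T) : slice T' :=
  match e with
  | Cup t p => Cup (g t) p
  | Cap p => Cap p
  | Cross b p => Cross b p
  end.

(* Number of closed curves of a diagram: [s] lists, for the strands met by the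
   current horizontal line, the name of the arc they belong to; the names in
   use are smaller than [k]. *)
Fixpoint loops_from (T : Type) (k : nat) (s : seq nat) (w : word T) : nat :=
  match w with
  | [::] => 0%N
  | Cup _ p :: w' =>
      loops_from k.+1 (take p s ++ [:: k; k] ++ drop p s) w'
  | Cap p :: w' =>
      let a := nth 0%N s p in
      let b := nth 0%N s p.+1 in
      ((a == b) + loops_from k
         [seq if x == a then b else x | x <- take p s ++ drop p.+2 s] w')%N
  | Cross _ p :: w' =>
      loops_from k
        (take p s ++ [:: nth 0%N s p.+1; nth 0%N s p] ++ drop p.+2 s) w'
  end.

Definition loops (T : Type) (w : word T) : nat := loops_from 0 [::] w.

(* All states: each crossing is replaced either by two vertical strands or by a
   cap followed by a cup.  The integer is the exponent of A: for [Cross true]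
   the A-smoothing is the vertical one. *)
Fixpoint states (w : word unit) : seq (int * word unit) :=
  match w with
  | [::] => [:: (0, [::])]
  | Cross b p :: w' =>
      let eps : int := if b then 1 else -1 in
      [seq (x.1 + eps, x.2) | x <- states w'] ++
      [seq (x.1 - eps, Cap p :: Cup tt p :: x.2) | x <- states w']
  | e :: w' => [seq (x.1, e :: x.2) | x <- states w']
  end.

Definition bracket (F : fieldType) (A : F) (w : word unit) : F :=
  \sum_(x <- states w) A ^ x.1 * (- A ^+ 2 - A ^- 2) ^+ loops x.2.

(* A label (c, d) on a strand gives its component c and whether it is oriented
   upwards.  [Cup (c, d) p] creates strands labelled (c, d) and (c, ~~ d).
   Orientations are auxiliary: they only serve to write the linking matrix. *)
Section Labelled.
Variable C : finType.

Definition label : Type := (C * bool)%type.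

Definition step (s : seq label) (e : slice label) : option (seq label) :=
  match e with
  | Cup (c, d) p =>
      if (p <= size s)%N
      then Some (take p s ++ [:: (c, d); (c, ~~ d)] ++ drop p s) else None
  | Cap p =>
      if drop p s is x :: y :: s' then
        if (x.1 == y.1) && (x.2 != y.2) then Some (take p s ++ s') else None
      else None
  | Cross _ p =>
      if drop p s is x :: y :: s' then Some (take p s ++ y :: x :: s') else None
  end.

(* The labels on the top line, if the diagram is well formed. *)
Definition run (s : seq label) (w : word label) : option (seq label) :=
  foldl (fun o e => obind (step^~ e) o) (Some s) w.

Definition mult (k : C -> nat) (s : seq label) (p : nat) : nat :=
  if onth s p is Some x then k x.1 else 0%N.

Definition cable_slice (k : C -> nat) (s : seq label) (e : slice label) :
    word unit :=
  let o := sumn [seq k x.1 | x <- take (slice_pos e) s] in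
  match e with
  | Cup (c, _) p => [seq Cup tt (o + j)%N | j <- iota 0 (k c)]
  | Cap p => [seq Cap (o + j)%N | j <- rev (iota 0 (mult k s p))]
  | Cross b p =>
      [seq Cross b (o + j + i)%N |
         j <- iota 0 (mult k s p.+1), i <- rev (iota 0 (mult k s p))]
  end.

(* Replace each component c by k c parallel copies for the blackboard framing. *)
Fixpoint cable_from (k : C -> nat) (s : seq label) (w : word label) :
    word unit :=
  if w is e :: w' then
    cable_slice k s e ++ cable_from k (odflt [::] (step s e)) w'
  else [::].

Definition cable (k : C -> nat) (w : word label) := cable_from k [::] w.

(* The second condition: the curves named c form exactly one knot (count the
   curves left after deleting all the other components). *)
Definition link_diagram (w : word label) : bool :=
  (run [::] w == Some [::]) &&
  [forall c : C, loops (cable (fun c' => nat_of_bool (c' == c)) w) == 1%N].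

(* Bracket of the diagram with the element [P c] of the skein algebra of the
   annulus (polynomials in the core) placed along the component c. *)
Definition skein_bracket (F : fieldType) (A : F) (P : C -> {poly F})
    (w : word label) : F :=
  \sum_(k : {ffun C -> 'I_(\max_c size (P c))})
     (\prod_c (P c)`_(k c)) * bracket A (cable (fun c => k c : nat) w).

(* Labels of the two strands at each crossing, with the sign of the crossing. *)
Fixpoint crossings_from (s : seq label) (w : word label) :
    seq (C * C * int) :=
  if w is e :: w' then
    let tl := crossings_from (odflt [::] (step s e)) w' in
    match e with
    | Cross b p =>
        if drop p s is x :: y :: _ then
          ((x.1, y.1), if b (+) (x.2 != y.2) then 1 else -1) :: tl
        else tl
    | _ => tl
    end
  else [::].

Definition crossings (w : word label) := crossings_from [::] w.

(* Linking number for a != b; writhe, that is the framing, for a = b. *)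
Definition linking (F : fieldType) (w : word label) (a b : C) : F :=
  if a == b then
    \sum_(x <- crossings w | x.1 == (a, a)) x.2%:~R
  else
    2^-1 * \sum_(x <- crossings w | (x.1 == (a, b)) || (x.1 == (b, a))) x.2%:~R.

End Labelled.
Arguments label C : clear implicits.

Definition relabel (C C' : finType) (f : C -> C') (w : word (label C)) :
    word (label C') :=
  map (map_slice (fun l : label C => (f l.1, l.2) : label C')) w.

Definition reverse_component (C : finType) (c : C) (w : word (label C)) :
    word (label C) :=
  map (map_slice (fun l : label C => (l.1, l.2 (+) (l.1 == c)) : label C)) w.

Definition slice_in (T : Type) (e : slice T) : nat :=
  match e with Cup _ _ => 0%N | _ => 2%N end.

Definition slice_out (T : Type) (e : slice T) : nat :=
  match e with Cap _ => 0%N | _ => 2%N end.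

Definition shift_slice (T : Type) (n : nat) (e : slice T) : slice T :=
  match e with
  | Cup t p => Cup t (n + p)%N
  | Cap p => Cap (n + p)%N
  | Cross b p => Cross b (n + p)%N
  end.

(* A kink of sign b on the strand at position p, labelled l. *)
Definition kink (T : Type) (l : T) (b : bool) (p : nat) : word T :=
  [:: Cup l p.+1; Cross b p; Cap p.+1].

(* Local moves; they are applied inside well formed diagrams only. *)
Inductive local_move (T : Type) : word T -> word T -> Prop :=
  | Far e e' :
      local_move [:: e; shift_slice (slice_pos e + slice_out e)%N e']
                 [:: shift_slice (slice_pos e + slice_in e)%N e'; e]
  | Zigzag_left l p : local_move [:: Cup l p.+1; Cap p] [::]
  | Zigzag_right l p : local_move [:: Cup l p; Cap p.+1] [::]
  | Cup_slide l b p :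
      local_move [:: Cup l p; Cross b p.+1] [:: Cup l p.+1; Cross (~~ b) p]
  | Cap_slide b p :
      local_move [:: Cross b p.+1; Cap p] [:: Cross (~~ b) p; Cap p.+1]
  (* framed version of the first Reidemeister move *)
  | Reidemeister1 l l' b p :
      local_move (kink l b p) [:: Cup l' p; Cross b p.+1; Cap p]
  | Reidemeister2 b p : local_move [:: Cross b p; Cross (~~ b) p] [::]
  (* excluded: the three pairs of strands are cyclically over one another *)
  | Reidemeister3 a b c p :
      ~~ ((a == c) && (a != b)) ->
      local_move [:: Cross a p; Cross b p.+1; Cross c p]
                 [:: Cross c p.+1; Cross b p; Cross a p.+1].

(* The last constructor: the links considered are unoriented. *)
Inductive isotopy_move (C : finType) :
    word (label C) -> word (label C) -> Prop :=
  | Local u x y v : local_move x y -> isotopy_move (u ++ x ++ v) (u ++ y ++ v)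
  | Reverse c w : isotopy_move w (reverse_component c w).

(* f kinks (with sign) on the strand at position p, labelled l. *)
Definition kinks (T : Type) (l : T) (f : int) (p : nat) : word T :=
  flatten (nseq `|f|%N (kink l (0 <= f) p)).

(* A circle named c, with framing f, around the n strands at p, ..., p+n-1. *)
Definition circle (C : finType) (c : C) (f : int) (p n : nat) :
    word (label C) :=
  Cup ((c, true) : label C) (p + n)%N ::
  [seq Cross true (p + i)%N | i <- rev (iota 0 n)] ++
  [seq Cross true (p + i)%N | i <- iota 0 n] ++
  kinks ((c, true) : label C) f (p + n)%N ++
  [:: Cap (p + n)%N].

(* A full twist of sign b on the band of strands starting at position p, with
   labels ls; the kinks account for the twisting of each framed strand. *)
Definition full_twist (T : Type) (b : bool) (p : nat) (ls : seq T) : word T :=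
  flatten (nseq (size ls) [seq Cross b (p + i)%N | i <- iota 0 (size ls).-1]) ++
  flatten [seq kink x.2 b (p + x.1)%N | x <- zip (iota 0 (size ls)) ls].

(* A pair (M, L), the components of L being numbered by X: M is obtained from
   S^3 by surgery along the components numbered by [surg]. *)
Record linkPair (X : finType) : Type := LinkPair {
  surg : finType;
  diagram : word (label (X + surg)%type);
  diagramP : link_diagram diagram
}.

Definition on_surg (X S S' : finType) (f : S -> S') (c : X + S) : X + S' :=
  match c with inl x => inl x | inr s => inr (f s) end.

(* [FennRourke]: a surgery circle of framing +1 (resp. -1) around any number of
   strands is traded for a full negative (resp. positive) twist. *)
Inductive kirby_move (X : finType) : linkPair X -> linkPair X -> Prop :=
  | Isotopy (S : finType) (w w' : word (label (X + S)%type))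
      (hw : link_diagram w) (hw' : link_diagram w') :
      isotopy_move w w' -> kirby_move (LinkPair hw) (LinkPair hw')
  | Rename (S S' : finType) (f : S -> S') (w : word (label (X + S)%type))
      (hw : link_diagram w) (hw' : link_diagram (relabel (on_surg f) w)) :
      bijective f -> kirby_move (LinkPair hw) (LinkPair hw')
  | FennRourke (S : finType) (u v : word (label (X + S)%type)) (b : bool)
      (p : nat) (ls : seq (label (X + S)%type))
      (hw : link_diagram (u ++ full_twist (~~ b) p ls ++ v))
      (hw' : link_diagram
               (relabel (on_surg (@Some S)) u ++
                circle (inr None) (if b then 1 else -1) p (size ls) ++
                relabel (on_surg (@Some S)) v)) :
      kirby_move (LinkPair hw) (LinkPair hw').

Definition same_pair (X : finType) : linkPair X -> linkPair X -> Prop :=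
  clos_refl_sym_trans (linkPair X) (@kirby_move X).

(* [add_meridians h J w w']: w' is w with, for each j in J, a meridian named
   [inl j], with any framing, added around a strand of the component [h j]. *)
Inductive add_meridians (X S : finType) (h : X -> (X + S)%type) :
    {set X} -> word (label (X + S)%type) -> word (label (X + S)%type) -> Prop :=
  | NoMeridian w : add_meridians h set0 w w
  | AddMeridian (J : {set X}) (j : X) w u v s (p : nat) (d : bool) (f : int) :
      j \notin J ->
      add_meridians h J w (u ++ v) ->
      run [::] u = Some s ->
      onth s p = Some (h j, d) ->
      add_meridians h (j |: J) w (u ++ circle (inl j) f p 1 ++ v).

(* The components of L_I become surgery components, numbered by I; the others
   are kept. *)
Definition surger (X S : finType) (I : {set X}) (c : X + S) :
    (X + (S + {x | x \in I}))%type :=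
  match c with
  | inl x => if insub x is Some i then inr (inr i) else inl x
  | inr s => inr (inl s)
  end.

(* The i-th component of L^* is L_i^* if i is in I, and L_i otherwise. *)
Definition change_of_pair (X : finType) (I : {set X}) (P Q : linkPair X) :
    Prop :=
  exists (S : finType) (w : word (label (X + S)%type)) (hw : link_diagram w)
         (w' : word (label (X + (S + {x | x \in I}))%type))
         (hw' : link_diagram w'),
    [/\ same_pair P (LinkPair hw),
        add_meridians (fun x => surger I (inl x)) I (relabel (surger I) w) w' &
        same_pair (LinkPair hw') Q].

Inductive theory : Type := SU2 | SO3.

Section RT.
Variable R : realType.

Definition cis (t : R) : R[i] := Complex (cos t) (sin t).

(* Signature of a Hermitian matrix, from its eigenvalues with multiplicity. *)
Definition signature (n : nat) (M : 'M[R[i]]_n) : int :=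
  let ev := sval (closed_field_poly_normal (char_poly M)) in
  (count (fun z => 0 < z) ev)%:Z - (count (fun z => z < 0) ev)%:Z.

Definition surgery_matrix (X : finType) (P : linkPair X) :
    'M[R[i]]_#|surg P| :=
  \matrix_(i, j) linking (R[i]) (diagram P) (inr (enum_val i))
                                            (inr (enum_val j)).

Variables (th : theory) (r : nat).

Definition rootq : R[i] :=
  match th with SU2 => cis (pi / r%:R) | SO3 => cis (2 * pi / r%:R) end.

Definition rootA : R[i] :=
  match th with SU2 => cis (pi / (2 * r%:R)) | SO3 => cis (pi / r%:R) end.

Definition color : pred nat :=
  fun k => match th with
           | SU2 => (k <= r - 2)%N
           | SO3 => ~~ odd k && (k <= r - 3)%N
           end.

Definition mu : R :=
  match th with
  | SU2 => Num.sqrt 2 * sin (pi / r%:R) / Num.sqrt r%:R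
  | SO3 => 2 * sin (2 * pi / r%:R) / Num.sqrt r%:R
  end.

Definition qint (k : nat) : R[i] :=
  (rootq ^+ k - rootq ^- k) / (rootq - rootq^-1).

Fixpoint cheb (k : nat) : {poly R[i]} :=
  match k with
  | 0 => 1
  | k1.+1 => match k1 with
             | 0 => 'X
             | k2.+1 => 'X * cheb k1 - cheb k2
             end
  end.

Definition Omega : {poly R[i]} :=
  real_complex R mu *:
  \sum_(k < r | color k) ((-1) ^+ k * qint k.+1) *: cheb k.

(* The unknot with one positive kink. *)
Definition Uplus : word (label unit) :=
  [:: Cup (tt, true) 0; Cup (tt, true) 1; Cross true 0; Cap 1; Cap 0].

Definition RT (X : finType) (P : linkPair X) (m : X -> nat) : R[i] :=
  real_complex R mu *
  skein_bracket rootA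
    (fun c => match c with inl x => cheb (m x) | inr _ => Omega end)
    (diagram P) *
  skein_bracket rootA (fun=> Omega) Uplus ^ (- signature (surgery_matrix P)).

End RT.

(* Main.v *)
(* The Kauffman bracket at a root of unity is computed on paths in the graph
   0 - 1 - ... - m, m = r - 2 (the RSOS model): diagrams act on functions of
   paths, isotopic diagrams act in the same way, and the framing twist of k
   strands at the left end of the diagram is diagonal, with an eigenvalue
   depending only on the k-th vertex.  So does a circle around these strands.

   An operator that depends only on the k-th vertex, placed on the k parallel
   copies of a knot, acts on the knot coloured by e_n as its value at the vertex
   n.  Indeed, cut the knot open at the operator and let psi(P) be the value for
   the projection on a path P of length k.  Where P backtracks, let e be the
   corresponding Temperley-Lieb projection.  Inserting 1 = e + (1 - e) in the
   copies of the knot at each of its minima leaves only the two terms where the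
   same summand is chosen everywhere, because the knot is connected; this shows
   that psi is a trace and that psi(P) does not change when the backtracking is
   removed from P.  Thus psi(P) only depends on the end of P, and the Chebyshev
   polynomial e_n selects the end n.

   Consequently kinks on, and meridians around, a component coloured by e_a act
   by scalars: up to a root of unity a meridian coloured by e_n multiplies the
   invariant by S_na / S_0a, where S is the S matrix.  The Kirby color makes the
   surgered component run over all a with the weights S_0a, so that the invariants
   of (M^*, L^* ) are obtained from those of (M, L) by applying S to the colors of
   the components in I.  As S is unitary the sum of the squared moduli is kept.
   The same eigenvalues give the invariance under the Fenn-Rourke move up to a
   factor of modulus 1, so signatures play no role. *)
Require Import Defs.
From mathcomp Require Import all_boot all_order all_algebra.
From mathcomp Require Import complex boolp reals trigo.
From mathcomp Require Import ring lra zify.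
From Stdlib Require Import Setoid Morphisms.

Set Implicit Arguments.
Unset Strict Implicit.
Unset Printing Implicit Defensive.

Import Order.TTheory GRing.Theory Num.Theory.

Local Open Scope ring_scope.

(** Three obstacles shape the proof. Paths start at the vertex 0, so twists and circles are diagonal
    only at the left end; elsewhere their strands are pulled to the left by a braid and pushed back
    afterwards. Next, a colour e_n is a combination of cables with varying numbers of copies, so the
    vertex weights must not depend on that number: removing two copies at a backtracking is what
    compares k copies with k - 2. Finally, the operators moved around the knot include matrix units
    on paths, which are not given as diagrams; the argument is therefore made for abstract operators
    that commute with everything on their right.

    Weighting cups by [lam] and caps by its inverse avoids square roots. Everything up to the last
    section then holds over a field with an element A such that A^4 has order m + 2; complex
    conjugation enters as a ring morphism [cj] inverting A. For SO(3), m is odd, and n -> m - n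
    exchanges even and odd vertices while preserving S and the twists: a sum over colours is half of
    the sum over all vertices. *)

Section Shift.
Local Open Scope nat_scope.
Implicit Types (e : slice unit) (w x y : word unit).

Definition outs1 n e : nat := n + slice_out e - slice_in e.
Definition outs n w : nat := foldl outs1 n w.

Fixpoint wf n w : bool :=
  if w is e :: w' then (slice_pos e + slice_in e <= n) && wf (outs1 n e) w'
  else true.

Definition sh k w : word unit := map (shift_slice k) w.

Lemma outs_cat n x y : outs n (x ++ y) = outs (outs n x) y.
Proof. by rewrite /outs foldl_cat. Qed.

Lemma wf_cat n x y : wf n (x ++ y) = wf n x && wf (outs n x) y.
Proof. by elim: x n => //= e x IH n; rewrite IH andbA. Qed.

Lemma sh_cat k x y : sh k (x ++ y) = sh k x ++ sh k y.
Proof. exact: map_cat. Qed.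

Lemma sh0 w : sh 0 w = w.
Proof. by elim: w => //= e w; rewrite /sh => ->; case: e. Qed.

Lemma shD k l w : sh k (sh l w) = sh (k + l) w.
Proof.
by elim: w => //= e w ->; congr (_ :: _); case: e => [t p|p|b p]; rewrite /= addnA.
Qed.

Lemma slice_in_sh k e : slice_in (shift_slice k e) = slice_in e.
Proof. by case: e. Qed.
Lemma slice_out_sh k e : slice_out (shift_slice k e) = slice_out e.
Proof. by case: e. Qed.
Lemma slice_pos_sh k e : slice_pos (shift_slice k e) = k + slice_pos e.
Proof. by case: e. Qed.

Lemma wf_sh k n w : wf n w -> wf (k + n) (sh k w).
Proof.
elim: w n => //= e w IH n /andP[h1 /IH h2].
rewrite slice_in_sh slice_pos_sh -addnA leq_add2l h1 /=.
by rewrite /outs1 slice_in_sh slice_out_sh -addnA -addnBA // ; lia.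
Qed.

Lemma outs_sh k n w : wf n w -> outs (k + n) (sh k w) = k + outs n w.
Proof.
elim: w n => //= e w IH n /andP[h1 /IH <-].
by rewrite /outs1 slice_in_sh slice_out_sh -addnA -addnBA //; lia.
Qed.

Lemma wf_weak k n w : wf n w -> wf (n + k) w /\ outs (n + k) w = outs n w + k.
Proof.
elim: w n => //= e w IH n /andP[h1 /IH [h2 h3]].
have E : outs1 (n + k) e = outs1 n e + k.
  by rewrite /outs1 addnAC addnBAC //; lia.
by rewrite E h2 h3 andbT; split=> //; lia.
Qed.

End Shift.

Section PathModel.
Variables (F : fieldType) (A : F) (m : nat).
Hypothesis A_neq0 : A != 0.
Hypothesis A_prim : forall j, (0 < j < m.+2)%N -> A ^+ (4 * j) != 1.
Hypothesis A_order : A ^+ (4 * m.+2) = 1.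
Hypothesis m_gt0 : (0 < m)%N.

#[local] Hint Resolve A_neq0 A_prim A_order m_gt0 : core.

(** * Path model of the Kauffman bracket *)

Definition delta : F := - A ^+ 2 - A ^- 2.
(** The signed quantum integer (-1)^a [a+1], which is the a-th Chebyshev polynomial at [delta]. On
    the graph it is an eigenvector of the adjacency matrix for the eigenvalue [delta]. *)
Definition lam (a : nat) : F :=
  (-1) ^+ a * (A ^+ (2 * a.+1) - A ^- (2 * a.+1)) / (A ^+ 2 - A ^- 2).

Lemma A2_neq0 : A ^+ 2 - A ^- 2 != 0.
Proof.
rewrite subr_eq0; apply/negP => /eqP h.
have /A_prim/negP[] : (0 < 1 < m.+2)%N by [].
by rewrite muln1 (exprD _ 2 2) {1}h mulVf // expf_neq0.
Qed.

Lemma lam0 : lam 0 = 1.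
Proof. by rewrite /lam expr0 mul1r divff // A2_neq0. Qed.

Lemma lam1 : lam 1 = delta.
Proof.
rewrite /lam /delta; apply: (canLR (mulfK A2_neq0)); rewrite expr1.
by field.
Qed.

Lemma lamSS a : lam a.+2 = delta * lam a.+1 - lam a.
Proof.
rewrite /lam /delta.
have [-> -> ->] : [/\ 2 * a.+3 = 2 * a + 6, 2 * a.+2 = 2 * a + 4
                    & 2 * a.+1 = 2 * a + 2]%N by split; lia.
have h := A2_neq0; rewrite !exprD 2!(exprS (-1)).
apply: (mulIf h); rewrite mulrBl !mulrA !(mulfVK h).
by field; rewrite A_neq0 expf_neq0.
Qed.

Lemma lam_neq0 a : (a <= m)%N -> lam a != 0.
Proof.
move=> am; rewrite /lam !mulf_neq0 ?signr_eq0 ?invr_neq0 ?A2_neq0 //.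
rewrite subr_eq0; apply/negP => /eqP h.
have /A_prim/negP[] : (0 < a.+1 < m.+2)%N by lia.
have -> : (4 * a.+1 = 2 * a.+1 + 2 * a.+1)%N by lia.
by rewrite exprD {1}h mulVf // expf_neq0.
Qed.

(** This zero is why the graph may be cut at m: a neighbour m + 1 would enter the sums with weight
    0. *)
Lemma lam_top : lam m.+1 = 0.
Proof.
rewrite /lam; have h : A ^+ (2 * m.+2) = A ^- (2 * m.+2).
  apply: (mulIf (expf_neq0 (2 * m.+2) A_neq0)).
  rewrite mulVf ?expf_neq0 // -exprD.
  by have -> : (2 * m.+2 + 2 * m.+2 = 4 * m.+2)%N by lia.
by rewrite {1}h subrr mulr0 mul0r.
Qed.

Lemma delta_neq0 : delta != 0.
Proof. by rewrite -lam1 lam_neq0. Qed.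

Definition nbs (x : nat) : seq nat :=
  (if (x < m)%N then [:: x.+1] else [::]) ++ (if x is y.+1 then [:: y] else [::]).
Definition adj : rel nat := fun x y => y \in nbs x.

Lemma adjE x y : (x <= m)%N ->
  adj x y = (y <= m)%N && ((y == x.+1) || (x == y.+1)).
Proof.
rewrite /adj /nbs mem_cat => xm.
case: x xm => [|x] xm; case: ifP => h; rewrite ?in_nil ?mem_seq1 ?orbF ?eqSS.
all: by apply/idP/idP; lia.
Qed.

Lemma adj_le x y : (x <= m)%N -> adj x y -> (y <= m)%N.
Proof. by move=> /adjE-> /andP[]. Qed.

Lemma adj_sym x y : (x <= m)%N -> adj x y -> adj y x.
Proof. by move=> xm xy; move: xy (adj_le xm xy); rewrite adjE // => h ym; rewrite adjE //; lia. Qed.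

Lemma nbs_uniq x : uniq (nbs x).
Proof.
by rewrite /nbs; case: x => [|x]; case: ifP => //= _; rewrite inE; lia.
Qed.

Lemma sum_lam_nbs a : (a <= m)%N -> \sum_(b <- nbs a) lam b = delta * lam a.
Proof.
rewrite /nbs big_cat /= leq_eqVlt => /predU1P[->|am].
  rewrite ltnn big_nil add0r; case: m m_gt0 lam_top => // n _ top.
  by rewrite big_seq1; apply/eqP; rewrite -subr_eq0 -oppr_eq0 opprB -lamSS top.
rewrite am big_seq1; case: a am => [|a] am.
  by rewrite big_nil addr0 lam0 mulr1 lam1.
by rewrite big_seq1 lamSS subrK.
Qed.

Lemma path_le a s : (a <= m)%N -> path adj a s -> (last a s <= m)%N.
Proof. by elim: s a => //= b s IH a am /andP[/(adj_le am) bm /(IH _ bm)]. Qed.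

(* A path s starting at the vertex a of the graph 0 - 1 - ... - m assigns
   vertices to the regions met by a horizontal line.  A diagram acts on functions
   of such paths, the value on the bottom line being computed from the top line:
   reading upwards, a cup inserts b, x with weight [lam b], and a cap removes
   them with weight [1 / lam x]. *)
Fixpoint cupo p a (f : seq nat -> F) (s : seq nat) : F :=
  if p is p'.+1 then
    if s is c :: s' then cupo p' c (fun t => f (c :: t)) s' else 0
  else \sum_(b <- nbs a) lam b * f [:: b, a & s].

Fixpoint capo p a (f : seq nat -> F) (s : seq nat) : F :=
  if p is p'.+1 then
    if s is c :: s' then capo p' c (fun t => f (c :: t)) s' else 0
  else if s is [:: _, c & s'] then (if c == a then (lam a)^-1 * f s' else 0)
  else 0.

Definition Ab (b : bool) : F := if b then A else A^-1.

Definition op (a : nat) (e : slice unit) (f : seq nat -> F) (s : seq nat) : F :=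
  match e with
  | Cup _ p => cupo p a f s
  | Cap p => capo p a f s
  | Cross b p => Ab b * f s + (Ab b)^-1 * capo p a (cupo p a f) s
  end.

Fixpoint ops (a : nat) (w : word unit) (f : seq nat -> F) : seq nat -> F :=
  if w is e :: w' then op a e (ops a w' f) else f.

Lemma Ab_neq0 b : Ab b != 0.
Proof. by case: b; rewrite /= ?invr_eq0. Qed.

Lemma Ab_neg b : Ab (~~ b) = (Ab b)^-1.
Proof. by case: b; rewrite /= ?invrK. Qed.

Lemma ops_cat a x y f : ops a (x ++ y) f = ops a x (ops a y f).
Proof. by elim: x => //= e x ->. Qed.

(** Functions are compared on genuine paths only, where the relations of the calculus hold. The end
    of the path is recorded as well: a diagram never changes the region on its right, and whatever
    is placed there starts from this vertex. *)
Lemma cupo_ext p a f g s : (a <= m)%N -> path adj a s ->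
  (forall t, path adj a t -> size t = (size s).+2 -> last a t = last a s ->
     f t = g t) -> cupo p a f s = cupo p a g s.
Proof.
elim: p a f g s => [|p IH] a f g [|c s] //= am.
- move=> _ H; apply: eq_big_seq => b ab; congr (_ * _); apply: H => //=.
  by rewrite [adj a b]ab (adj_sym am ab).
- move=> /andP[ac cs] H; apply: eq_big_seq => b ab; congr (_ * _).
  by apply: H => //=; rewrite [adj a b]ab (adj_sym am ab) ac.
- move=> /andP[ac cs] H; apply: IH => //; first exact: adj_le ac.
  by move=> t ct st lt; apply: H => //=; rewrite ?ac ?st.
Qed.

Lemma capo_ext p a f g s : (a <= m)%N -> path adj a s ->
  (forall t, path adj a t -> (size t).+2 = size s -> last a t = last a s ->
     f t = g t) -> capo p a f s = capo p a g s.
Proof.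
elim: p a f g s => [|p IH] a f g [|c s] //= am /andP[ac cs].
- case: s cs => [|d s] //= /andP[cd ds] H; case: eqP => // da; subst d.
  by congr (_ * _); apply: H.
- move=> H; apply: IH => //; first exact: adj_le ac.
  by move=> t ct st lt; apply: H => //=; rewrite ?ac ?st.
Qed.

Lemma op_ext a e f g s : (a <= m)%N -> path adj a s ->
  (forall t, path adj a t -> (size t + slice_in e = size s + slice_out e)%N ->
     last a t = last a s -> f t = g t) -> op a e f s = op a e g s.
Proof.
move=> am as_; case: e => [[] p|p|b p] /= H.
- by apply: cupo_ext => // t at_ st lt; apply: H => //; rewrite st addn0 addn2.
- by apply: capo_ext => // t at_ st lt; apply: H => //; rewrite -st addn0 addn2.
- rewrite H //; congr (_ + _ * _); apply: capo_ext => // t at_ st lt.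
  apply: cupo_ext => // u au su lu; apply: H => //; first by rewrite su st.
  by rewrite lu.
Qed.

Definition insum (w : word unit) := sumn (map (@slice_in unit) w).
Definition outsum (w : word unit) := sumn (map (@slice_out unit) w).

Lemma wf_outs n w : wf n w -> (outs n w + insum w = n + outsum w)%N.
Proof.
elim: w n => //= e w IH n /andP[h /IH]; rewrite /insum /outsum /=.
by rewrite /outs1; case: e h => //= *; lia.
Qed.

Lemma ops_ext a w f g s : (a <= m)%N -> path adj a s ->
  (forall t, path adj a t -> (size t + insum w = size s + outsum w)%N ->
     last a t = last a s -> f t = g t) -> ops a w f s = ops a w g s.
Proof.
move=> am; elim: w s => [|e w IH] s as_ H /=; first exact: H.
apply: op_ext => // t at_ st lt; apply: IH => // u au su lu; apply: H => //.
  by move: su st; rewrite /insum /outsum /=; lia.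
by rewrite lu.
Qed.

Lemma ops_ext_wf a w f g s : (a <= m)%N -> path adj a s -> wf (size s) w ->
  (forall t, path adj a t -> size t = outs (size s) w ->
     last a t = last a s -> f t = g t) -> ops a w f s = ops a w g s.
Proof.
move=> am as_ /wf_outs E H; apply: ops_ext => // t at_ st lt; apply: H => //.
by apply: (@addIn (insum w)); rewrite st E.
Qed.

Lemma cupo_lin p a c f g s :
  cupo p a (fun t => c * f t + g t) s = c * cupo p a f s + cupo p a g s.
Proof.
elim: p a f g s => [|p IH] a f g [|d s] //=; rewrite ?mulr0 ?addr0 //.
all: rewrite big_distrr -big_split /=; apply: eq_bigr => b _.
all: by rewrite mulrDr mulrCA.
Qed.

Lemma capo_lin p a c f g s :
  capo p a (fun t => c * f t + g t) s = c * capo p a f s + capo p a g s.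
Proof.
elim: p a f g s => [|p IH] a f g [|d s] //=; rewrite ?mulr0 ?addr0 //.
case: s => [|e s]; rewrite ?mulr0 ?addr0 //.
by case: eqP; rewrite ?mulr0 ?addr0 // mulrDr mulrCA.
Qed.

Lemma op_lin a e c f g s :
  op a e (fun t => c * f t + g t) s = c * op a e f s + op a e g s.
Proof.
case: e => [[] p|p|b p] /=; rewrite ?cupo_lin ?capo_lin //.
have -> : cupo p a (fun t => c * f t + g t) =
          (fun t => c * cupo p a f t + cupo p a g t).
  by apply: funext => t; rewrite cupo_lin.
by rewrite capo_lin; ring.
Qed.

Lemma ops_lin a w c f g s :
  ops a w (fun t => c * f t + g t) s = c * ops a w f s + ops a w g s.
Proof.
elim: w s => //= e w IH s; rewrite -op_lin; congr (op _ _ _ _).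
exact: funext.
Qed.

Lemma ops0 a w s : ops a w (fun=> 0) s = 0.
Proof.
have := @ops_lin a w (-1) (fun=> 0) (fun=> 0) s.
have -> : (fun _ : seq nat => -1 * 0 + 0) = (fun _ : seq nat => 0 : F).
  by apply: funext => t; rewrite mulr0 addr0.
by rewrite mulN1r addNr.
Qed.

Lemma opsZ a w c f s : ops a w (fun t => c * f t) s = c * ops a w f s.
Proof.
have := ops_lin a w c f (fun=> 0) s; rewrite ops0 addr0 => <-.
by congr (ops _ _ _ _); apply: funext => t; rewrite addr0.
Qed.

Lemma ops_sum a w I (r : seq I) (P : pred I) (f : I -> seq nat -> F) s :
  ops a w (fun t => \sum_(i <- r | P i) f i t) s =
  \sum_(i <- r | P i) ops a w (f i) s.
Proof.
elim: r => [|i r IH].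
  by rewrite big_nil -[RHS](ops0 a w s); congr (ops _ _ _ _); apply: funext => t; rewrite big_nil.
rewrite big_cons -IH; case: (boolP (P i)) => Pi.
  rewrite -[X in X + _]mul1r -ops_lin; congr (ops _ _ _ _).
  by apply: funext => t; rewrite big_cons Pi mul1r.
by congr (ops _ _ _ _); apply: funext => t; rewrite big_cons (negPf Pi).
Qed.

Lemma cupo_sh p a f s t :
  cupo (size s + p) a f (s ++ t) = cupo p (last a s) (fun u => f (s ++ u)) t.
Proof. by elim: s a f => //= c s IH a f; rewrite IH. Qed.

Lemma capo_sh p a f s t :
  capo (size s + p) a f (s ++ t) = capo p (last a s) (fun u => f (s ++ u)) t.
Proof. by elim: s a f => //= c s IH a f; rewrite IH. Qed.

Lemma op_sh e a f s t : op a (shift_slice (size s) e) f (s ++ t) =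
  op (last a s) e (fun u => f (s ++ u)) t.
Proof.
case: e => [[] p|p|b p] /=; rewrite ?cupo_sh ?capo_sh //.
congr (_ + _ * capo _ _ _ _); apply: funext => u; exact: cupo_sh.
Qed.

Lemma ops_sh w a f s t : ops a (sh (size s) w) f (s ++ t) =
  ops (last a s) w (fun u => f (s ++ u)) t.
Proof.
elim: w t => //= e w IH t; rewrite op_sh; congr (op _ _ _ _).
exact: funext.
Qed.

Lemma cupo_loc p a f s t : (p <= size s)%N ->
  cupo p a f (s ++ t) = cupo p a (fun u => f (u ++ t)) s.
Proof. by elim: p a f s => [|p IH] a f [|c s] //= ps; rewrite IH. Qed.

Lemma capo_loc p a f s t : (p + 2 <= size s)%N ->
  capo p a f (s ++ t) = capo p a (fun u => f (u ++ t)) s.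
Proof.
elim: p a f s => [|p IH] a f [|c s] //= ps; last by rewrite IH.
by case: s ps.
Qed.

Lemma op_loc e a f s t : (slice_pos e + slice_in e <= size s)%N ->
  (a <= m)%N -> path adj a s ->
  op a e f (s ++ t) = op a e (fun u => f (u ++ t)) s.
Proof.
case: e => [[] p|p|b p] /= h am as_; first by rewrite cupo_loc // -[p]addn0.
  by rewrite capo_loc.
rewrite capo_loc //; congr (_ + _ * _); apply: capo_ext => // u au su lu.
by rewrite cupo_loc //; lia.
Qed.

Lemma ops_loc w a f s t : wf (size s) w -> (a <= m)%N -> path adj a s ->
  ops a w f (s ++ t) = ops a w (fun u => f (u ++ t)) s.
Proof.
move=> + am; elim: w s => //= e w IH s /andP[h1 h2] as_.
rewrite op_loc //; apply: op_ext => // u au su lu; apply: IH => //.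
by move: h2; rewrite /outs1 -su addnK.
Qed.

(** Each operator forms linear combinations of values of its argument, with coefficients that depend
    only on its own path; so operators in separate variables commute. *)
Lemma fubini a b x y (G : seq nat -> seq nat -> F) s t :
  ops a x (fun u => ops b y (G u) t) s =
  ops b y (fun v => ops a x (fun u => G u v) s) t.
Proof.
have cupF p (G' : seq nat -> seq nat -> F) a' s' :
    cupo p a' (fun u => ops b y (G' u) t) s' =
    ops b y (fun v => cupo p a' (fun u => G' u v) s') t.
  elim: p a' G' s' => [|p IH] a' G' [|c s'] /=; rewrite ?ops0 //.
  - by rewrite ops_sum; apply: eq_bigr => c' _; rewrite opsZ.
  - by rewrite ops_sum; apply: eq_bigr => c' _; rewrite opsZ.
have capF p (G' : seq nat -> seq nat -> F) a' s' :
    capo p a' (fun u => ops b y (G' u) t) s' =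
    ops b y (fun v => capo p a' (fun u => G' u v) s') t.
  elim: p a' G' s' => [|p IH] a' G' [|c s'] /=; rewrite ?ops0 //.
    case: s' => [|d s']; rewrite ?ops0 //; case: eqP; rewrite ?ops0 // => _.
    by rewrite opsZ.
elim: x G s => //= e x IH G s.
have -> : ops a x (fun u => ops b y (G u) t) =
    fun s' => ops b y (fun v => ops a x (fun u => G u v) s') t.
  by apply: funext => s'; apply: IH.
case: e => [[] p|p|c p] /=.
- exact: (cupF p (fun s' v => ops a x (fun u => G u v) s')).
- exact: (capF p (fun s' v => ops a x (fun u => G u v) s')).
rewrite ops_lin opsZ; congr (_ + _ * _).
rewrite -(capF p (fun s' v => cupo p a (ops a x (fun u => G u v)) s')).
congr (capo _ _ _ _); apply: funext => s'.
exact: (cupF p (fun s' v => ops a x (fun u => G u v) s')).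
Qed.

(* Equality of the operators on all long paths: adding strands on the right
   makes the well-formedness conditions disappear, and [eqv] is a congruence. *)
Definition eqv (x y : seq (slice unit)) : Prop :=
  exists B, forall a s f, (a <= m)%N -> path adj a s -> (B <= size s)%N ->
    ops a x f s = ops a y f s.

Lemma eqv_refl x : eqv x x.
Proof. by exists 0%N. Qed.

Lemma eqv_sym x y : eqv x y -> eqv y x.
Proof. by case=> B H; exists B => *; rewrite H. Qed.

Lemma eqv_trans y x z : eqv x y -> eqv y z -> eqv x z.
Proof.
by case=> B H [C K]; exists (B + C)%N => a s f am as_ h; rewrite H ?K //; lia.
Qed.

Lemma eqv_cat x x' y y' : eqv x x' -> eqv y y' -> eqv (x ++ y) (x' ++ y').
Proof.
case=> B H [C K]; exists (B + C + insum x')%N => a s f am as_ h.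
rewrite !ops_cat H //; last by lia.
apply: ops_ext => // t at_ st _; apply: K => //; lia.
Qed.

Lemma eqv_sh k x y : eqv x y -> eqv (sh k x) (sh k y).
Proof.
case=> B H; exists (k + B)%N => a s f am + h.
have E : size (take k s) = k by rewrite size_takel //; lia.
rewrite -(cat_take_drop k s) cat_path => /andP[h1 h2].
rewrite -{1 4}E !ops_sh; apply: H => //; first exact: path_le.
by rewrite size_drop; lia.
Qed.

(** Once [x] is localised to the first part of the path and [y] to the rest, this is [fubini]; [x]
    leaves the vertex between the two parts unchanged. *)
Lemma eqv_far n x y : wf n x ->
  eqv (x ++ sh (outs n x) y) (sh n y ++ x).
Proof.
move=> wx; exists n => a s f am + h.
have E : size (take n s) = n by rewrite size_takel.
rewrite -(cat_take_drop n s) cat_path => /andP[].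
move: (take n s) (drop n s) E => {h}s t En; subst n => h1 h2.
rewrite !ops_cat ops_sh ops_loc //.
rewrite (ops_ext_wf (g := fun u => ops (last a s) y (fun v => f (u ++ v)) t)) //.
  rewrite fubini; congr (ops _ _ _ _); apply: funext => v.
  by rewrite ops_loc.
by move=> u au su lu; rewrite -su ops_sh lu.
Qed.

Lemma adj_exists a : (a <= m)%N -> exists b, adj a b.
Proof.
case: a => [|a] am; first by exists 1%N; rewrite adjE //; have := m_gt0; lia.
by exists a; rewrite adjE //; lia.
Qed.

Lemma path_exists n a : (a <= m)%N -> exists2 s, size s = n & path adj a s.
Proof.
elim: n a => [|n IH] a am; first by exists [::].
have [b ab] := adj_exists am; have [s sn bs] := IH b (adj_le am ab).
by exists (b :: s); rewrite /= ?sn ?ab.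
Qed.

Lemma eqv_wf x y a s f : eqv x y -> wf (size s) x -> wf (size s) y ->
  (a <= m)%N -> path adj a s -> ops a x f s = ops a y f s.
Proof.
case=> B H wx wy am as_.
have [t tB lt] := path_exists B (path_le am as_).
(* The path is lengthened by the B strands that [eqv] asks for, and the test function forgets the
   last B vertices. *)
pose f' (u : seq nat) := f (take (size u - B) u).
have E w : wf (size s) w -> ops a w f s = ops a w f' (s ++ t).
  move=> ww; rewrite ops_loc //; congr (ops _ _ _ _); apply: funext => u.
  by rewrite /f' size_cat tB addnK take_size_cat.
by rewrite !E // H // ?cat_path ?as_ // size_cat tB leq_addl.
Qed.

Notation "x =~ y" := (eqv x y) (at level 70).

Instance eqv_equivalence : Equivalence eqv.
Proof. by split; [exact: eqv_refl | exact: eqv_sym | move=> x y z; exact: eqv_trans]. Qed.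

Instance cat_eqv : Proper (eqv ==> eqv ==> eqv) (@cat (slice unit)).
Proof. by move=> x x' ? y y' ?; apply: eqv_cat. Qed.

Instance cons_eqv e : Proper (eqv ==> eqv) (@cons (slice unit) e).
Proof. by move=> x x' h; exact: (@eqv_cat [:: e] _ _ _ (eqv_refl _) h). Qed.

Instance sh_eqv k : Proper (eqv ==> eqv) (sh k).
Proof. by move=> x x' ?; apply: eqv_sh. Qed.

#[local] Hint Resolve eqv_refl : core.

Section Words.
Implicit Types (u v w x y : seq (slice unit)).

Lemma zig1 p : [:: Cup tt p.+1; Cap p] =~ [::].
Proof.
have /(eqv_sh p) : [:: Cup tt 1; Cap 0] =~ [::]; last by rewrite /sh /= addn1 addn0.
exists 1%N => a [|c s] f //= am /andP[ac cs] _.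
rewrite (bigD1_seq a) ?nbs_uniq //=; last exact: (adj_sym am ac).
rewrite eqxx mulrA mulfV ?lam_neq0 // mul1r big1 ?addr0 // => b /negPf->.
by rewrite mulr0.
Qed.

Lemma zig2 p : [:: Cup tt p; Cap p.+1] =~ [::].
Proof.
have /(eqv_sh p) : [:: Cup tt 0; Cap 1] =~ [::]; last by rewrite /sh /= addn1 addn0.
exists 1%N => a [|c s] f //= am /andP[ac cs] _.
rewrite (bigD1_seq c) ?nbs_uniq //=.
rewrite eqxx mulrA mulfV ?lam_neq0 ?(adj_le am) // mul1r big1 ?addr0 // => b bc.
by rewrite eq_sym (negPf bc) mulr0.
Qed.

Lemma ops_loop p u a f s : (a <= m)%N -> path adj a s -> (p <= size s)%N ->
  ops a (Cup tt p :: Cap p :: u) f s = delta * ops a u f s.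
Proof.
move=> am as_ ps; rewrite /=; set g := ops a u f; move: g => {f u}f.
elim: p a f s am as_ ps => [|p IH] a f s am /=.
  move=> _ _; rewrite eqxx -big_distrl /= sum_lam_nbs // -mulrA.
  by rewrite mulVKf ?lam_neq0.
by case: s => [|c s] //= /andP[ac cs] ps; rewrite IH // (adj_le am).
Qed.

Lemma ops_cross a u b p v f s : ops a (u ++ Cross b p :: v) f s =
  Ab b * ops a (u ++ v) f s + (Ab b)^-1 * ops a (u ++ Cap p :: Cup tt p :: v) f s.
Proof. by rewrite !ops_cat -[X in _ + X]opsZ -ops_lin. Qed.

Lemma cross_same u v u' v' b p p' :
  u ++ v =~ u' ++ v' ->
  u ++ Cap p :: Cup tt p :: v =~ u' ++ Cap p' :: Cup tt p' :: v' ->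
  u ++ Cross b p :: v =~ u' ++ Cross b p' :: v'.
Proof.
case=> B H [C K]; exists (B + C)%N => a s f am as_ h.
by rewrite !ops_cross H ?K //; lia.
Qed.

(** Reversing the sign of a crossing exchanges its two smoothings, because [Ab (~~ b)] is the
    inverse of [Ab b]. A slide that rotates a crossing is therefore checked on smoothings matched
    crosswise. *)
Lemma cross_swap u v u' v' b p p' :
  u ++ v =~ u' ++ Cap p' :: Cup tt p' :: v' ->
  u ++ Cap p :: Cup tt p :: v =~ u' ++ v' ->
  u ++ Cross b p :: v =~ u' ++ Cross (~~ b) p' :: v'.
Proof.
case=> B H [C K]; exists (B + C)%N => a s f am as_ h.
by rewrite !ops_cross H ?K ?Ab_neg ?invrK 1?addrC //; lia.
Qed.

Lemma cup_slide1 b p :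
  [:: Cup tt p; Cross b p.+1] =~ [:: Cup tt p.+1; Cross (~~ b) p].
Proof.
apply: (@cross_swap [:: _] [::] [:: _] [::]); symmetry.
  by rewrite -[_ ++ _]/([:: Cup tt p.+1; Cap p] ++ [:: Cup tt p]) zig1 /=.
by rewrite -[_ ++ [:: _; _]]/([:: Cup tt p; Cap p.+1] ++ [:: Cup tt p.+1]) zig2 /=.
Qed.

Lemma cap_slide1 b p :
  [:: Cross b p.+1; Cap p] =~ [:: Cross (~~ b) p; Cap p.+1].
Proof.
apply: (@cross_swap [::] [:: _] [::] [:: _]); symmetry.
  by rewrite -[_ ++ _]/([:: Cap p] ++ [:: Cup tt p; Cap p.+1]) zig2 /=.
by rewrite -[_ ++ [:: _; _; _]]/([:: Cap p.+1] ++ [:: Cup tt p.+1; Cap p]) zig1 /=.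
Qed.

Lemma reid2 b p : [:: Cross b p; Cross (~~ b) p] =~ [::].
Proof.
exists p.+2 => a s f am as_ h.
rewrite (ops_cross a [::]) !(ops_cross _ [:: _; _] _ _ [::]) (ops_cross _ [::] _ _ [::]) /=.
have E : capo p a (cupo p a (capo p a (cupo p a f))) s = delta * capo p a (cupo p a f) s.
  have -> : delta * capo p a (cupo p a f) s = capo p a (fun t => delta * cupo p a f t) s.
    by rewrite -[LHS](opsZ a [:: Cap p]).
  apply: capo_ext => // t at_ st lt.
  by apply: (@ops_loop p [:: Cup tt p]) => //; lia.
rewrite E Ab_neg !invrK; have := Ab_neq0 b; rewrite /delta.
rewrite -![op a (Cup tt p) f]/(cupo p a f).
by case: b => /= B0; field; rewrite ?A_neq0 ?oner_eq0.
Qed.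

(** One smoothing of the kink splits off a loop and the other straightens by two zigzags, so the
    scalar is [Ab b * delta + (Ab b)^-1]. *)
Lemma kinkR p b a f s : (a <= m)%N -> path adj a s -> (p < size s)%N ->
  ops a [:: Cup tt p.+1; Cross b p; Cap p.+1] f s = - Ab b ^+ 3 * f s.
Proof.
move=> am as_ ps; rewrite (ops_cross a [:: _]) !cat1s.
rewrite (@ops_loop p.+1 [::]) //.
rewrite -[ops _ [:: _, _, _ & _] _ _]/(ops a ([:: Cup tt p.+1; Cap p] ++ [:: Cup tt p; Cap p.+1]) f s).
rewrite (@eqv_wf _ [::]) //; first 1 last.
- by rewrite zig1 zig2.
- by rewrite /= /outs1 /=; lia.
rewrite /delta; have := Ab_neq0 b.
by case: b => /= B0; field; rewrite ?A_neq0 ?oner_eq0.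
Qed.

Lemma kinkL p b a f s : (a <= m)%N -> path adj a s -> (p < size s)%N ->
  ops a [:: Cup tt p; Cross b p.+1; Cap p] f s = - Ab b ^+ 3 * f s.
Proof.
move=> am as_ ps; rewrite (ops_cross a [:: _]) !cat1s.
rewrite (@ops_loop p [::]) //; last by lia.
rewrite -[ops _ [:: _, _, _ & _] _ _]/(ops a ([:: Cup tt p; Cap p.+1] ++ [:: Cup tt p.+1; Cap p]) f s).
rewrite (@eqv_wf _ [::]) //; first 1 last.
- by rewrite zig2 zig1.
- by rewrite /= /outs1 /=; lia.
rewrite /delta; have := Ab_neq0 b.
by case: b => /= B0; field; rewrite ?A_neq0 ?oner_eq0.
Qed.

(* One strand moving to the left, resp. right, across n strands. *)
Definition L b p n : seq (slice unit) := [seq Cross b (p + i)%N | i <- rev (iota 0 n)].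
Definition Rr b p n : seq (slice unit) := [seq Cross b (p + i)%N | i <- iota 0 n].

Lemma L_S b p n : L b p n.+1 = Cross b (p + n)%N :: L b p n.
Proof. by rewrite /L -addn1 iotaD rev_cat. Qed.

Lemma Rr_S b p n : Rr b p n.+1 = Rr b p n ++ [:: Cross b (p + n)%N].
Proof. by rewrite /Rr -addn1 iotaD map_cat. Qed.

Lemma sh_L k b p n : sh k (L b p n) = L b (k + p) n.
Proof. by elim: n => // n IH; rewrite !L_S /= IH addnA. Qed.

Lemma L_add b p n n' : L b p (n + n') = L b (p + n) n' ++ L b p n.
Proof. by elim: n' => [|n' IH]; rewrite ?addn0 // addnS !L_S IH -addnA. Qed.

Lemma wf_L b p n N : wf N (L b p n) = (n == 0)%N || (p + n < N)%N.
Proof.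
elim: n => // n IH; rewrite L_S /= /outs1 /= addnK IH.
by apply/idP/idP; lia.
Qed.

Lemma outs_L b p n N : outs N (L b p n) = N.
Proof. by elim: n => // n IH; rewrite L_S /= /outs1 /= addnK. Qed.

Lemma outs_Rr b p n N : outs N (Rr b p n) = N.
Proof. by elim: n => // n IH; rewrite Rr_S outs_cat IH /= /outs1 /= addnK. Qed.

Lemma wf_Rr b p n N : wf N (Rr b p n) = (n == 0)%N || (p + n < N)%N.
Proof.
elim: n => // n IH; rewrite Rr_S wf_cat IH outs_Rr /=.
by apply/idP/idP; lia.
Qed.

Lemma LRr b p n : L b p n ++ Rr (~~ b) p n =~ [::].
Proof.
elim: n => // n IH; rewrite L_S Rr_S.
rewrite -[_ ++ _]/([:: Cross b (p + n)%N] ++ (L b p n ++ (Rr (~~ b) p n ++ [:: Cross (~~ b) (p + n)%N]))).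
by rewrite (catA (L _ _ _)) IH /= reid2.
Qed.

(** * Blocks of parallel strands *)

(** A cup or a cap passes the strand by a slide and a second Reidemeister move. For a crossing this
    is the third Reidemeister move: the crossing is resolved, and its cap-cup smoothing passes by
    the two cases just obtained. *)
Lemma nat_L1 b e : slice_pos e = 0%N ->
  e :: L b 0 (slice_out e) =~ L b 0 (slice_in e) ++ [:: shift_slice 1 e].
Proof.
have cup : [:: Cup tt 0; Cross b 1; Cross b 0] =~ [:: Cup tt 1].
  rewrite -[[:: _; _; _]]/([:: Cup tt 0; Cross b 1] ++ [:: Cross b 0]) cup_slide1.
  by rewrite -[_ ++ _]/([:: Cup tt 1] ++ [:: Cross (~~ b) 0; Cross b 0]) -{2}[b]negbK reid2.
have cap : [:: Cap 0] =~ [:: Cross b 1; Cross b 0; Cap 1].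
  rewrite -[[:: _; _; _]]/([:: Cross b 1] ++ [:: Cross b 0; Cap 1]) -{2}[b]negbK.
  rewrite -cap_slide1 -[_ ++ _]/([:: Cross b 1; Cross (~~ b) 1] ++ [:: Cap 0]).
  by rewrite reid2.
case: e => [[] p|p|c p] /= ->; rewrite /L //=.
apply: (@cross_same [::] [:: _; _] [:: _; _] [::]) => //=.
rewrite -[[:: _; _; _; _]]/([:: Cap 0] ++ [:: Cup tt 0; Cross b 1; Cross b 0]).
by rewrite cup cap.
Qed.

(** The long strand crosses in three stages: the strands to the right of the slice, those that the
    slice touches, and those to its left. Only the middle stage is more than a distant
    commutation. *)
Lemma nat_Le b n e : (slice_pos e + slice_in e <= n)%N ->
  e :: L b 0 (outs1 n e) =~ L b 0 n ++ [:: shift_slice 1 e].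
Proof.
move=> h.
have [e0 pos0 Ee] : exists2 e0, slice_pos e0 = 0%N & e = shift_slice (slice_pos e) e0.
  by case: e {h} => [t p|p|c p]; [exists (Cup t 0)|exists (Cap 0)|exists (Cross c 0)];
     rewrite //= addn0.
move: (slice_pos e) h Ee => q h Ee; pose j := (n - q - slice_in e)%N.
have qE : slice_pos e = q by rewrite Ee slice_pos_sh pos0 addn0.
have -> : outs1 n e = (q + slice_out e + j)%N by rewrite /outs1 /j; lia.
have -> : n = (q + slice_in e + j)%N by rewrite /j; lia.
rewrite !L_add !add0n.
have far1 : [:: e] ++ L b (q + slice_out e) j =~ L b (q + slice_in e) j ++ [:: e].
  have := @eqv_far (q + slice_in e) [:: e] (L b 0 j).
  rewrite !sh_L !addn0 /= qE leqnn => /(_ isT).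
  suff -> : outs1 (q + slice_in e) e = (q + slice_out e)%N by [].
  by rewrite /outs1; lia.
have far2 : L b 0 q ++ [:: shift_slice 1 e] =~ [:: shift_slice 1 e] ++ L b 0 q.
  have := @eqv_far q.+1 (L b 0 q) [:: e0].
  rewrite outs_L wf_L ltnS leqnn orbT => /(_ isT) h1.
  suff E : [:: shift_slice 1 e] = sh q.+1 [:: e0] by rewrite E.
  by rewrite Ee; case: (e0).
have base : [:: e] ++ L b q (slice_out e) =~ L b q (slice_in e) ++ [:: shift_slice 1 e].
  have := eqv_sh q (@nat_L1 b e0 _); rewrite -cat1s !sh_cat !sh_L !addn0.
  have -> : sh q [:: shift_slice 1 e0] = [:: shift_slice 1 e].
    by rewrite Ee; case: (e0) => * /=; rewrite !addnA ?[(1 + q)%N]addnC.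
  have -> : sh q [:: e0] = [:: e] by rewrite Ee.
  have -> : slice_in e0 = slice_in e by rewrite Ee slice_in_sh.
  have -> : slice_out e0 = slice_out e by rewrite Ee slice_out_sh.
  exact.
rewrite -cat1s catA far1 -!catA far2 [X in _ ++ X]catA base.
by rewrite -!catA.
Qed.

Lemma nat_L b n x : wf n x -> x ++ L b 0 (outs n x) =~ L b 0 n ++ sh 1 x.
Proof.
elim: x n => /= [|e x IH] n; first by rewrite cats0.
move=> /andP[h1 h2]; rewrite -cat1s IH // catA cat1s nat_Le //.
by rewrite -catA.
Qed.
End Words.

Section Tails.
Implicit Types u v w x y z t : seq (slice unit).
Lemma tl2 u v z : u ++ v =~ z -> forall t, u ++ (v ++ t) =~ z ++ t.
Proof. by move=> h t; rewrite catA h. Qed.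
Lemma tl3 u v w z : u ++ v ++ w =~ z -> forall t, u ++ (v ++ (w ++ t)) =~ z ++ t.
Proof. by move=> h t; rewrite -h -!catA. Qed.

Lemma far p n x y : wf n x ->
  sh p x ++ sh (p + outs n x) y =~ sh (p + n) y ++ sh p x.
Proof. by move=> wx; rewrite -!shD -!sh_cat eqv_far. Qed.
End Tails.

(* [X b k l p] crosses the k strands at p with the l strands to their right. *)
Definition X b k l p : seq (slice unit) :=
  [seq Cross b (p + j + i)%N | j <- iota 0 l, i <- rev (iota 0 k)].
Definition cupn k p : seq (slice unit) := [seq Cup tt (p + j)%N | j <- iota 0 k].
Definition capn k p : seq (slice unit) := [seq Cap (p + j)%N | j <- rev (iota 0 k)].

Lemma X_Sr b k l p : X b k l.+1 p = X b k l p ++ L b (p + l) k.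
Proof. by rewrite /X -addn1 iotaD allpairs_cat /= cats0. Qed.

Lemma X_0l b l p : X b 0 l p = [::].
Proof. by elim: l => // l IH; rewrite X_Sr IH. Qed.

Lemma X_addr b k l l' p : X b k (l + l') p = X b k l p ++ X b k l' (p + l).
Proof.
by elim: l' => [|l' IH]; rewrite ?addn0 ?cats0 // addnS !X_Sr IH -catA addnA.
Qed.

Lemma X_1r b k p : X b k 1 p = L b p k.
Proof. by rewrite X_Sr addn0. Qed.

Lemma X_1l b l p : X b 1 l p = Rr b p l.
Proof.
by elim: l => // l IH; rewrite X_Sr Rr_S IH /L /= addn0.
Qed.

Lemma sh_X q b k l p : sh q (X b k l p) = X b k l (q + p).
Proof. by elim: l => // l IH; rewrite !X_Sr sh_cat IH sh_L addnA. Qed.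

Lemma outs_X b k l p N : outs N (X b k l p) = N.
Proof. by elim: l => // l IH; rewrite X_Sr outs_cat IH outs_L. Qed.

Lemma wf_X b k l p N : (p + k + l <= N)%N -> wf N (X b k l p).
Proof.
elim: l => // l IH h; rewrite X_Sr wf_cat IH ?outs_X ?wf_L; last by lia.
by apply/orP; right; lia.
Qed.

Lemma cupn_add k l p : cupn (k + l) p = cupn k p ++ cupn l (p + k).
Proof.
by rewrite /cupn iotaD map_cat add0n; congr (_ ++ _); rewrite -[k in LHS]addn0
  iotaDl -map_comp; apply: eq_map => j /=; rewrite addnA.
Qed.

Lemma capn_add k l p : capn (k + l) p = capn l (p + k) ++ capn k p.
Proof.
by rewrite /capn iotaD rev_cat map_cat add0n; congr (_ ++ _); rewrite -[k in LHS]addn0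
  iotaDl -map_rev -map_comp; apply: eq_map => j /=; rewrite addnA.
Qed.

Lemma cupn1 p : cupn 1 p = [:: Cup tt p].
Proof. by rewrite /cupn /= addn0. Qed.
Lemma capn1 p : capn 1 p = [:: Cap p].
Proof. by rewrite /capn /= addn0. Qed.

Lemma sh_cupn q k p : sh q (cupn k p) = cupn k (q + p).
Proof. by rewrite /sh -map_comp; apply: eq_map => j /=; rewrite addnA. Qed.
Lemma sh_capn q k p : sh q (capn k p) = capn k (q + p).
Proof. by rewrite /sh -map_comp; apply: eq_map => j /=; rewrite addnA. Qed.

Lemma outs_cupn k p N : outs N (cupn k p) = (N + k.*2)%N.
Proof.
elim: k => [|k IH]; first by rewrite addn0.
by rewrite -addn1 cupn_add outs_cat IH cupn1 /= /outs1 /=; lia.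
Qed.

Lemma wf_cupn k p N : (p <= N)%N -> wf N (cupn k p).
Proof.
elim: k => // k IH h; rewrite -addn1 cupn_add wf_cat IH // cupn1 outs_cupn /=.
by lia.
Qed.

Lemma outs_capn k p N : outs N (capn k p) = (N - k.*2)%N.
Proof.
elim: k p N => [|k IH] p N; first by rewrite subn0.
by rewrite -addn1 capn_add outs_cat capn1 IH /= /outs1 /=; lia.
Qed.

Lemma wf_capn k p N : (p + k.*2 <= N)%N -> wf N (capn k p).
Proof.
elim: k N => // k IH N h; rewrite -addn1 capn_add wf_cat capn1 IH /= /outs1 /=; lia.
Qed.

Ltac wfs := rewrite ?wf_cat ?outs_cat ?outs_X ?outs_cupn ?outs_capn;
  repeat (apply/andP; split);
  rewrite ?wf_X ?wf_cupn ?wf_capn ?outs_X ?outs_cupn ?outs_capn //; lia.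

Lemma farXX b k l p c k' l' p' : (p + k + l <= p')%N ->
  X b k l p ++ X c k' l' p' =~ X c k' l' p' ++ X b k l p.
Proof.
move=> h; have := @far 0 p' (X b k l p) (X c k' l' 0).
by rewrite !sh_X outs_X ?sh0 !addn0 !add0n; apply; wfs.
Qed.

Lemma farXcup b k l p k' p' : (p + k + l <= p')%N ->
  X b k l p ++ cupn k' p' =~ cupn k' p' ++ X b k l p.
Proof.
move=> h; have := @far 0 p' (X b k l p) (cupn k' 0).
by rewrite !sh_cupn outs_X ?sh0 !addn0 !add0n; apply; wfs.
Qed.

Lemma farXcap b k l p k' p' : (p + k + l <= p')%N ->
  X b k l p ++ capn k' p' =~ capn k' p' ++ X b k l p.
Proof.
move=> h; have := @far 0 p' (X b k l p) (capn k' 0).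
by rewrite !sh_capn outs_X ?sh0 !addn0 !add0n; apply; wfs.
Qed.

Lemma farcup k p y n : (p <= n)%N -> cupn k p ++ sh (n + k.*2) y =~ sh n y ++ cupn k p.
Proof.
move=> h; have := @far 0 n (cupn k p) y; rewrite outs_cupn sh0 !add0n; apply; wfs.
Qed.

Lemma farcap k p y n : (p <= n)%N -> capn k p ++ sh n y =~ sh (n + k.*2) y ++ capn k p.
Proof.
move=> h; have := @far 0 (n + k.*2)%N (capn k p) y; rewrite outs_capn sh0 !add0n addnK.
by apply; wfs.
Qed.

(** Naturality of the braiding [X] in its left block. With the hexagon relations [X_addl] and
    [X_addr] it turns the later identities between cables into formal computations in a braided
    category. *)
Lemma natl b k l p x : wf k x ->
  sh p x ++ X b (outs k x) l p =~ X b k l p ++ sh (p + l) x.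
Proof.
move=> wx; suff {p} H : x ++ X b (outs k x) l 0 =~ X b k l 0 ++ sh l x.
  by have := eqv_sh p H; rewrite !sh_cat !sh_X shD addn0.
elim: l => [|l IH]; first by rewrite sh0 cats0.
rewrite !X_Sr add0n catA IH -!catA -[l.+1]addn1 -shD.
have := eqv_sh l (nat_L b wx); rewrite !sh_cat !sh_L !addn0 => ->.
by [].
Qed.

Lemma X_addl b k k' l p :
  X b (k + k') l p =~ X b k' l (p + k) ++ X b k l p.
Proof.
elim: l => // l IH; rewrite !X_Sr IH L_add -!catA (addnAC p l k) -[L b _ k']X_1r.
by rewrite (tl2 (@farXX _ _ _ _ _ _ _ _ (leqnn _))) X_1r -!catA.
Qed.

Lemma X_inv b k l p : X b k l p ++ X (~~ b) l k p =~ [::].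
Proof.
elim: l => [|l IH]; first by rewrite X_0l.
by rewrite X_Sr -[l.+1]addn1 X_addl X_1l -!catA (tl2 (@LRr _ _ _)).
Qed.

Lemma X_invN b k l p : X (~~ b) k l p ++ X b l k p =~ [::].
Proof. by rewrite -{2}[b]negbK X_inv. Qed.

Lemma natr b k l p y : wf l y ->
  sh (p + k) y ++ X b k (outs l y) p =~ X b k l p ++ sh p y.
Proof.
move=> wy; rewrite -[X in X =~ _]cat0s -(X_inv b k l p) -catA.
have H := eqv_sym (natl (~~ b) k p wy).
by rewrite (tl2 H) -!catA X_invN cats0.
Qed.

(** Naturality of the braiding applied to a crossing. Here the sign [a] is free, in [R3r] it is
    another one; together they cover all triples of signs except the cyclic ones. *)
Lemma R3l a b k l n p :
  X a k l p ++ X b k n (p + l) ++ X b l n p =~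
  X b l n (p + k) ++ X b k n p ++ X a k l (p + n).
Proof.
have E : X b (k + l) n p =~ X b k n (p + l) ++ X b l n p by rewrite addnC X_addl.
have wx : wf (k + l) (X a k l 0) by wfs.
have := natl b n p wx; rewrite outs_X !sh_X !addn0 {1}E X_addl -!catA.
exact.
Qed.

Lemma R3r a c k l n p :
  X a k l p ++ X a k n (p + l) ++ X c l n p =~
  X c l n (p + k) ++ X a k n p ++ X a k l (p + n).
Proof.
have wx : wf (l + n) (X c l n 0) by wfs.
have E : X a k (l + n) p = X a k n p ++ X a k l (p + n) by rewrite addnC X_addr.
by have := natr a k p wx; rewrite outs_X !sh_X !addn0 {1}E X_addr -!catA => ->.
Qed.

Lemma zig1n k p : cupn k (p + k) ++ capn k p =~ [::].
Proof.
elim: k => // k IH; rewrite -add1n cupn_add -[(1 + k)%N]addn1 capn_add cupn1 capn1 -catA.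
have -> : (p + (k + 1) + 1 = p + k + 2)%N by lia.
have := @far 0 (p + k + 2) [:: Cap (p + k)%N] (cupn k 0).
rewrite sh0 !sh_cupn !addn0 !add0n /= /outs1 /= addn0 addnK leqnn => /(_ isT) H.
rewrite -[Cap _ :: _]cat1s in H; rewrite (tl2 (eqv_sym H)) -!catA IH cats0.
by rewrite addnA addn1 zig1.
Qed.

Lemma zig2n k p : cupn k p ++ capn k (p + k) =~ [::].
Proof.
elim: k p => // k IH p; rewrite -{1}[k.+1]addn1 cupn_add cupn1 -add1n capn_add capn1 -catA.
have H : [:: Cup tt (p + k)] ++ capn k (p + k + 2) =~ capn k (p + k) ++ [:: Cup tt (p + k)].
  have := @far (p + k) 0 [:: Cup tt 0] (capn k 0).
  by rewrite !sh_capn !addn0 /= !addn0; apply.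
have -> : (p + (1 + k) + 1 = p + k + 2)%N by lia.
have -> : (p + (1 + k) = (p + k).+1)%N by lia.
rewrite (tl2 H) -!catA (tl2 (IH p)) /=.
exact: zig2.
Qed.

Fact curl_key : unit. Proof. exact: tt. Qed.
(** A kink on a band of k strands, the twist of a ribbon category. The lock keeps rewriting from
    opening it into cups, crossings and caps. *)
Definition curlR b k p : seq (slice unit) :=
  locked_with curl_key (cupn k (p + k) ++ X b k k p ++ capn k (p + k)).
Definition curlL b k p : seq (slice unit) :=
  locked_with curl_key (cupn k p ++ X b k k (p + k) ++ capn k p).

Lemma curlRE b k p : curlR b k p = cupn k (p + k) ++ X b k k p ++ capn k (p + k).
Proof. exact: locked_withE. Qed.
Lemma curlLE b k p : curlL b k p = cupn k p ++ X b k k (p + k) ++ capn k p.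
Proof. exact: locked_withE. Qed.

Lemma sh_curlR q b k p : sh q (curlR b k p) = curlR b k (q + p).
Proof. by rewrite !curlRE !sh_cat sh_cupn sh_X sh_capn addnA. Qed.
Lemma sh_curlL q b k p : sh q (curlL b k p) = curlL b k (q + p).
Proof. by rewrite !curlLE !sh_cat sh_cupn sh_X sh_capn addnA. Qed.
Lemma outs_curlR b k p N : outs N (curlR b k p) = N.
Proof. by rewrite curlRE !outs_cat outs_X outs_cupn outs_capn addnK. Qed.
Lemma outs_curlL b k p N : outs N (curlL b k p) = N.
Proof. by rewrite curlLE !outs_cat outs_X outs_cupn outs_capn addnK. Qed.
Lemma wf_curlR b k p N : (p + k <= N)%N -> wf N (curlR b k p).
Proof. by move=> h; rewrite curlRE; wfs. Qed.
Lemma wf_curlL b k p N : (p + k <= N)%N -> wf N (curlL b k p).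
Proof. by move=> h; rewrite curlLE; wfs. Qed.

(** There is nothing to cross below the cups, so by naturality the crossings of the l strands with
    both feet cancel; half of them is then moved to the other side. *)
Lemma cup_slide b k l p :
  cupn k p ++ X b k l (p + k) =~ cupn k (p + l) ++ X (~~ b) l k p.
Proof.
have wx : wf 0 (cupn k 0) by wfs.
have := natl b l p wx; rewrite outs_cupn !sh_cupn !addn0 add0n X_0l -addnn X_addl /= => <-.
by rewrite -!catA X_inv cats0.
Qed.

Lemma cap_slide b k l p :
  X b l k (p + k) ++ capn k p =~ X (~~ b) k l p ++ capn k (p + l).
Proof.
have wx : wf k.*2 (capn k 0) by wfs.
have := natl (~~ b) l p wx; rewrite outs_capn !sh_capn !addn0 subnn X_0l cats0.
move=> ->; rewrite -addnn X_addl -!catA -{1}[b]negbK.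
by rewrite (tl2 (X_invN _ _ _ _)).
Qed.

(** The balancing relation of a twist. After the hexagon relations have opened the curl, its part on
    l strands is slid down to the bottom; a third Reidemeister move and distant commutations reorder
    the rest. *)
Lemma curlR_add b k l p : curlR b (k + l) p =~
  curlR b l (p + k) ++ X b k l p ++ curlR b k (p + l) ++ X b l k p.
Proof.
suff {p} H : curlR b (k + l) 0 =~
  curlR b l k ++ X b k l 0 ++ curlR b k l ++ X b l k 0.
  have := eqv_sh p H; rewrite sh_curlR sh_cat [sh p (X _ _ _ _ ++ _)]sh_cat.
  by rewrite [sh p (curlR _ _ _ ++ _)]sh_cat !sh_curlR !sh_X !addn0.
rewrite curlRE add0n cupn_add capn_add X_addr -!catA add0n.
rewrite (tl2 (eqv_sym (@farXcup _ _ _ _ _ _ _))); last by lia.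
rewrite [X b (k + l) l k]X_addl -!catA.
rewrite (tl2 (@farXcap b k l k l (k + l + k) _)); last by lia.
have -> : cupn l (k + l + k) ++ X b l l (k + k) ++ (capn l (k + l + k) ++ X b k l k) ++ capn k (k + l)
   = curlR b l (k + k) ++ X b k l k ++ capn k (k + l).
  by rewrite curlRE -!catA (_ : k + k + l = k + l + k)%N //; lia.
rewrite [X b (k + l) k 0]X_addl add0n -!catA.
have wc : wf l (curlR b l 0) by apply: wf_curlR.
have wX : wf (k + k) (X b k k 0) by wfs.
have F1 : X b k k 0 ++ curlR b l (k + k) =~ curlR b l (k + k) ++ X b k k 0.
  have := @far 0 (k + k) (X b k k 0) (curlR b l 0) wX.
  by rewrite outs_X !sh_curlR !sh0 !addn0 !add0n.
have F2 : X b l k k ++ curlR b l (k + k) =~ curlR b l k ++ X b l k k.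
  by have := natl b k k wc; rewrite outs_curlR !sh_curlR !addn0 => ->.
have F3 : cupn k (k + l) ++ curlR b l k =~ curlR b l k ++ cupn k (k + l).
  have := @far k l (curlR b l 0) (cupn k 0) wc.
  by rewrite outs_curlR !sh_curlR !sh_cupn !addn0 => ->.
rewrite (tl2 F1) -catA (tl2 F2) -catA (tl2 F3) -catA.
have /eqv_sym/tl3 F4 := @R3l b b k l k 0; rewrite !add0n in F4; rewrite F4 -!catA.
rewrite (tl2 (eqv_sym (@farXcup b k l 0 k (k + l) _))) // -!catA.
rewrite (@farXcap b l k 0 k (k + l) _); last by lia.
by rewrite [curlR b k l]curlRE -!catA [(l + k)%N]addnC.
Qed.

Lemma curlL_add b k l p : curlL b (k + l) p =~
  curlL b k p ++ X b k l p ++ curlL b l p ++ X b l k p.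
Proof.
suff {p} H : curlL b (k + l) 0 =~
  curlL b k 0 ++ X b k l 0 ++ curlL b l 0 ++ X b l k 0.
  have := eqv_sh p H; rewrite sh_curlL sh_cat [sh p (X _ _ _ _ ++ _)]sh_cat.
  by rewrite [sh p (curlL _ _ _ ++ _)]sh_cat !sh_curlL !sh_X !addn0.
have Ecup : cupn (k + l) 0 = cupn l 0 ++ cupn k l by rewrite addnC cupn_add.
have Ecap : capn (k + l) 0 = capn k l ++ capn l 0 by rewrite addnC capn_add.
rewrite [curlL b (k + l) 0]curlLE add0n Ecup Ecap X_addr -!catA.
rewrite [X b (k + l) k _]X_addl [X b (k + l) l _]X_addl -!catA.
have F1 : X b k l (k + l + k) ++ capn k l =~ capn k l ++ X b k l l.
  have -> : (k + l + k = l + k.*2)%N by lia.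
  by have := @farcap k l (X b k l 0) l (leqnn _); rewrite !sh_X !addn0 => ->.
have F2 : X b l l (k + l + k + k) ++ capn k l =~ capn k l ++ X b l l (k + l).
  have -> : (k + l + k + k = k + l + k.*2)%N by lia.
  by have := @farcap k l (X b l l 0) (k + l) (leq_addl _ _); rewrite !sh_X !addn0 => ->.
have F3 : cupn k l ++ X b l k (k + l + k) =~ X b l k l ++ cupn k l.
  have -> : (k + l + k = l + k.*2)%N by lia.
  by have := @farcup k l (X b l k 0) l (leqnn _); rewrite !sh_X !addn0 => ->.
rewrite (tl2 F1) -!catA (tl2 F2) -!catA (tl2 F3) -!catA.
have -> : cupn k l ++ X b k k (k + l) ++ capn k l ++ X b l l (k + l) ++ X b k l l ++ capn l 0
   = curlL b k l ++ X b l l (l + k) ++ X b k l l ++ capn l 0.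
  by rewrite curlLE -!catA [(l + k)%N]addnC.
have wc : wf k (curlL b k 0) by apply: wf_curlL.
have F4 : X b l k l ++ curlL b k l =~ curlL b k (l + l) ++ X b l k l.
  by have := natr b l l wc; rewrite outs_curlL !sh_curlL !addn0 => ->.
have F5 : cupn l 0 ++ curlL b k (l + l) =~ curlL b k 0 ++ cupn l 0.
  have := @farcup l 0 (curlL b k 0) 0 (leqnn _).
  by rewrite !sh_curlL !addn0 add0n addnn.
rewrite (tl2 F4) -catA (tl2 F5) -catA.
have /tl3 F6 := @R3l b b l k l l; rewrite F6 -!catA.
have F7 : cupn l 0 ++ X b k l (l + l) =~ X b k l 0 ++ cupn l 0.
  have := @farcup l 0 (X b k l 0) 0 (leqnn _).
  by rewrite !sh_X !addn0 add0n addnn.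
have F8 : X b l k (l + l) ++ capn l 0 =~ capn l 0 ++ X b l k 0.
  have := @farcap l 0 (X b l k 0) 0 (leqnn _).
  by rewrite !sh_X !addn0 add0n addnn => ->.
by rewrite (tl2 F7) -catA F8 [curlL b l 0]curlLE -!catA add0n.
Qed.

Lemma curl0 b p : curlR b 0 p = [::] /\ curlL b 0 p = [::].
Proof. by rewrite curlRE curlLE. Qed.

(** The framed first Reidemeister move for cables: on one strand both curls are the same scalar, and
    the two balancing relations carry this to k strands. *)
Lemma curl_LR b k p : curlL b k p =~ curlR b k p.
Proof.
elim: k => // k IH; rewrite -addn1 curlL_add curlR_add IH.
have K : curlL b 1 p =~ curlR b 1 p.
  exists p.+1 => a s f am as_ h.
  rewrite curlLE curlRE !cupn1 !capn1 !X_1r !addn1 /L /= !addn0.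
  exact: etrans (kinkL _ _ _ _ _) (esym (kinkR _ _ _ _ _)).
rewrite K.
have w1 : wf 1 (curlR b 1 0) by apply: wf_curlR.
have wk : wf k (curlR b k 0) by apply: wf_curlR.
have H1 : X b k 1 p ++ curlR b 1 p =~ curlR b 1 (p + k) ++ X b k 1 p.
  by have := natr b k p w1; rewrite outs_curlR !sh_curlR !addn0 => ->.
have H2 : X b k 1 p ++ curlR b k (p + 1) =~ curlR b k p ++ X b k 1 p.
  by have := natl b 1 p wk; rewrite outs_curlR !sh_curlR !addn0 => ->.
have H3 : curlR b k p ++ curlR b 1 (p + k) =~ curlR b 1 (p + k) ++ curlR b k p.
  have := @far p k _ (curlR b 1 0) wk.
  by rewrite outs_curlR !sh_curlR !addn0.
by rewrite (tl2 H1) (tl2 H2) -!catA (tl2 H3) -!catA.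
Qed.

(** * Closed planar diagrams and the loop count *)

Section Loops.
Local Open Scope nat_scope.

Lemma split1 (T : Type) p (s : seq T) : p < size s ->
  exists s1 a s2, s = s1 ++ a :: s2 /\ size s1 = p.
Proof.
move=> h; exists (take p s); case E : (drop p s) => [|a s2].
  by have := size_drop p s; rewrite E /=; lia.
by exists a, s2; rewrite -E cat_take_drop size_takel // ltnW.
Qed.

Lemma split2 (T : Type) p (s : seq T) : p + 2 <= size s ->
  exists s1 a b s2, s = s1 ++ a :: b :: s2 /\ size s1 = p.
Proof.
move=> h; have [|s1 [a [s2 [E E1]]]] := @split1 _ p s; first by lia.
case: s2 E h => [|b s2] -> h; first by rewrite size_cat /= in h; lia.
by exists s1, a, b, s2.
Qed.

Lemma split3 (T : Type) p (s : seq T) : p <= size s ->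
  exists s1 s2, s = s1 ++ s2 /\ size s1 = p.
Proof. by move=> h; exists (take p s), (drop p s); rewrite cat_take_drop size_takel. Qed.

Lemma loops_cup (T : Type) (t : T) k s1 s2 w :
  loops_from k (s1 ++ s2) (Cup t (size s1) :: w) = loops_from k.+1 (s1 ++ k :: k :: s2) w.
Proof. by rewrite /= take_size_cat // drop_size_cat. Qed.

Lemma loops_cap (T : Type) k s1 a b s2 (w : word T) :
  loops_from k (s1 ++ a :: b :: s2) (Cap (size s1) :: w) =
  (a == b) + loops_from k [seq if x == a then b else x | x <- s1 ++ s2] w.
Proof.
rewrite /= take_size_cat // !nth_cat ltnn subnn ltnNge leqnSn /= subSnn /=.
by rewrite -[(size s1).+2]/(2 + size s1)%N -drop_drop drop_size_cat //= drop0.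
Qed.

Lemma loops_inj w n k k' s (rho : nat -> nat) : wf n w -> size s = n ->
  ~~ has (fun e => if e is Cross _ _ then true else false) w ->
  all (gtn k) s -> all (gtn k') (map rho s) -> {in s &, injective rho} ->
  loops_from k' (map rho s) w = loops_from k s w.
Proof.
elim: w n k k' s rho => // e w IH n k k' s rho /= /andP[h1 h2] sn.
rewrite negb_or => /andP[ne nw] sk sk' inj.
case: e h1 h2 ne => [t p|p|b p] //= h1 h2 _.
- have [|s1 [s2 [E E1]]] := @split3 _ p s; first by lia.
  (* The renaming is extended to the fresh name, which on either side differs from all names in
     use. *)
  pose rho' x := if x == k then k' else rho x.
  have mE u : all (gtn k) u -> map rho' u = map rho u.
    by move=> /allP uk; apply/eq_in_map => x /uk; rewrite /rho' /= => /ltn_eqF->.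
  have eqs : take p (map rho s) ++ [:: k', k' & drop p (map rho s)] =
             map rho' (take p s ++ [:: k, k & drop p s]).
    rewrite map_cat /= -map_take -map_drop !mE ?[rho' k]/rho' ?eqxx //.
      by apply/allP => x /mem_drop xs; exact: (allP sk).
    by apply/allP => x /mem_take xs; exact: (allP sk).
  rewrite eqs; apply: (IH _ _ _ _ _ h2) => //.
  + by rewrite E take_size_cat // drop_size_cat // size_cat /= /outs1 /= -sn E size_cat; lia.
  + rewrite E take_size_cat // drop_size_cat // all_cat /= ltnSn.
    move: sk; rewrite E all_cat => /andP[/allP a1 /allP a2].
    by apply/andP; split; apply/allP => x; [move/a1|move/a2] => /= /ltnW.
  + rewrite -eqs E map_cat take_size_cat ?size_map // drop_size_cat ?size_map //.
    rewrite all_cat /= ltnSn; move: sk'; rewrite E map_cat all_cat => /andP[/allP a1 /allP a2].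
    by apply/andP; split; apply/allP => x; [move/a1|move/a2] => /= /ltnW.
  + have kin x : x \in take p s ++ [:: k, k & drop p s] -> x = k \/ (x \in s /\ x < k).
      rewrite mem_cat !inE => /or3P[/mem_take xs|/eqP->|]; [right|by left|].
        by split=> //; exact: (allP sk).
      case/predU1P=> [->|/mem_drop xs]; [by left|right].
      by split=> //; exact: (allP sk).
    have rk x : x \in s -> rho x < k'.
      by move=> xs; apply: (allP sk'); exact: map_f.
    move=> x y /kin hx /kin hy; rewrite /rho'.
    case: hx hy => [->|[xs xk]] [->|[ys yk]] //; rewrite ?eqxx.
    * by rewrite (ltn_eqF yk) => ek; have := rk _ ys; rewrite -ek ltnn.
    * by rewrite (ltn_eqF xk) => ek; have := rk _ xs; rewrite ek ltnn.
    * by rewrite (ltn_eqF xk) (ltn_eqF yk); apply: inj.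
- have [|s1 [a [b [s2 [E E1]]]]] := @split2 _ p s; first by lia.
  have ain : a \in s by rewrite E mem_cat inE eqxx orbT.
  have bin : b \in s by rewrite E mem_cat !inE eqxx !orbT.
  have sub x : x \in s1 ++ s2 -> x \in s.
    by rewrite E !mem_cat !inE => /orP[->|->]; rewrite ?orbT.
  have := loops_cap k s1 a b s2 w; rewrite -E /= E1 => ->.
  have := loops_cap k' (map rho s1) (rho a) (rho b) (map rho s2) w.
  rewrite size_map E1 -!map_cons -!map_cat -E /= => ->.
  have inj' x y : x \in s -> y \in s -> (rho x == rho y) = (x == y).
    by move=> xs ys; apply/eqP/eqP => [/inj->|->].
  rewrite inj' // -map_comp.
  have -> : [seq ((fun x => if x == rho a then rho b else x) \o rho) i | i <- s1 ++ s2] =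
       map rho [seq if x == a then b else x | x <- s1 ++ s2].
    rewrite -map_comp; apply/eq_in_map => x /sub xs /=; rewrite inj' //.
    by case: eqP.
  have sub2 x : x \in [seq if x == a then b else x | x <- s1 ++ s2] -> x \in s.
    by case/mapP => y /sub ys ->; case: ifP.
  congr (_ + _); apply: (IH _ _ _ _ _ h2) => //.
  + by rewrite size_map size_cat /outs1 /= -sn E size_cat /=; lia.
  + by apply/allP => x /sub2 xs; exact: (allP sk).
  + by apply/allP => x /mapP[y /sub2 ys ->]; apply: (allP sk'); exact: map_f.
  + by move=> x y /sub2 xs /sub2 ys; apply: inj.
Qed.

Definition planar (w : word unit) := ~~ has (fun e => if e is Cross _ _ then true else false) w.
Definition cups (w : word unit) := all (fun e => if e is Cup _ _ then true else false) w.

Lemma outs_cups u N : cups u -> outs N u = N + (size u).*2.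
Proof.
elim: u N => [|e u IH] N /=; first by rewrite addn0.
by case: e => // t p /= /IH->; rewrite /outs1 /=; lia.
Qed.

Lemma loops_ctx c u x y N k s : cups u ->
  (forall k s, size s = N + (size u).*2 -> all (gtn k) s ->
     loops_from k s x = c + loops_from k s y) ->
  size s = N -> all (gtn k) s -> loops_from k s (u ++ x) = c + loops_from k s (u ++ y).
Proof.
elim: u N k s => [|e u IH] N k s /=; first by move=> _ H sN; apply: H; rewrite sN addn0.
case: e => // t p cu H sN sk /=; apply: (IH N.+2) => //.
- by move=> k' s' h; apply: H; rewrite h; lia.
- by rewrite size_cat /= -[in RHS]sN -[in RHS](cat_take_drop p s) size_cat; lia.
- rewrite all_cat /= ltnSn /=; apply/andP; split; apply/allP => z.
    by move=> /mem_take /(allP sk) /= /ltnW.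
  by move=> /mem_drop /(allP sk) /= /ltnW.
Qed.

Lemma all_ltnW k (s : seq nat) : all (gtn k) s -> all (gtn k.+1) s.
Proof. by move=> /allP h; apply/allP => x /h /= /ltnW. Qed.

Lemma map_rn (k a : nat) (s : seq nat) : all (gtn k) s ->
  [seq if x == k then a else x | x <- s] = s.
Proof.
move=> /allP h; rewrite -[RHS]map_id; apply/eq_in_map => x /h /=.
by move=> /ltn_eqF->.
Qed.

Lemma loops_loop p k s v : p <= size s -> wf (size s) v -> planar v -> all (gtn k) s ->
  loops_from k s (Cup tt p :: Cap p :: v) = 1 + loops_from k s v.
Proof.
move=> ps wv pv sk; have [s1 [s2 [E E1]]] := split3 ps; subst s p.
rewrite loops_cup loops_cap eqxx map_rn //; congr (_ + _).
by rewrite -{1}[_ ++ _]map_id (loops_inj (k := k) wv) ?map_id ?all_ltnW.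
Qed.

Lemma loops_zig1 p k s v : p < size s -> wf (size s) v -> planar v -> all (gtn k) s ->
  loops_from k s (Cup tt p.+1 :: Cap p :: v) = loops_from k s v.
Proof.
move=> ps wv pv sk; have [s1 [a [s2 [E E1]]]] := split1 ps; subst p.
have ak : a < k by apply: (allP sk); rewrite E mem_cat inE eqxx orbT.
have := loops_cup tt k (rcons s1 a) s2 (Cap (size s1) :: v).
rewrite size_rcons cat_rcons -E => ->; rewrite cat_rcons loops_cap (ltn_eqF ak) add0n.
pose rho x := if x == a then k else x.
have -> : [seq if x == a then k else x | x <- s1 ++ k :: s2] = map rho s.
  rewrite E !map_cat /= /rho eqxx; congr (_ ++ _ :: _).
  by case: eqP => // ka; rewrite -ka ltnn in ak.
rewrite (loops_inj (k := k) wv) //.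
- by apply/allP => x /mapP[y ys ->]; rewrite /rho /=; case: eqP => // _; apply/ltnW/(allP sk).
- move=> x y /(allP sk)/= xk /(allP sk)/= yk; rewrite /rho.
  by case: eqP => [->|_]; case: eqP => [->|_] // h; rewrite ?h ltnn // -h ltnn in xk yk.
Qed.

Lemma loops_zig2 p k s v : p < size s -> wf (size s) v -> planar v -> all (gtn k) s ->
  loops_from k s (Cup tt p :: Cap p.+1 :: v) = loops_from k s v.
Proof.
move=> ps wv pv sk; have [s1 [a [s2 [E E1]]]] := split1 ps; subst p.
have ak : a < k by apply: (allP sk); rewrite E mem_cat inE eqxx orbT.
rewrite E loops_cup.
have := loops_cap k.+1 (rcons s1 k) k a s2 v.
rewrite size_rcons !cat_rcons => ->; rewrite eq_sym (ltn_eqF ak) add0n.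
move: sk wv; rewrite E all_cat /= => /and3P[h1 h2 h3] wv.
rewrite map_cat /= eqxx !map_rn // -{1}[_ ++ _]map_id (loops_inj (k := k) wv) //.
  by rewrite all_cat /= h1 h2.
by rewrite map_id all_ltnW // all_cat /= h1 h2.
Qed.

Lemma loops_far1 p j k s v : p + 2 + j <= size s -> all (gtn k) s ->
  loops_from k s (Cup tt (p + 2 + j) :: Cap p :: v) =
  loops_from k s (Cap p :: Cup tt (p + j) :: v).
Proof.
move=> ps sk; have [s0 [s3 [E E1]]] := split3 ps.
have [|s1 [a [b [s2 [E2 E3]]]]] := @split2 _ p s0; first by rewrite E1; lia.
have sz : size s2 = j by move: E1; rewrite E2 size_cat /= E3; lia.
rewrite -E1 E loops_cup E2 -!catA !cat_cons -E3 !loops_cap; congr (_ + _).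
set f := fun x => if x == a then b else x.
have -> : size s1 + j = size (map f s1 ++ map f s2) by rewrite size_cat !size_map sz.
rewrite !map_cat !catA loops_cup.
have ak : a < k by apply: (allP sk); rewrite E E2 !mem_cat inE eqxx !orbT.
by rewrite /= ![f k]/f (gtn_eqF ak) -!catA.
Qed.

Lemma loops_far2 p j k s v : p + 2 + j <= size s -> all (gtn k) s ->
  loops_from k s (Cup tt p :: Cap (p + 2 + j) :: v) =
  loops_from k s (Cap (p + j) :: Cup tt p :: v).
Proof.
move=> ps sk; have [|s0 [a [b [s3 [E E1]]]]] := @split2 _ (p + j) s; first by lia.
have [|s1 [s2 [E2 E3]]] := @split3 _ p s0; first by rewrite E1; lia.
have sz : size s2 = j by move: E1; rewrite E2 size_cat E3; lia.
have ak : a < k by apply: (allP sk); rewrite E !mem_cat inE eqxx !orbT.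
rewrite -E1 E loops_cap E2 -catA -E3 loops_cup.
have := loops_cap k.+1 (s1 ++ k :: k :: s2) a b s3 v.
rewrite size_cat /= sz addnS addnS -addSn -addSn -[_.+2]addn2 -!catA !cat_cons => ->.
congr (_ + _); set f := fun x => if x == a then b else x.
have -> : size s1 = size (map f s1) by rewrite size_map.
by rewrite !map_cat take_size_cat // drop_size_cat // /= ![f k]/f (gtn_eqF ak) map_cat.
Qed.
End Loops.

(** A nonempty closed planar diagram has a first cap, preceded by cups alone. The last of these cups
    either forms a loop or a zigzag with the cap, which is removed, or is distant from it; then the
    cap is lowered below that cup and the inner induction on the cups goes on. *)
Lemma planar_value w : planar w -> wf 0 w -> outs 0 w = 0%N ->
  ops 0 w (fun=> 1) [::] = delta ^+ loops w.
Proof.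
have [N] := ubnP (size w); elim: N w => // N IHN w; rewrite ltnS => wN pw ww ow.
have [u [v [Ew cu hv]]] : exists u v, [/\ w = u ++ v, cups u &
   v = [::] \/ exists p v', v = Cap p :: v'].
  elim: w pw {wN ww ow} => [|e w IH] /=; first by exists [::], [::]; split=> //; left.
  rewrite /planar /= negb_or => /andP[ne /IH[u [v [-> cu hv]]]].
  case: e ne => // [t p|p] _; first by exists (Cup t p :: u), v.
  by exists [::], (Cap p :: u ++ v); split=> //; right; exists p, (u ++ v).
case: hv => [v0|[p [v' v1]]].
  by move: ow; rewrite Ew v0 cats0 outs_cups //; case: (u).
subst v; elim/last_ind: u p v' w Ew cu wN pw ww ow => [|u e IHu] p v w -> //=.
  by move=> _ _ _ /andP[]; lia.
rewrite /cups all_rcons cat_rcons; case: e => // -[] q /= cu.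
rewrite size_cat /= => wN; rewrite /planar has_cat /= negb_or => /andP[pu pv].
have ou := outs_cups 0 cu; rewrite add0n in ou.
rewrite wf_cat !outs_cat ou; set M := (size u).*2 in ou *.
have o1 t x : outs1 M (Cup t x) = (M + 2)%N by rewrite /outs1 /= subn0.
have o2 x : outs1 (M + 2) (Cap x) = M by rewrite /outs1 /= addn0 addnK.
rewrite /= o1 o2 addn0 leq_add2r => /and4P[wu qM pM wv] ov.
have ww : wf 0 (u ++ v) by rewrite wf_cat ou wu.
have oo : outs 0 (u ++ v) = 0%N by rewrite outs_cat ou.
have pp : planar (u ++ v) by rewrite /planar has_cat negb_or pu.
have sz : (size (u ++ v) < N)%N by rewrite size_cat; lia.
have w0 : wf 0 (u ++ [:: Cup tt q, Cap p & v]).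
  by rewrite wf_cat ou wu /= addn0 o1 o2 qM leq_add2r pM.
have loopsE c y : (forall k s, size s = M -> all (gtn k) s ->
     loops_from k s [:: Cup tt q, Cap p & v] = c + loops_from k s y)%N ->
   loops (u ++ [:: Cup tt q, Cap p & v]) = (c + loops (u ++ y))%N.
  by move=> H; apply: (@loops_ctx _ _ _ _ 0%N) => // k s; rewrite add0n; apply: H.
have [e1|[e1|[e1|[[j e1]|[j e1]]]]] : p = q \/ q = p.+1 \/ p = q.+1 \/ (exists j, q = p + 2 + j)%N
    \/ (exists j, p = q + 2 + j)%N.
  have [?|[?|[?|[?|?]]]] : p = q \/ q = p.+1 \/ p = q.+1 \/ (p + 2 <= q)%N \/ (q + 2 <= p)%N by lia.
  - by left.
  - by right; left.
  - by right; right; left.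
  - by right; right; right; left; exists (q - (p + 2))%N; lia.
  - by right; right; right; right; exists (p - (q + 2))%N; lia.
- subst q; rewrite (loopsE 1%N v) ?exprS -?IHN // => [|k s sM sk]; last first.
    by rewrite loops_loop ?sM.
  rewrite !ops_cat -opsZ; apply: ops_ext_wf => // t pt st _.
  by rewrite ou in st; rewrite ops_loop // st.
- rewrite (loopsE 0%N v) ?add0n -?IHN // => [|k s sM sk]; last first.
    by rewrite e1 loops_zig1 ?sM // -e1.
  apply: eqv_wf => //; rewrite e1 -[[:: _, _ & v]]/([:: Cup tt p.+1; Cap p] ++ v).
  by rewrite zig1.
- rewrite (loopsE 0%N v) ?add0n -?IHN // => [|k s sM sk]; last first.
    by rewrite e1 loops_zig2 ?sM // -e1.
  apply: eqv_wf => //; rewrite e1 -[[:: _, _ & v]]/([:: Cup tt q; Cap q.+1] ++ v).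
  by rewrite zig2.
- have ww' : wf 0 (u ++ Cap p :: Cup tt (p + j) :: v).
    rewrite wf_cat ou wu /=; have -> : outs1 (outs1 M (Cap p)) (Cup tt (p + j)) = M.
      by rewrite /outs1 /=; lia.
    by rewrite wv andbT /outs1 /=; lia.
  rewrite (loopsE 0%N [:: Cap p, Cup tt (p + j) & v]) ?add0n => [|k s sM sk]; last first.
    by rewrite e1 loops_far1 // sM -e1.
  rewrite -(IHu p (Cup tt (p + j) :: v)) //; last first.
  + by rewrite outs_cat ou /=; have -> : outs1 (outs1 M (Cap p)) (Cup tt (p + j)) = M;
      rewrite // /outs1 /=; lia.
  + by rewrite /planar has_cat negb_or pu.
  + by rewrite size_cat /=; lia.
  apply: eqv_wf => //; rewrite e1.
  have := @far p 2 [:: Cap 0] [:: Cup tt j] isT.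
  rewrite /= /outs1 /= !addn0 => H.
  by rewrite -[[:: _, _ & v]]/([:: Cup tt (p + 2 + j); Cap p] ++ v) -H.
- have ww' : wf 0 (u ++ Cap (q + j) :: Cup tt q :: v).
    rewrite wf_cat ou wu /=; have -> : outs1 (outs1 M (Cap (q + j))) (Cup tt q) = M.
      by rewrite /outs1 /=; lia.
    by rewrite wv andbT /outs1 /=; lia.
  rewrite (loopsE 0%N [:: Cap (q + j), Cup tt q & v]) ?add0n => [|k s sM sk]; last first.
    by rewrite e1 loops_far2 // sM -e1.
  rewrite -(IHu (q + j)%N (Cup tt q :: v)) //; last first.
  + by rewrite outs_cat ou /=; have -> : outs1 (outs1 M (Cap (q + j))) (Cup tt q) = M;
      rewrite // /outs1 /=; lia.
  + by rewrite /planar has_cat negb_or pu.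
  + by rewrite size_cat /=; lia.
  apply: eqv_wf => //; rewrite e1.
  have := @far q 0 [:: Cup tt 0] [:: Cap j] isT.
  rewrite /= /outs1 /= !addn0 => H.
  by rewrite -[[:: _, _ & v]]/([:: Cup tt q; Cap (q + 2 + j)] ++ v) H.
Qed.

Lemma states_value a w f s :
  ops a w f s = \sum_(x <- states w) A ^ x.1 * ops a x.2 f s.
Proof.
elim: w s => [|e w IH] s; first by rewrite big_seq1 expr0z mul1r.
have IH' : ops a w f = fun s => \sum_(x <- states w) A ^ x.1 * ops a x.2 f s.
  exact: funext.
have gen e' : ops a (e' :: w) f s = \sum_(x <- states w) A ^ x.1 * ops a (e' :: x.2) f s.
  rewrite -cat1s ops_cat IH' ops_sum; apply: eq_bigr => x _.
  by rewrite opsZ.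
case: e => [[] p|p|b p]; [by rewrite gen /= big_map..|].
rewrite /= big_cat !big_map /=.
have -> : capo p a (cupo p a (ops a w f)) s =
    \sum_(x <- states w) A ^ x.1 * ops a (Cap p :: Cup tt p :: x.2) f s.
  rewrite -[LHS]/(ops a ([:: Cap p; Cup tt p] ++ w) f s) ops_cat IH' ops_sum.
  by apply: eq_bigr => x _; rewrite opsZ.
rewrite mulr_sumr IH mulr_sumr; congr (_ + _); apply: eq_bigr => x _.
  by rewrite expfzDr // [Ab b]/Ab; case: b; rewrite mulrA [_ * A ^ x.1]mulrC ?exprN1.
by rewrite expfzDr // [Ab b]/Ab; case: b; rewrite mulrA [_ * A ^ x.1]mulrC ?opprK ?invrK ?exprN1.
Qed.

Lemma states_wf n w : wf n w ->
  all (fun x => [&& planar x.2, wf n x.2 & outs n x.2 == outs n w]) (states w).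
Proof.
elim: w n => [|e w IH] n /=; first by rewrite eqxx.
case/andP=> h1 /IH {IH}; case: e h1 => [t p|p|b p] h1 IH.
- by rewrite all_map; apply: sub_all IH => x /= /and3P[? -> ->]; rewrite andbT; apply/and3P.
- by rewrite all_map; apply: sub_all IH => x /= /and3P[? -> ->]; rewrite andbT; apply/and3P.
have E : outs1 n (Cross b p) = n by rewrite /outs1 /= addnK.
have E2 : outs1 (outs1 n (Cap p)) (Cup tt p) = n by rewrite /outs1 /= in h1 *; lia.
rewrite E in IH *; rewrite all_cat !all_map; apply/andP; split=> //.
apply: sub_all IH => x /= /and3P[? ? ?]; rewrite E2; apply/and3P; split=> //.
by apply/and3P; split=> //; rewrite /outs1 /= in h1 *; lia.
Qed.

(** A closed diagram acts on functions of the empty path, hence by a number; its states are planar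
    and each gives a power of [delta]. *)
Lemma bracket_ops w : wf 0 w -> outs 0 w = 0%N ->
  bracket A w = ops 0 w (fun=> 1) [::].
Proof.
move=> ww ow; rewrite states_value /bracket; have := states_wf ww; rewrite ow.
elim: (states w) => [|x r IH] /=; first by rewrite !big_nil.
case/andP=> /and3P[px wx /eqP ox] /IH; rewrite !big_cons => ->.
by rewrite planar_value.
Qed.

Section Cable.
Variable C : finType.
Implicit Types (k : C -> nat) (s : seq (label C)) (w u v : word (label C)) (x y z : label C).

(** * Cables *)

Definition K k s : nat := sumn [seq k x.1 | x <- s].

Lemma K_cat k s1 s2 : K k (s1 ++ s2) = (K k s1 + K k s2)%N.
Proof. by rewrite /K map_cat sumn_cat. Qed.

Lemma K_cons k x s : K k (x :: s) = (k x.1 + K k s)%N.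
Proof. by []. Qed.

Lemma step_sh s1 s2 (e : slice (label C)) :
  step (s1 ++ s2) (shift_slice (size s1) e) = omap (cat s1) (step s2 e).
Proof.
case: e => [[c d] p|p|b p] /=.
- rewrite size_cat leq_add2l; case: ifP => //= ps.
  by rewrite take_cat drop_cat ltnNge leq_addr /= addKn !catA.
- rewrite drop_cat take_cat ltnNge leq_addr /= addKn.
  by case: (drop p s2) => [|x [|y t]] //=; case: ifP => //= _; rewrite catA.
- rewrite drop_cat take_cat ltnNge leq_addr /= addKn.
  by case: (drop p s2) => [|x [|y t]] //=; rewrite catA.
Qed.

Lemma cable_sh k s1 s2 (e : slice (label C)) :
  cable_slice k (s1 ++ s2) (shift_slice (size s1) e) = sh (K k s1) (cable_slice k s2 e).
Proof.
have tk p : sumn [seq k x.1 | x <- take (size s1 + p) (s1 ++ s2)] =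
    (K k s1 + sumn [seq k x.1 | x <- take p s2])%N.
  by rewrite take_cat ltnNge leq_addr /= addKn map_cat sumn_cat.
have mu p : mult k (s1 ++ s2) (size s1 + p) = mult k s2 p.
  by rewrite /mult onth_cat ltnNge leq_addr /= addKn.
case: e => [[c d] p|p|b p]; rewrite /cable_slice /=.
- by rewrite tk; symmetry; exact: sh_cupn.
- by rewrite tk mu; symmetry; exact: sh_capn.
- by rewrite tk -addnS !mu; symmetry; exact: sh_X.
Qed.

Lemma step_cup s1 s2 c d :
  step (s1 ++ s2) (Cup (c, d) (size s1)) = Some (s1 ++ (c, d) :: (c, ~~ d) :: s2).
Proof. by have := step_sh s1 s2 (Cup (c, d) 0); rewrite /= addn0 take0 drop0. Qed.

Lemma step_cap s1 s2 x y : step (s1 ++ x :: y :: s2) (Cap (size s1)) =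
  if (x.1 == y.1) && (x.2 != y.2) then Some (s1 ++ s2) else None.
Proof.
by have := step_sh s1 (x :: y :: s2) (Cap 0); rewrite /= addn0 => ->; case: ifP.
Qed.

Lemma step_cross b s1 s2 x y : step (s1 ++ x :: y :: s2) (Cross b (size s1)) =
  Some (s1 ++ y :: x :: s2).
Proof. by have := step_sh s1 (x :: y :: s2) (Cross b 0); rewrite /= addn0. Qed.

Lemma cable_cup k s1 s2 c d :
  cable_slice k (s1 ++ s2) (Cup (c, d) (size s1)) = cupn (k c) (K k s1).
Proof.
have := cable_sh k s1 s2 (Cup (c, d) 0); rewrite [shift_slice _ _]/= addn0 => ->.
have -> : cable_slice k s2 (Cup (c, d) 0) = cupn (k c) 0 by rewrite /cable_slice /= take0.
by rewrite sh_cupn addn0.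
Qed.

Lemma cable_cap k s1 s2 x y :
  cable_slice k (s1 ++ x :: y :: s2) (Cap (size s1)) = capn (k x.1) (K k s1).
Proof.
have := cable_sh k s1 (x :: y :: s2) (Cap 0); rewrite [shift_slice _ _]/= addn0 => ->.
by rewrite [cable_slice _ _ _](_ : _ = capn (k x.1) 0) // sh_capn addn0.
Qed.

Lemma cable_cross b k s1 s2 x y :
  cable_slice k (s1 ++ x :: y :: s2) (Cross b (size s1)) = X b (k x.1) (k y.1) (K k s1).
Proof.
have := cable_sh k s1 (x :: y :: s2) (Cross b 0); rewrite [shift_slice _ _]/= addn0 => ->.
by rewrite [cable_slice _ _ _](_ : _ = X b (k x.1) (k y.1) 0) // sh_X addn0.
Qed.

Variant step_spec s : slice (label C) -> seq (label C) -> Prop :=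
  | StCup c d s1 s2 of s = s1 ++ s2 :
      step_spec s (Cup (c, d) (size s1)) (s1 ++ (c, d) :: (c, ~~ d) :: s2)
  | StCap c d s1 s2 of s = s1 ++ (c, d) :: (c, ~~ d) :: s2 :
      step_spec s (Cap (size s1)) (s1 ++ s2)
  | StCross b x y s1 s2 of s = s1 ++ x :: y :: s2 :
      step_spec s (Cross b (size s1)) (s1 ++ y :: x :: s2).

Lemma stepP s e s' : step s e = Some s' -> step_spec s e s'.
Proof.
case: e => [[c d] p|p|b p].
- rewrite /=; case: ifP => // ps.
  have [s1 [s2 [E E1]]] := split3 ps; subst s p => [[<-]].
  by rewrite take_size_cat // drop_size_cat //; constructor.
- case: (leqP (p + 2) (size s)) => [/split2[s1 [x [y [s2 [E E1]]]]]|h]; last first.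
    rewrite /=; case E : (drop p s) => [|x [|y t]] //.
    by move: h; have := size_drop p s; rewrite E /=; lia.
  subst s p; rewrite step_cap; case: ifP => // /andP[/eqP h1 h2] [<-].
  case: x y h1 h2 => [c d] [c' d'] /= <- h2.
  have -> : d' = ~~ d by case: (d) (d') h2 => -[].
  exact: StCap.
- case: (leqP (p + 2) (size s)) => [/split2[s1 [x [y [s2 [E E1]]]]]|h]; last first.
    rewrite /=; case E : (drop p s) => [|x [|y t]] //.
    by move: h; have := size_drop p s; rewrite E /=; lia.
  by subst s p; rewrite step_cross => [[<-]]; constructor.
Qed.

Lemma run_cons s e w : run s (e :: w) = obind (fun t => run t w) (step s e).
Proof.
by rewrite /run /=; case: (step s e) => //=; elim: w => //= e' w ->.
Qed.

Lemma run_cat s u v : run s (u ++ v) = obind (fun t => run t v) (run s u).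
Proof.
elim: u s => // e u IH s; rewrite cat_cons !run_cons.
by case: (step s e) => //= s'.
Qed.

Lemma run_catP s u v s' : run s (u ++ v) = Some s' ->
  exists2 t, run s u = Some t & run t v = Some s'.
Proof. by rewrite run_cat; case: (run s u) => // t; exists t. Qed.

Lemma run_consP s e w s' : run s (e :: w) = Some s' ->
  exists2 t, step s e = Some t & run t w = Some s'.
Proof. by rewrite run_cons; case: (step s e) => // t; exists t. Qed.

Lemma cable_cat k s u v t : run s u = Some t ->
  cable_from k s (u ++ v) = cable_from k s u ++ cable_from k t v.
Proof.
elim: u s => [|e u IH] s; first by case=> ->.
by rewrite run_cons /=; case: (step s e) => // s' /IH->; rewrite catA.
Qed.

Lemma cable_step_wf k s e s' : step s e = Some s' ->
  wf (K k s) (cable_slice k s e) /\ outs (K k s) (cable_slice k s e) = K k s'.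
Proof.
case/stepP => [c d s1 s2 ->|c d s1 s2 ->|b x y s1 s2 ->].
- by rewrite cable_cup outs_cupn; split; [apply: wf_cupn|]; rewrite !K_cat ?K_cons /=; lia.
- by rewrite cable_cap outs_capn; split; [apply: wf_capn|]; rewrite !K_cat ?K_cons /=; lia.
- by rewrite cable_cross outs_X; split; [apply: wf_X|]; rewrite !K_cat ?K_cons /=; lia.
Qed.

Lemma cable_wf k s w s' : run s w = Some s' ->
  wf (K k s) (cable_from k s w) /\ outs (K k s) (cable_from k s w) = K k s'.
Proof.
elim: w s => [|e w IH] s; first by case=> ->.
case/run_consP => t /[dup] st /(cable_step_wf k)[w1 o1] /IH[w2 o2] /=.
by rewrite st /= wf_cat outs_cat w1 o1.
Qed.

Lemma cable_bracket k w : run [::] w = Some [::] ->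
  bracket A (cable k w) = ops 0 (cable k w) (fun=> 1) [::].
Proof. by case/(cable_wf k) => h1 h2; apply: bracket_ops. Qed.

Lemma rcons2 s1 x s2 : s1 ++ x :: s2 = rcons s1 x ++ s2.
Proof. by rewrite cat_rcons. Qed.

Lemma K_rcons k s x : K k (rcons s x) = (K k s + k x.1)%N.
Proof. by rewrite -cats1 K_cat K_cons /K /= addn0. Qed.

Lemma neq_negb (a b : bool) : a != b -> b = ~~ a.
Proof. by case: a; case: b. Qed.

Lemma step_cup1 s1 s2 x c d : step (s1 ++ x :: s2) (Cup (c, d) (size s1).+1) =
  Some (s1 ++ x :: (c, d) :: (c, ~~ d) :: s2).
Proof. by rewrite (rcons2 s1 x) -(size_rcons s1 x) step_cup ?cat_rcons. Qed.

Lemma step_cap1 s1 s2 x y z : step (s1 ++ x :: y :: z :: s2) (Cap (size s1).+1) =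
  if (y.1 == z.1) && (y.2 != z.2) then Some (s1 ++ x :: s2) else None.
Proof. by rewrite (rcons2 s1 x) -(size_rcons s1 x) step_cap ?cat_rcons. Qed.

Lemma step_cross1 b s1 s2 x y z : step (s1 ++ x :: y :: z :: s2) (Cross b (size s1).+1) =
  Some (s1 ++ x :: z :: y :: s2).
Proof. by rewrite (rcons2 s1 x) -(size_rcons s1 x) step_cross ?cat_rcons. Qed.

Lemma cable_cup1 k s1 s2 x c d :
  cable_slice k (s1 ++ x :: s2) (Cup (c, d) (size s1).+1) = cupn (k c) (K k s1 + k x.1).
Proof. by rewrite (rcons2 s1 x) -(size_rcons s1 x) cable_cup K_rcons. Qed.

Lemma cable_cap1 k s1 s2 x y z :
  cable_slice k (s1 ++ x :: y :: z :: s2) (Cap (size s1).+1) = capn (k y.1) (K k s1 + k x.1).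
Proof. by rewrite (rcons2 s1 x) -(size_rcons s1 x) cable_cap K_rcons. Qed.

Lemma cable_cross1 b k s1 s2 x y z :
  cable_slice k (s1 ++ x :: y :: z :: s2) (Cross b (size s1).+1) =
  X b (k y.1) (k z.1) (K k s1 + k x.1).
Proof. by rewrite (rcons2 s1 x) -(size_rcons s1 x) cable_cross K_rcons. Qed.

Definition cableE := (step_cup1, step_cap1, step_cross1, step_cup, step_cap, step_cross,
  cable_cup1, cable_cap1, cable_cross1, cable_cup, cable_cap, cable_cross).

Lemma cable_cons k s e w :
  cable_from k s (e :: w) = cable_slice k s e ++ cable_from k (odflt [::] (step s e)) w.
Proof. by []. Qed.

Lemma cable_nil k s : cable_from k s [::] = [::].
Proof. by []. Qed.

Lemma odfltE (T : Type) (t t2 : T) : odflt t (Some t2) = t2.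
Proof. by []. Qed.

Lemma obindE (T U : Type) (f : T -> option U) (t : T) : obind f (Some t) = f t.
Proof. by []. Qed.

Lemma step_local k s e t : step s e = Some t -> exists s1 i o s2 cw,
  [/\ s = s1 ++ i ++ s2, t = s1 ++ o ++ s2, slice_pos e = size s1,
      size i = slice_in e & size o = slice_out e] /\
  [/\ wf (K k i) cw, outs (K k i) cw = K k o &
      forall s3, step (s1 ++ i ++ s3) e = Some (s1 ++ o ++ s3) /\
         cable_slice k (s1 ++ i ++ s3) e = sh (K k s1) cw].
Proof.
case/stepP => [c d s1 s2 ->|c d s1 s2 ->|b x y s1 s2 ->].
- exists s1, [::], [:: (c, d); (c, ~~ d)], s2, (cupn (k c) 0); split=> //.
  rewrite outs_cupn wf_cupn //; split=> // [|s3]; first by rewrite /K /=; lia.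
  by rewrite !cat_cons !cat0s step_cup cable_cup sh_cupn addn0.
- exists s1, [:: (c, d); (c, ~~ d)], [::], s2, (capn (k c) 0); split=> //.
  have -> : K k [:: (c, d); (c, ~~ d)] = (k c).*2 by rewrite /K /=; lia.
  rewrite outs_capn subnn wf_capn //; split=> // s3.
  by rewrite !cat_cons !cat0s step_cap cable_cap eqxx sh_capn addn0; case: (d).
- exists s1, [:: x; y], [:: y; x], s2, (X b (k x.1) (k y.1) 0); split=> //.
  have E2 (x1 y1 : label C) : K k [:: x1; y1] = (k x1.1 + k y1.1)%N by rewrite /K /= addn0.
  rewrite outs_X !E2 wf_X //; split=> // [|s3]; first exact: addnC.
  by rewrite !cat_cons !cat0s step_cross cable_cross sh_X addn0.
Qed.

(** On cables each move becomes the same move for blocks of parallel strands, of any width including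
    0. Since both sides can be run, the labels joined by a cap agree, which makes the widths
    match. *)
Lemma cable_local k s w w' s1 s2 : local_move w w' ->
  run s w = Some s1 -> run s w' = Some s2 ->
  s1 = s2 /\ cable_from k s w =~ cable_from k s w'.
Proof.
case=> [e e'|[c d] p|[c d] p|[c d] b p|b p|[c d] [c' d'] b p|b p|a b c p abc].
- case/run_consP => t /(step_local k)[u1 [i [o [u2 [x [[Es Et -> <- <-] [wx ox H]]]]]]].
  rewrite -!size_cat; subst s t; have [E1 E2] := H u2.
  have Sh l := step_sh (u1 ++ l) u2 e'; have Ch l := cable_sh k (u1 ++ l) u2 e'.
  rewrite /= E1 E2 /= !run_cons (catA u1 o) (catA u1 i) !Sh !Ch.
  case E : (step u2 e') => [u3|] //= [<-].
  have [E3 E4] := H u3; rewrite -(catA u1 i) run_cons E3 E4 => -[<-]; split; first by rewrite catA.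
  by rewrite !cats0 !K_cat -ox; apply: far.
- case/run_consP => t; have [h|h] := leqP p.+1 (size s); last by rewrite /= leqNgt h.
  have [s3 [x [s4 [E E1]]]] := split1 h; subst s p.
  rewrite step_cup1 => -[<-]; rewrite run_cons step_cap; case: ifP => // /andP[/eqP xc xd].
  move=> -[<-] [<-]; split; first by clear h; case: x xc xd => /= ? ? -> /neq_negb->; rewrite ?negbK.
  by rewrite !cable_cons !(cableE, odfltE) cable_nil cats0 /= ?xc; exact: zig1n.
- case/run_consP => t; have [h|h] := leqP p (size s); last by rewrite /= leqNgt h.
  have [s3 [[|x s4] [E E1]]] := split3 h; subst s p; rewrite step_cup => -[<-].
    by rewrite run_cons /= drop_cat ltnNge leqnSn /= subSnn.
  rewrite run_cons step_cap1; case: ifP => // /andP[/eqP xc xd].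
  move=> -[<-] [<-]; split; first by clear h; case: x xc xd => /= ? ? <- /neq_negb->; rewrite ?negbK.
  by rewrite !cable_cons !(cableE, odfltE) cable_nil cats0 /= ?xc; exact: zig2n.
- case/run_consP => t; have [h|h] := leqP p (size s); last by rewrite /= leqNgt h.
  have [s3 [[|x s4] [E E1]]] := split3 h; subst s p; rewrite step_cup => -[<-].
    by rewrite run_cons /= drop_cat ltnNge leqnSn /= subSnn.
  rewrite run_cons step_cross1 => -[<-]; rewrite run_cons step_cup1 obindE run_cons step_cross.
  move=> -[<-]; split=> //.
  by rewrite !cable_cons !(cableE, odfltE) !cable_nil !cats0; exact: cup_slide.
- case/run_consP => t; have [h|h] := leqP (p.+1 + 2) (size s); last first.
    by rewrite /=; case E : (drop _ s) => [|x [|y l]] //; move: h; have := size_drop p.+1 s;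
      rewrite E /=; lia.
  have [|s3 [x [s4 [E E1]]]] := @split1 _ p s; first by lia.
  case: s4 E h => [|y [|z s4]] E h; [by move: h; rewrite E size_cat /=; lia..|].
  subst s p; rewrite step_cross1 => -[<-]; rewrite run_cons step_cap run_cons step_cross obindE.
  rewrite run_cons step_cap1; case: ifP => // hxz -[<-] [<-]; split=> //.
  rewrite !cable_cons !(cableE, odfltE) !cable_nil !cats0; case/andP: hxz => /eqP -> _.
  exact: cap_slide.
- case/run_consP => t; have [h|h] := leqP p.+1 (size s); last by rewrite /= leqNgt h.
  have [s3 [x [s4 [E E1]]]] := split1 h; subst s p.
  rewrite step_cup1 => -[<-]; rewrite run_cons step_cross obindE run_cons step_cap1.
  case: ifP => // /andP[/eqP xc xd] [<-].
  rewrite run_cons step_cup obindE run_cons step_cross1 obindE run_cons step_cap.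
  case: ifP => // /andP[/eqP xc' xd'] [<-]; split.
    by clear h; case: x xc xd xc' xd' => /= ? ? -> /neq_negb/(can_inj negbK)-> <- /neq_negb->; rewrite ?negbK.
  rewrite /kink !cable_cons !(cableE, odfltE) !cable_nil !cats0 /=.
  rewrite /= in xc xc'; rewrite xc' xc.
  by rewrite -curlRE -curlLE curl_LR.
- case/run_consP => t; have [h|h] := leqP (p + 2) (size s); last first.
    by rewrite /=; case E : (drop _ s) => [|x [|y l]] //; move: h; have := size_drop p s;
      rewrite E /=; lia.
  have [s3 [x [y [s4 [E E1]]]]] := split2 h; subst s p.
  rewrite step_cross => -[<-]; rewrite run_cons step_cross => -[<-] [<-]; split=> //.
  by rewrite !cable_cons !(cableE, odfltE) !cable_nil cats0; exact: X_inv.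
- case/run_consP => t st /[dup] rt /run_consP[t'].
  have [h _ _|h] := leqP (p.+1 + 2) (size t); last first.
    by rewrite {1}/step; case E : (drop _ t) => [|x [|y l]] //; move: h; have := size_drop p.+1 t;
      rewrite E /=; lia.
  have ts : size t = size s.
    move: st; rewrite /=; case E : (drop p s) => [|x [|y l]] // [<-].
    by rewrite -[in RHS](cat_take_drop p s) E !size_cat.
  rewrite ts in h; have [|s3 [x [s4 [E E1]]]] := @split1 _ p s; first by lia.
  case: s4 E h => [|y [|z s4]] E h; [by move: h; rewrite E size_cat /=; lia..|].
  subst s p; move: st rt; rewrite step_cross => -[<-].
  rewrite run_cons step_cross1 obindE run_cons step_cross => -[<-].
  rewrite run_cons step_cross1 obindE run_cons step_cross obindE run_cons step_cross1 => -[<-]; split=> //.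
  rewrite !cable_cons !(cableE, odfltE) !cable_nil !cats0.
  have [bc|bc] := eqVneq b c; first by rewrite bc; exact: R3l.
  have -> : b = a by move: abc bc; case: (a); case: (b); case: (c).
  exact: R3r.
Qed.
End Cable.

(** * Values of cabled diagrams and sums over multiplicities *)

Definition cval (C : finType) (k : C -> nat) (w : word (label C)) : F :=
  ops 0 (cable k w) (fun=> 1) [::].

Section Relabel.
Variables (C C' : finType) (f : C -> C') (h : C -> bool) (g : label C -> label C').
Hypotheses (f_inj : injective f) (g1 : forall l, (g l).1 = f l.1)
  (g2 : forall l, (g l).2 = l.2 (+) h l.1).

Lemma gE c d : g (c, d) = (f c, d (+) h c).
Proof. by rewrite [LHS]surjective_pairing g1 g2. Qed.

Lemma step_map s e : step (map g s) (map_slice g e) = omap (map g) (step s e).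
Proof.
case: e => [[c d] p|p|b p]; rewrite /map_slice ?gE /step ?size_map -?map_take -?map_drop.
- by case: ifP => //= _; rewrite map_cat /= !gE addNb.
- case: (drop p s) => [|x [|y t]] //=; rewrite !g1 (inj_eq f_inj) !g2.
  case: eqP => //= ->; rewrite (inj_eq (@addIb _)).
  by case: ifP => //= _; rewrite map_cat.
- by case: (drop p s) => [|x [|y t]] //=; rewrite map_cat.
Qed.

Lemma cable_slice_map k s e :
  cable_slice k (map g s) (map_slice g e) = cable_slice (k \o f) s e.
Proof.
have tk p : [seq k x.1 | x <- take p (map g s)] = [seq (k \o f) x.1 | x <- take p s].
  by rewrite -map_take -map_comp; apply: eq_map => x /=; rewrite g1.
have mu p : mult k (map g s) p = mult (k \o f) s p.
  by rewrite /mult onth_map; case: (onth s p) => //= x; rewrite g1.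
by case: e => [[c d] p|p|b p]; rewrite /map_slice ?gE /cable_slice ?mu tk.
Qed.

Lemma run_map s w : run (map g s) (map (map_slice g) w) = omap (map g) (run s w).
Proof.
elim: w s => // e w IH s; rewrite map_cons !run_cons step_map.
by case: (step s e) => //= t.
Qed.

Lemma cable_map k s w :
  cable_from k (map g s) (map (map_slice g) w) = cable_from (k \o f) s w.
Proof.
elim: w s => // e w IH s; rewrite map_cons !cable_cons cable_slice_map step_map.
by rewrite -IH; case: (step s e).
Qed.

Lemma val_map k w : cval k (map (map_slice g) w) = cval (k \o f) w.
Proof. by rewrite /cval /cable -[[::] in LHS]/(map g [::]) cable_map. Qed.
End Relabel.

Section RelabelCor.
Variables (C C' : finType) (f : C -> C').
Hypothesis f_inj : injective f.
Let g (l : label C) : label C' := (f l.1, l.2).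

Lemma run_relabel s w : run (map g s) (relabel f w) = omap (map g) (run s w).
Proof. by apply: (@run_map _ _ f (fun=> false)) => // l; rewrite addbF. Qed.

Lemma val_relabel k w : cval k (relabel f w) = cval (k \o f) w.
Proof. by apply: (@val_map _ _ f (fun=> false)) => // l; rewrite addbF. Qed.

End RelabelCor.

Lemma val_reverse (C : finType) (c : C) k w : cval k (reverse_component c w) = cval k w.
Proof.
have := @val_map C C id (fun c' => c' == c) (fun l => (l.1, l.2 (+) (l.1 == c))).
by move=> ->.
Qed.

Lemma val_isotopy (C : finType) (w w' : word (label C)) k :
  run [::] w = Some [::] -> run [::] w' = Some [::] ->
  isotopy_move w w' -> cval k w = cval k w'.
Proof.
move=> rw rw' mv; case: mv rw rw' => [u x y v mv|c w0] rw rw'; last by rewrite val_reverse.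
have [s ru rxv] := run_catP rw; have [s1 rx rv] := run_catP rxv.
have [s' ru' ryv] := run_catP rw'; move: ru'; rewrite ru => -[Es]; subst s'.
have [s2 ry rv'] := run_catP ryv.
have [Es H] := cable_local k mv rx ry; subst s2.
rewrite /cval /cable; apply: eqv_wf => //.
- by rewrite !(cable_cat _ _ ru) (cable_cat _ _ rx) (cable_cat _ _ ry) H.
- by have [] := cable_wf k rw.
- by have [] := cable_wf k rw'.
Qed.

Section MultiSum.
Variable C : finType.
Implicit Types (P : C -> {poly F}) (G : (C -> nat) -> F).

Definition msum B P G : F :=
  \sum_(k : {ffun C -> 'I_B}) (\prod_c (P c)`_(k c)) * G (fun c => k c : nat).

Definition upd (k : C -> nat) c0 j : C -> nat := fun c => if c == c0 then j else k c.

(** Isolates the multiplicity of one component. The multiplicities of the others are indexed by the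
    functions that vanish at [c0], chosen as representatives. *)
Lemma msumE c0 B P G : msum B.+1 P G =
  \sum_(k : {ffun C -> 'I_B.+1} | k c0 == ord0)
    (\prod_(c | c != c0) (P c)`_(k c)) *
    \sum_(j < B.+1) (P c0)`_j * G (upd (fun c => k c) c0 j).
Proof.
pose nrm (k : {ffun C -> 'I_B.+1}) := [ffun c => if c == c0 then ord0 else k c].
rewrite /msum (partition_big nrm (fun k => k c0 == ord0)) /=; last first.
  by move=> k _; rewrite ffunE eqxx.
apply: eq_bigr => k0 /eqP k00.
pose up (j : 'I_B.+1) : {ffun C -> 'I_B.+1} := [ffun c => if c == c0 then j else k0 c].
rewrite (reindex_onto up (fun k : {ffun C -> 'I_B.+1} => k c0)) /=; last first.
  move=> k /eqP/ffunP kE; apply/ffunP => c; rewrite ffunE.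
  by case: eqVneq => [->//|cc]; have := kE c; rewrite ffunE (negPf cc).
rewrite mulr_sumr; apply: eq_big => [j|j _].
  rewrite [up j c0]ffunE !eqxx andbT; apply/eqP/ffunP => c; rewrite !ffunE.
  by case: eqVneq => [->|].
rewrite (bigD1 c0) //= ffunE eqxx -mulrA mulrCA; congr (_ * (_ * _)).
  by apply: eq_bigr => c cc; rewrite ffunE (negPf cc).
congr (G _); apply: funext => c; rewrite /upd ffunE; by case: eqP.
Qed.

Lemma msum_supp (I J : finType) (up : I -> J) (E : J -> F) : injective up ->
  (forall j, j \notin codom up -> E j = 0) -> \sum_j E j = \sum_i E (up i).
Proof.
move=> inj out; rewrite (bigID (mem (up @: setT))) /= [X in _ + X]big1 ?addr0.
  rewrite big_imset /=; last by move=> x y _ _ /inj.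
  by apply: eq_bigl => x; rewrite inE.
move=> j jn; apply: out; apply: contra jn => /codomP[x ->].
exact: imset_f.
Qed.

Lemma msum_bound B B' P G : (forall c, (size (P c) <= B)%N) -> (B <= B')%N ->
  msum B' P G = msum B P G.
Proof.
move=> sz BB'.
pose up (k : {ffun C -> 'I_B}) : {ffun C -> 'I_B'} := [ffun c => widen_ord BB' (k c)].
rewrite /msum (@msum_supp _ _ up) => [|x y /ffunP e|k kn].
- apply: eq_bigr => k _; congr (_ * G _); last by apply: funext => c; rewrite ffunE.
  by apply: eq_bigr => c _; rewrite ffunE.
- by apply/ffunP => c; have := e c; rewrite !ffunE => /(congr1 val) /= h; apply: val_inj.
- case: (boolP [forall c, (k c < B)%N]) => [/forallP kB|/forallPn[c kc]].
    case/negP: kn; apply/codomP; exists [ffun c => Ordinal (kB c)].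
    by apply/ffunP => c; rewrite !ffunE; apply: val_inj.
  rewrite (bigD1 c) //= nth_default ?mul0r //.
  by rewrite -leqNgt in kc; exact: leq_trans (sz c) kc.
Qed.
End MultiSum.

(** A component coloured by the constant 1 contributes with multiplicity 0 only, that is, it is
    erased. *)
Lemma msum_inj (C C' : finType) (f : C -> C') B (P : C' -> {poly F}) G :
  injective f -> (forall c', c' \notin codom f -> P c' = 1) ->
  msum B.+1 P (fun k => G (k \o f)) = msum B.+1 (P \o f) G.
Proof.
move=> f_inj Pout.
pose up (k : {ffun C -> 'I_B.+1}) : {ffun C' -> 'I_B.+1} :=
  [ffun c' => if [pick c | f c == c'] is Some c then k c else ord0].
have upf k c : up k (f c) = k c.
  rewrite ffunE; case: pickP => [c2 /eqP/f_inj->//|/(_ c)]; by rewrite eqxx.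
have upo k c' : c' \notin codom f -> up k c' = ord0.
  rewrite ffunE; case: pickP => // c /eqP <-; by rewrite codom_f.
rewrite /msum (@msum_supp _ _ up) => [|x y /ffunP e|k kn].
- apply: eq_bigr => k _; congr (_ * G _); last first.
    by apply: funext => c /=; rewrite upf.
  rewrite (bigID (mem (codom f))) /= [X in _ * X]big1 ?mulr1 => [|c' c'n]; last first.
    by rewrite upo // Pout // coef1.
  rewrite (eq_bigl (mem (f @: setT))) => [|c']; last first.
    by apply/idP/imsetP => [/codomP[c ->]|[c _ ->]]; [exists c|exact: codom_f].
  rewrite big_imset /=; last by move=> c d _ _ /f_inj.
  by apply: eq_big => [c|c _]; rewrite ?inE // upf.
- by apply/ffunP => c; have := e (f c); rewrite !upf.
- case: (boolP [forall c', (c' \notin codom f) ==> (k c' == ord0)]) => [/forallP kB|/forallPn[c' kc]].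
    case/negP: kn; apply/codomP; exists [ffun c => k (f c)].
    apply/ffunP => c'; case: (boolP (c' \in codom f)) => [/codomP[c ->]|cn].
      by rewrite upf ffunE.
    by have := kB c'; rewrite cn /= => /eqP ->; rewrite upo.
  move: kc; rewrite negb_imply => /andP[cn kc].
  by rewrite (bigD1 c') //= Pout // coef1 (_ : (k c' == 0 :> nat) = false) ?mul0r //; exact: negbTE.
Qed.

Definition SB (C : finType) (P : C -> {poly F}) (w : word (label C)) : F :=
  msum (\max_c size (P c)) P (fun k => cval k w).

Lemma skein_SB (C : finType) (P : C -> {poly F}) (w : word (label C)) :
  run [::] w = Some [::] -> skein_bracket A P w = SB P w.
Proof.
by move=> rw; apply: eq_bigr => k _; rewrite cable_bracket.
Qed.

Lemma SBE (C : finType) (P : C -> {poly F}) w B : (forall c, (size (P c) <= B)%N) ->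
  SB P w = msum B P (fun k => cval k w).
Proof.
move=> sz; rewrite (@msum_bound _ (\max_c size (P c)) B) // => [c|].
  exact: (leq_bigmax c).
by apply/bigmax_leqP => c _.
Qed.

Lemma SB_val (C : finType) (P : C -> {poly F}) w w' :
  (forall k, cval k w = cval k w') -> SB P w = SB P w'.
Proof. by move=> e; apply: eq_bigr => k _; rewrite e. Qed.

Lemma SB_relabel (C C' : finType) (f : C -> C') (P : C' -> {poly F}) w :
  injective f -> (forall c', c' \notin codom f -> P c' = 1) ->
  SB P (relabel f w) = SB (P \o f) w.
Proof.
move=> f_inj Pout; pose B := \max_c size (P c).
have szP c : (size (P c) <= B.+1)%N by apply: leqW; exact: (leq_bigmax c).
rewrite (SBE _ szP) (@SBE _ _ _ B.+1) => [|c]; last exact: szP.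
by rewrite -msum_inj //; apply: eq_bigr => k _; rewrite val_relabel.
Qed.

(** The linear functional sending the j-th power of the core to [u j]. The bound B stands in for the
    degree, so that polynomials of different sizes can be compared. *)
Definition pev B (p : {poly F}) (u : nat -> F) : F := \sum_(j < B) p`_j * u j.

Lemma SB_comp (C : finType) (P P' : C -> {poly F}) w w' c0 a :
  (forall c, c != c0 -> P c = P' c) ->
  (forall k B, (size (P c0) <= B)%N -> (size (P' c0) <= B)%N ->
     pev B (P c0) (fun j => cval (upd k c0 j) w) =
     a * pev B (P' c0) (fun j => cval (upd k c0 j) w')) ->
  SB P w = a * SB P' w'.
Proof.
move=> Pe H; pose B := maxn (\max_c size (P c)) (\max_c size (P' c)).
have szP c : (size (P c) <= B.+1)%N.
  by apply/leqW/(leq_trans _ (leq_maxl _ _)); exact: (leq_bigmax c).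
have szP' c : (size (P' c) <= B.+1)%N.
  by apply/leqW/(leq_trans _ (leq_maxr _ _)); exact: (leq_bigmax c).
rewrite (SBE _ szP) (SBE _ szP') !(msumE c0) mulr_sumr; apply: eq_bigr => k _.
rewrite mulrCA; congr (_ * _); last exact: H.
by apply: eq_bigr => c /Pe ->.
Qed.

Lemma SB_lin (C : finType) (P : C -> {poly F}) w c0 (I : finType) (Q : pred I)
    (a : I -> F) (p : I -> {poly F}) :
  P c0 = \sum_(i | Q i) a i *: p i ->
  SB P w = \sum_(i | Q i) a i * SB (fun c => if c == c0 then p i else P c) w.
Proof.
move=> E; pose B := (\max_i size (p i) + \max_c size (P c))%N.
have szP c : (size (P c) <= B.+1)%N.
  by apply/leqW/(leq_trans _ (leq_addl _ _)); exact: (leq_bigmax c).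
have szp i c : (size (if c == c0 then p i else P c) <= B.+1)%N.
  case: eqP => // _; apply/leqW/(leq_trans _ (leq_addr _ _)); exact: (leq_bigmax i).
rewrite (SBE _ szP) (msumE c0); under [RHS]eq_bigr => i _ do
  rewrite (SBE _ (szp i)) (msumE c0) mulr_sumr.
rewrite exchange_big; apply: eq_bigr => k _ /=.
under [RHS]eq_bigr => i _ do (rewrite eqxx; under eq_bigr => c /negPf-> do over).
under [RHS]eq_bigr => i _ do rewrite mulrCA.
rewrite -mulr_sumr; congr (_ * _).
under [RHS]eq_bigr => i _ do rewrite mulr_sumr.
rewrite exchange_big; apply: eq_bigr => j _ /=.
rewrite E coef_sum mulr_suml; apply: eq_bigr => i _.
by rewrite coefZ mulrA.
Qed.

(** * Diagonal braids *)

(** Paths are stored without their starting vertex, which is restored here as the vertex of index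
    0. *)
Definition vx (s : seq nat) i : nat := nth 0%N (0%N :: s) i.

Lemma vx_last s1 s2 : vx (s1 ++ s2) (size s1) = last 0%N s1.
Proof.
rewrite /vx -cat_cons nth_cat /= ltnS leqnn.
by rewrite -[in RHS](@nth_last _ 0%N) /=; case: s1.
Qed.

Lemma vx_cat s1 t k : vx (s1 ++ t) (size s1 + k) = nth 0%N (last 0%N s1 :: t) k.
Proof.
case: k => [|k]; first by rewrite addn0 vx_last.
by rewrite /vx addnS /= nth_cat ltnNge leq_addr /= addKn.
Qed.

(** The predecessor weight, extended by 0. Like [lam_top] at the other end, this lets sums over
    neighbours ignore the ends of the graph. *)
Definition lamp x := if x is y.+1 then lam y else 0.

Lemma sum_nbs x (phi : nat -> F) : (x <= m)%N ->
  \sum_(c <- nbs x) lam c * phi c = lam x.+1 * phi x.+1 + lamp x * phi x.-1.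
Proof.
move=> xm; rewrite /nbs big_cat /=; congr (_ + _).
  case: ltnP => h; first by rewrite big_seq1.
  by have -> : x = m by [lia|]; rewrite big_nil lam_top mul0r.
by case: x xm => [|x] _ /=; rewrite ?big_nil ?mul0r ?big_seq1.
Qed.

Lemma lamAb b a : lam a =
  (-1) ^+ a * (Ab b ^+ (2 * a.+1) - Ab b ^- (2 * a.+1)) / (Ab b ^+ 2 - Ab b ^- 2).
Proof.
rewrite /lam; case: b => //=; rewrite !exprVn !invrK.
set x := A ^+ (2 * a.+1); set y := A ^+ 2.
by rewrite -[x^-1 - x]opprB -[y^-1 - y]opprB invrN mulrN [_ * - _]mulrN mulNr opprK.
Qed.

Lemma AbD_neq0 b : Ab b ^+ 2 - Ab b ^- 2 != 0.
Proof.
case: b => /=; first exact: A2_neq0.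
by rewrite !exprVn invrK -oppr_eq0 opprB A2_neq0.
Qed.

(** Eigenvalue, for the step from x to y, of a strand going once round all the strands on its left.
    Up to the kink factor [- Ab b ^+ 3] it is the quotient of the twists of y and x ([th_step]). *)
Definition mon (b : bool) (x y : nat) : F :=
  if y == x.+1 then Ab b ^+ (2 * x) else Ab b ^- (2 * x + 4).

Lemma cross_at b s1 y z s2 h : op 0 (Cross b (size s1)) h (s1 ++ [:: y, z & s2]) =
  Ab b * h (s1 ++ [:: y, z & s2]) + (Ab b)^-1 *
  (if z == last 0%N s1 then (lam (last 0%N s1))^-1 *
     \sum_(c <- nbs (last 0%N s1)) lam c * h (s1 ++ [:: c, last 0%N s1 & s2]) else 0).
Proof. by have := op_sh (Cross b 0) 0 h s1 [:: y, z & s2]; rewrite /= addn0. Qed.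

(** The first relation is the eigenvector equation, the second is the same sum over neighbours
    weighted by [mon b x]. They suffice to multiply out the two-dimensional blocks in [mon_step]. *)
Lemma lam_nbs b x : let T := Ab b ^+ (2 * x) in
  lam x.+1 + lamp x = - (Ab b ^+ 2 + Ab b ^- 2) * lam x /\
  lam x.+1 * T + lamp x * (T^-1 * Ab b ^- 4) =
  - (T * Ab b ^+ 2 + T^-1 * Ab b ^- 2) * lam x.
Proof.
move=> T; have Q0 := Ab_neq0 b; have D0 := AbD_neq0 b.
have T0 : T != 0 by rewrite expf_neq0.
have E0 : lam x = (-1) ^+ x * (T * Ab b ^+ 2 - T^-1 * Ab b ^- 2) / (Ab b ^+ 2 - Ab b ^- 2).
  have En : (2 * x.+1 = 2 * x + 2)%N by lia.
  by rewrite (lamAb b) En (exprD _ (2 * x)) invfM.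
have E1 : lam x.+1 = - (-1) ^+ x * (T * Ab b ^+ 4 - T^-1 * Ab b ^- 4) / (Ab b ^+ 2 - Ab b ^- 2).
  have En : (2 * x.+2 = 2 * x + 4)%N by lia.
  by rewrite (lamAb b) En (exprD _ (2 * x)) invfM [(-1) ^+ _]exprS mulN1r.
have E2 : lamp x = - (-1) ^+ x * (T - T^-1) / (Ab b ^+ 2 - Ab b ^- 2).
  rewrite /T; case: (x) => [|y] /=; first by rewrite expr0 invr1 subrr mulr0 mul0r.
  by rewrite (lamAb b) [(-1) ^+ y.+1]exprS mulN1r opprK.
rewrite E0 E1 E2; move: (Ab b ^+ 2 - Ab b ^- 2) D0 => D D0.
by split; field; rewrite ?D0 ?T0 ?Q0.
Qed.

(* Conjugating by a crossing: the seminormal form of the Jucys-Murphy elements. *)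
Lemma mon_step b n s f : path adj 0%N s -> (n.+1 < size s)%N ->
  op 0 (Cross b n) (fun t => mon b (vx t n) (vx t n.+1) * op 0 (Cross b n) f t) s =
  mon b (vx s n.+1) (vx s n.+2) * f s.
Proof.
move=> ps ns; have [|s1 [y [z [s2 [E E1]]]]] := @split2 _ n s; first by lia.
subst n s; set x := last 0%N s1.
have vE c d : (vx (s1 ++ [:: c, d & s2]) (size s1) = x) * (vx (s1 ++ [:: c, d & s2]) (size s1).+1 = c) *
   (vx (s1 ++ [:: c, d & s2]) (size s1).+2 = d).
  split; first split; first exact: vx_last.
    by rewrite /vx /= nth_cat ltnn subnn.
  by rewrite /vx /= nth_cat ltnNge leqnSn /= subSnn.
have /and4P[ps1 xy yz _] : [&& path adj 0%N s1, adj x y, adj y z & path adj z s2].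
  by move: ps; rewrite cat_path.
have xm : (x <= m)%N by exact: path_le ps1.
have ym := adj_le xm xy.
rewrite !cross_at -/x !vE; case: (eqVneq z x) => zx; last first.
  (* The path does not return to x after two steps, so both crossings act by the scalar [Ab b]. *)
  rewrite !mulr0 !addr0 !mulrA; congr (_ * _).
  move: xy yz; rewrite !adjE // => /andP[_ /orP[/eqP e1|/eqP e1]] /andP[_ /orP[/eqP e2|/eqP e2]].
  - by rewrite /mon e2 e1 !eqxx -exprS -exprSr; congr (_ ^+ _); lia.
  - by case/eqP: zx; lia.
  - by case/eqP: zx; lia.
  - rewrite /mon !ifF; [|lia..].
    have -> : (2 * x + 4 = (2 * y + 4) + 2)%N by lia.
    by rewrite exprD; have := Ab_neq0 b => B0; field; rewrite ?expf_neq0 ?B0.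
under [X in _ + _ * (_ * X)]eq_bigr => c _ do rewrite !vE cross_at -/x eqxx.
subst z; rewrite !(@sum_nbs x (fun c => f (s1 ++ [:: c, x & s2]))) //.
rewrite (@sum_nbs x (fun c => mon b x c * _)) //.
set f1 := f (s1 ++ [:: x.+1, x & s2]); set f2 := f (s1 ++ [:: x.-1, x & s2]).
have Q0 := Ab_neq0 b; have l0 := lam_neq0 xm.
pose T := Ab b ^+ (2 * x); have T0 : T != 0 by rewrite expf_neq0.
have m1 : mon b x x.+1 = T by rewrite /mon eqxx.
have m2 : mon b x x.-1 = T^-1 * Ab b ^- 4.
  by rewrite /mon ifF ?(exprD _ (2 * x)) ?invfM //; lia.
have [rS rM] := lam_nbs b x; rewrite -/T in rS rM.
move: (lam x) (lam x.+1) (lamp x) l0 rS rM => l L1 L2 l0 rS rM.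
rewrite m1 m2; move: xy; rewrite adjE // => /andP[_ /orP[/eqP e1|/eqP e1]].
  have -> : mon b y x = T^-1 * Ab b ^- 6.
    rewrite /mon ifF ?e1; last by lia.
    have -> : (2 * x.+1 + 4 = 2 * x + 6)%N by lia.
    by rewrite (exprD _ (2 * x)) invfM.
  rewrite e1 -/f1 m1.
  transitivity (Ab b ^+ 2 * T * f1 + T * (L1 * f1 + L2 * f2) / l
     + (L1 * T * f1 + L2 * (T^-1 * Ab b ^- 4) * f2) / l
     + Ab b ^- 2 * (L1 * f1 + L2 * f2) * (L1 * T + L2 * (T^-1 * Ab b ^- 4)) / l ^+ 2).
    by field; rewrite l0 T0 Q0.
  (* The two relations eliminate [L2] and the weighted sum. The terms in [f2] then cancel: this is
     the diagonality. *)
  rewrite rM; have -> : L2 = - (Ab b ^+ 2 + Ab b ^- 2) * l - L1 by rewrite -rS addrC addKr.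
  have E : L1 * (T - T^-1 * Ab b ^- 4) = l * (- T * Ab b ^+ 2 + T^-1 * Ab b ^- 6).
    have -> : L1 * (T - T^-1 * Ab b ^- 4) =
       (L1 * T + L2 * (T^-1 * Ab b ^- 4)) - (L1 + L2) * (T^-1 * Ab b ^- 4) by ring.
    by rewrite rM rS; field; rewrite T0 Q0.
  transitivity (Ab b ^+ 2 * T * f1 + (L1 * (T - T^-1 * Ab b ^- 4)) / l * f1).
    by field; rewrite l0 T0 Q0.
  by rewrite E; field; rewrite l0 T0 Q0.
have x0 : (0 < x)%N by rewrite e1.
have ey : y = x.-1 by rewrite e1.
have -> : mon b y x = T * Ab b ^- 2.
  rewrite /mon e1 eqxx /T e1 mulnS addnC exprD mulfK // expf_neq0 //.
rewrite ey -/f2 m2.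
transitivity (Ab b ^- 2 * T^-1 * f2 + T^-1 * Ab b ^- 4 * (L1 * f1 + L2 * f2) / l
   + (L1 * T * f1 + L2 * (T^-1 * Ab b ^- 4) * f2) / l
   + Ab b ^- 2 * (L1 * f1 + L2 * f2) * (L1 * T + L2 * (T^-1 * Ab b ^- 4)) / l ^+ 2).
  by field; rewrite l0 T0 Q0.
rewrite rM; have -> : L1 = - (Ab b ^+ 2 + Ab b ^- 2) * l - L2 by rewrite -rS addrK.
have E : L2 * (T^-1 * Ab b ^- 4 - T) = l * (T * Ab b ^- 2 - T^-1 * Ab b ^- 2).
  have -> : L2 * (T^-1 * Ab b ^- 4 - T) =
     (L1 * T + L2 * (T^-1 * Ab b ^- 4)) - (L1 + L2) * T by ring.
  by rewrite rM rS; field; rewrite T0 Q0.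
transitivity (Ab b ^- 2 * T^-1 * f2 + (L2 * (T^-1 * Ab b ^- 4 - T)) / l * f2).
  by field; rewrite l0 T0 Q0.
by rewrite E; field; rewrite l0 T0 Q0.
Qed.

Lemma ops_cons a e w f s : ops a (e :: w) f s = op a e (ops a w f) s.
Proof. by []. Qed.

Lemma mon_diag b n s f : path adj 0%N s -> (n < size s)%N ->
  ops 0 (L b 0 n ++ Rr b 0 n) f s = mon b (vx s n) (vx s n.+1) * f s.
Proof.
elim: n s f => [|n IH] s f ps ns.
  case: s ps ns => //= y s /andP[y0 _] _; rewrite /vx /= /mon.
  by move: y0; rewrite adjE // => /andP[_ /orP[/eqP->|//]]; rewrite eqxx mul1r.
rewrite L_S Rr_S add0n cat_cons catA ops_cons ops_cat.
rewrite -mon_step //; apply: op_ext => // t pt st _.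
rewrite /= in st; apply: IH => //; lia.
Qed.

Definition th (b : bool) (x : nat) : F := (-1) ^+ x * Ab b ^+ (x ^ 2 + 2 * x).

Lemma th0 b : th b 0 = 1. Proof. by rewrite /th mulr1. Qed.

Lemma th_neq0 b x : th b x != 0.
Proof. by rewrite /th mulf_neq0 ?signr_eq0 // expf_neq0 // Ab_neq0. Qed.

Lemma th_step b x y : (x <= m)%N -> adj x y ->
  th b y = - Ab b ^+ 3 * mon b x y * th b x.
Proof.
move=> xm; rewrite adjE // => /andP[_ /orP[/eqP->|/eqP->]].
  rewrite /th /mon eqxx exprS.
  have -> : (x.+1 ^ 2 + 2 * x.+1 = 3 + 2 * x + (x ^ 2 + 2 * x))%N by lia.
  by rewrite !exprD; ring.
rewrite /th /mon ifF; last by lia.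
have -> : (y.+1 ^ 2 + 2 * y.+1 = (y ^ 2 + 2 * y) + (2 * y + 3))%N by lia.
have -> : (2 * y.+1 + 4 = (2 * y + 3) + 3)%N by lia.
rewrite (exprD _ (y ^ 2 + 2 * y)) (exprD _ (2 * y + 3)) invfM [(-1) ^+ y.+1]exprS.
have Q0 := expf_neq0 3 (Ab_neq0 b); have T0 := expf_neq0 (2 * y + 3) (Ab_neq0 b).
move: (Ab b ^+ (2 * y + 3)) (Ab b ^+ 3) (Ab b ^+ (y ^ 2 + 2 * y)) ((-1) ^+ y) Q0 T0 => T Q S s Q0 T0.
by field; rewrite Q0.
Qed.

Lemma vx_le s i : path adj 0%N s -> (vx s i <= m)%N.
Proof.
move=> ps; have [h|h] := leqP i (size s); last by rewrite /vx nth_default.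
have [s1 [s2 [E E1]]] := split3 h; subst s i.
by rewrite vx_last path_le //; move: ps; rewrite cat_path => /andP[].
Qed.

Lemma vx_adj s i : path adj 0%N s -> (i < size s)%N -> adj (vx s i) (vx s i.+1).
Proof. by move/(pathP 0%N) => h /h. Qed.

(** Balancing against a single strand: the new strand brings its own kink and its monodromy around
    the first k, which are the factors of [th_step]. *)
Lemma curlR_S b k : curlR b k.+1 0 =~ curlR b 1 k ++ curlR b k 0 ++ L b 0 k ++ Rr b 0 k.
Proof.
rewrite -addn1 curlR_add add0n -X_1r -X_1l.
have wk : wf k (curlR b k 0) by apply: wf_curlR.
have H : X b k 1 0 ++ curlR b k 1 =~ curlR b k 0 ++ X b k 1 0.
  by have := natl b 1 0 wk; rewrite outs_curlR !sh_curlR => ->.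
by rewrite (tl2 H) -!catA.
Qed.

Lemma curl_diag b k s f : path adj 0%N s -> (k <= size s)%N ->
  ops 0 (curlR b k 0) f s = th b (vx s k) * f s.
Proof.
elim: k s f => [|k IH] s f ps ks.
  by rewrite (curl0 b 0).1 /vx /= th0 mul1r.
have wM : wf (size s) (L b 0 k ++ Rr b 0 k).
  by rewrite wf_cat outs_L wf_L wf_Rr add0n ks !orbT.
rewrite (eqv_wf _ (curlR_S b k)) //; first last.
- by rewrite !wf_cat !outs_curlR outs_L wf_L wf_Rr !wf_curlR ?add0n ?addn1 ?ks ?orbT //; lia.
- by rewrite wf_curlR.
have kE p a g t : (a <= m)%N -> path adj a t -> (p < size t)%N ->
    ops a (curlR b 1 p) g t = - Ab b ^+ 3 * g t.
  move=> *; have EL : L b p 1 = [:: Cross b p] by rewrite /L /= addn0.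
  by rewrite curlRE cupn1 capn1 X_1r EL addn1 kinkR.
rewrite ops_cat kE // ops_cat IH ?ps //; last by lia.
rewrite mon_diag // (th_step b _ (vx_adj ps ks)) ?vx_le //.
by ring.
Qed.

Fixpoint walks k a (h : nat -> F) : F :=
  if k is k'.+1 then \sum_(c <- nbs a) walks k' c h else h a.

Lemma walksZ k a c h : walks k a (fun b => c * h b) = c * walks k a h.
Proof.
by elim: k a => //= k IH a; rewrite mulr_sumr; apply: eq_bigr => d _; rewrite IH.
Qed.

(** The weights telescope along a walk: the cups give [lam] at every vertex after the start, the
    caps divide by [lam] at every vertex before the end. *)
Lemma cupcap k a f h s : (a <= m)%N -> path adj a s ->
  ops a (cupn k 0) (fun t => h (nth 0%N (a :: t) k) * ops a (capn k 0) f t) s =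
  (lam a)^-1 * walks k a (fun b => lam b * h b) * f s.
Proof.
elim: k a f s => [|k IH] a f s am ps; first by rewrite /= mulKf ?lam_neq0.
have Ecup : cupn k.+1 0 = Cup tt 0 :: sh 1 (cupn k 0) by rewrite -add1n cupn_add sh_cupn cupn1.
have Ecap : capn k.+1 0 = sh 1 (capn k 0) ++ [:: Cap 0] by rewrite -add1n capn_add sh_capn capn1.
rewrite Ecup Ecap ops_cons [op _ _ _ _]/= [walks _ _ _]/= mulr_sumr mulr_suml; apply: eq_big_seq => c ac.
have cm := adj_le am ac; rewrite (ops_sh _ _ _ [:: c]) /=.
transitivity (lam c * ops c (cupn k 0) (fun t => h (nth 0%N (c :: t) k) *
    ops c (capn k 0) (fun u => op a (Cap 0) f (c :: u)) t) (a :: s)).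
  congr (_ * ops _ _ _ _); apply: funext => t; congr (_ * _).
  by rewrite ops_cat (ops_sh _ _ _ [:: c]).
rewrite IH //=; last by rewrite (adj_sym am ac).
by rewrite eqxx -mulrA mulVKf ?lam_neq0 // mulrCA mulrA.
Qed.

(** The circle is taken with framing +1: the extra curl turns its double crossing with the strands
    into a quotient of full twists. *)
Definition circ1 k n : seq (slice unit) :=
  cupn k n ++ X true n k 0 ++ X true k n 0 ++ curlR true k n ++ capn k n.

(** By the balancing relation the full twist on n + k strands is the full twist on n strands
    followed by [w]. Both twists are diagonal and the second one is invertible. *)
Lemma monodromy_diag k n s f : path adj 0%N s -> (n + k <= size s)%N ->
  ops 0 (X true n k 0 ++ X true k n 0 ++ curlR true k n) f s =
  th true (vx s (n + k)) / th true (vx s n) * f s.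
Proof.
move=> ps ns; set w := X _ _ _ _ ++ _.
have wn : wf n (curlR true n 0) by apply: wf_curlR.
have wk : wf k (curlR true k 0) by apply: wf_curlR.
have E : curlR true (n + k) 0 =~ curlR true n 0 ++ w.
  have H1 : X true n k 0 ++ curlR true n k =~ curlR true n 0 ++ X true n k 0.
    by have := natl true k 0 wn; rewrite outs_curlR !sh_curlR !addn0 ?add0n => ->.
  have H2 : curlR true k n ++ X true n k 0 =~ X true n k 0 ++ curlR true k 0.
    by have := natr true n 0 wk; rewrite outs_curlR !sh_curlR !addn0 ?add0n => ->.
  have H3 : curlR true k 0 ++ X true k n 0 =~ X true k n 0 ++ curlR true k n.
    by have := natl true n 0 wk; rewrite outs_curlR !sh_curlR !addn0 ?add0n => ->.
  have H4 : curlR true k n ++ curlR true n 0 =~ curlR true n 0 ++ curlR true k n.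
    have := @far 0 n _ (curlR true k 0) wn.
    by rewrite outs_curlR !sh_curlR !addn0 ?add0n => ->.
  by rewrite curlR_add add0n (tl2 H1) -catA (tl2 H4) -catA (tl2 H2) -catA H3.
have ww : wf (size s) w by rewrite !wf_cat !outs_X !wf_X ?wf_curlR //; lia.
have := @eqv_wf _ _ 0 s f E.
rewrite wf_cat !wf_curlR ?outs_curlR ?ww //; [|lia..].
move=> /(_ isT isT isT ps); rewrite curl_diag // ops_cat curl_diag //; last by lia.
by move=> H; apply: (mulfI (th_neq0 true (vx s n))); rewrite -H mulrA mulrCA mulfV ?mulr1 ?th_neq0.
Qed.

Lemma circ1_diag k n s f : path adj 0%N s -> (n <= size s)%N ->
  ops 0 (circ1 k n) f s =
  (lam (vx s n) * th true (vx s n))^-1 *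
  walks k (vx s n) (fun b => lam b * th true b) * f s.
Proof.
move=> ps ns; have [s1 [s2 [E E1]]] := split3 ns; subst s n.
rewrite /circ1 vx_last; set a := last _ _.
move: ps; rewrite cat_path -/a => /andP[ps1 ps2].
have am : (a <= m)%N by exact: path_le ps1.
have EC : cupn k (size s1) = sh (size s1) (cupn k 0) by rewrite sh_cupn addn0.
have EC' : capn k (size s1) = sh (size s1) (capn k 0) by rewrite sh_capn addn0.
rewrite ops_cat EC ops_sh -/a.
transitivity (ops a (cupn k 0) (fun t => th true (nth 0%N (a :: t) k) / th true a *
    ops a (capn k 0) (fun u => f (s1 ++ u)) t) s2).
  apply: ops_ext_wf => //; first by rewrite wf_cupn.
  move=> t pt; rewrite outs_cupn => st _.
  have pst : path adj 0%N (s1 ++ t) by rewrite cat_path ps1.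
  have -> : X true (size s1) k 0 ++ X true k (size s1) 0 ++ curlR true k (size s1) ++ capn k (size s1) =
      (X true (size s1) k 0 ++ X true k (size s1) 0 ++ curlR true k (size s1)) ++ capn k (size s1).
    by rewrite -!catA.
  rewrite ops_cat monodromy_diag ?size_cat ?st //; last by lia.
  by rewrite vx_last -/a vx_cat EC' ops_sh.
rewrite (@cupcap k a _ (fun b => th true b / th true a)) //; congr (_ * _).
rewrite (invfM (lam a)) -mulrA; congr (_ * _); rewrite -walksZ; congr walks.
by apply: funext => b; rewrite mulrA mulrC.
Qed.

(* Block form of the repeated cyclic permutation in a full twist: the blocks of
   t pass one after the other to the right of all the others. *)
Fixpoint Pw b (t u : seq nat) o : seq (slice unit) :=
  if t is a :: t' then X b a (sumn t' + sumn u) o ++ Pw b t' (rcons u a) o else [::].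

Fixpoint curls b (t : seq nat) o : seq (slice unit) :=
  if t is a :: t' then curlR b a o ++ curls b t' (o + a)%N else [::].

Lemma sumn_rcons' t a : sumn (rcons t a) = (sumn t + a)%N.
Proof. by rewrite -cats1 sumn_cat /= addn0. Qed.

Lemma sh_Pw q b t u o : sh q (Pw b t u o) = Pw b t u (q + o).
Proof. by elim: t u => //= a t IH u; rewrite sh_cat sh_X IH. Qed.

Lemma outs_Pw b t u o N : outs N (Pw b t u o) = N.
Proof. by elim: t u => //= a t IH u; rewrite outs_cat outs_X IH. Qed.

Lemma wf_Pw b t u o N : (o + sumn t + sumn u <= N)%N -> wf N (Pw b t u o).
Proof.
elim: t u => //= a t IH u h; rewrite wf_cat outs_X wf_X ?IH ?sumn_rcons' //; lia.
Qed.

Lemma sh_curls q b t o : sh q (curls b t o) = curls b t (q + o).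
Proof. by elim: t o => //= a t IH o; rewrite sh_cat sh_curlR IH addnA. Qed.

Lemma outs_curls b t o N : outs N (curls b t o) = N.
Proof. by elim: t o => //= a t IH o; rewrite outs_cat outs_curlR IH. Qed.

Lemma wf_curls b t o N : (o + sumn t <= N)%N -> wf N (curls b t o).
Proof.
elim: t o => //= a t IH o h; rewrite wf_cat outs_curlR wf_curlR ?IH //; lia.
Qed.

Lemma Pw_split b t u o : Pw b t u o =~ Pw b t [::] o ++ X b (sumn t) (sumn u) o.
Proof.
elim: t u => [|a t IH] u /=; first by rewrite X_0l.
rewrite IH [Pw b t [:: a] o]IH sumn_rcons' /= !addn0 -!catA X_addr -catA.
have wP : wf (sumn t) (Pw b t [::] 0) by apply: wf_Pw; rewrite /= addn0.
have H : X b a (sumn u) (o + sumn t) ++ Pw b t [::] o =~ Pw b t [::] o ++ X b a (sumn u) (o + sumn t).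
  have := @far o _ _ (X b a (sumn u) 0) wP.
  by rewrite outs_Pw sh_Pw sh_X !addn0 => ->.
rewrite (tl2 H) -catA; do 2 (apply: eqv_cat; first exact: eqv_refl).
rewrite (X_addr b (sumn t) (sumn u) a) (X_addl b a (sumn t) (sumn u)).
by rewrite -R3l.
Qed.

(** [Pw_split] isolates the first block; what surrounds the full twist of the remaining blocks is
    then the balancing relation [curlR_add]. *)
Lemma full_twist_curl b t o : Pw b t [::] o ++ curls b t o =~ curlR b (sumn t) o.
Proof.
elim: t o => [|a t IH] o /=; first by rewrite (curl0 b o).1.
rewrite addn0 Pw_split /= addn0 curlR_add -!catA.
have wc : wf a (curlR b a 0) by apply: wf_curlR.
have wt : wf (sumn t) (curls b t 0) by apply: wf_curls.
have wT : wf (sumn t) (curlR b (sumn t) 0) by apply: wf_curlR.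
have H1 : X b (sumn t) a o ++ curlR b a o =~ curlR b a (o + sumn t) ++ X b (sumn t) a o.
  by have := natr b (sumn t) o wc; rewrite outs_curlR !sh_curlR !addn0 => ->.
have H2 : X b (sumn t) a o ++ curls b t (o + a) =~ curls b t o ++ X b (sumn t) a o.
  by have := natl b a o wt; rewrite outs_curls !sh_curls !addn0 => ->.
have H3 : curlR b a (o + sumn t) ++ curls b t o =~ curls b t o ++ curlR b a (o + sumn t).
  have := @far o _ _ (curlR b a 0) wt.
  by rewrite outs_curls sh_curls sh_curlR !addn0 => ->.
have H4 : curlR b (sumn t) (o + a) ++ X b a (sumn t) o =~ X b a (sumn t) o ++ curlR b (sumn t) o.
  by have := natr b a o wT; rewrite outs_curlR !sh_curlR !addn0 => ->.
by rewrite (tl2 H1) -catA H2 (tl2 H3) -catA (tl2 (IH o)) (tl2 H4) -catA.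
Qed.

(** * Cables of circles, kinks and full twists *)

Section CableBlocks.
Variable C : finType.
Implicit Types (k : C -> nat) (s ls : seq (label C)) (w : word (label C)).

Lemma run_left b s1 ls x s2 k :
  let w := [seq Cross b (size s1 + i)%N | i <- rev (iota 0 (size ls))] in
  run (s1 ++ ls ++ x :: s2) w = Some (s1 ++ x :: ls ++ s2) /\
  cable_from k (s1 ++ ls ++ x :: s2) w =~ X b (K k ls) (k x.1) (K k s1).
Proof.
elim/last_ind: ls s2 => [|ls y IH] s2 /=; first by rewrite X_0l.
rewrite size_rcons -addn1 iotaD rev_cat map_cat [map _ _]/= cat1s add0n.
have E : s1 ++ rcons ls y ++ x :: s2 = (s1 ++ ls) ++ y :: x :: s2 by rewrite -cats1 -!catA.
have E2 : (s1 ++ ls) ++ x :: y :: s2 = s1 ++ ls ++ x :: y :: s2 by rewrite -catA.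
have [IH1 IH2] := IH (y :: s2).
rewrite -size_cat E run_cons cable_cons !cableE obindE odfltE E2 IH1 IH2; split.
  by rewrite -cats1 -!catA.
by rewrite K_cat -cats1 K_cat -X_addl K_cons addn0.
Qed.

Lemma run_right b s1 ls x s2 k :
  let w := [seq Cross b (size s1 + i)%N | i <- iota 0 (size ls)] in
  run (s1 ++ x :: ls ++ s2) w = Some (s1 ++ ls ++ x :: s2) /\
  cable_from k (s1 ++ x :: ls ++ s2) w = X b (k x.1) (K k ls) (K k s1).
Proof.
elim/last_ind: ls s2 => [|ls y IH] s2 //=.
rewrite size_rcons -addn1 iotaD map_cat add0n.
have E : s1 ++ x :: rcons ls y ++ s2 = s1 ++ x :: ls ++ y :: s2 by rewrite cat_rcons.
have E2 : s1 ++ ls ++ x :: y :: s2 = (s1 ++ ls) ++ x :: y :: s2 by rewrite -catA.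
have [IH1 IH2] := IH (y :: s2).
rewrite E run_cat (cable_cat _ _ IH1) IH1 IH2 obindE E2 [map _ _]/= -size_cat.
rewrite run_cons cable_cons !cableE cats0; split; first by rewrite cat_rcons -catA.
by rewrite !K_cat -cats1 K_cat X_addr K_cons addn0.
Qed.

Lemma run_kink b s1 c d s2 k :
  run (s1 ++ (c, d) :: s2) (kink (c, d) b (size s1)) = Some (s1 ++ (c, d) :: s2) /\
  cable_from k (s1 ++ (c, d) :: s2) (kink (c, d) b (size s1)) = curlR b (k c) (K k s1).
Proof.
rewrite /kink !run_cons !cable_cons !(cableE, obindE, odfltE) !run_cons !(cableE, obindE, odfltE).
rewrite run_cons step_cap1 eqxx; split; first by case: (d).
by rewrite curlRE cats0.
Qed.

Lemma run_kinkP b s1 x s2 l s' :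
  run (s1 ++ x :: s2) (kink l b (size s1)) = Some s' -> l = x.
Proof.
case: l => c d; rewrite /kink !run_cons !(cableE, obindE) run_cons !(cableE, obindE).
rewrite run_cons step_cap1; case: ifP => // /andP[/eqP]; case: x => c' d' /= ->.
by move/neq_negb/(can_inj negbK) => ->.
Qed.

Definition kinkw f j o := flatten (nseq `|f : int|%N (curlR (0 <= f) j o)).

Lemma run_kinks f s1 c d s2 k :
  run (s1 ++ (c, d) :: s2) (kinks (c, d) f (size s1)) = Some (s1 ++ (c, d) :: s2) /\
  cable_from k (s1 ++ (c, d) :: s2) (kinks (c, d) f (size s1)) = kinkw f (k c) (K k s1).
Proof.
have FE T n (x : seq T) : flatten (nseq n.+1 x) = x ++ flatten (nseq n x) by [].
rewrite /kinks /kinkw; elim: `|f|%N => // n [IH1 IH2]; rewrite !FE.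
have [R1 R2] := run_kink (0 <= f) s1 c d s2 k.
by rewrite run_cat (cable_cat _ _ R1) R1 R2 obindE IH1 IH2.
Qed.

Definition circle_head (c : C) p n : word (label C) :=
  Cup ((c, true) : label C) (p + n)%N ::
  [seq Cross true (p + i)%N | i <- rev (iota 0 n)] ++
  [seq Cross true (p + i)%N | i <- iota 0 n].

Lemma circleE c f p n : circle c f p n =
  circle_head c p n ++ kinks ((c, true) : label C) f (p + n)%N ++ [:: Cap (p + n)%N].
Proof. by rewrite /circle /circle_head /= -!catA. Qed.

Lemma run_circle_head c s1 ls s2 k :
  let w := circle_head c (size s1) (size ls) in
  run (s1 ++ ls ++ s2) w = Some ((s1 ++ ls) ++ (c, true) :: (c, false) :: s2) /\
  cable_from k (s1 ++ ls ++ s2) w =~ cupn (k c) (K k s1 + K k ls) ++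
    X true (K k ls) (k c) (K k s1) ++ X true (k c) (K k ls) (K k s1).
Proof.
move=> w; rewrite {}/w /circle_head run_cons cable_cons (catA s1) -size_cat step_cup cable_cup.
rewrite obindE odfltE -(catA s1) [~~ _]/=.
have [R1 R2] := run_left true s1 ls (c, true) ((c, false) :: s2) k.
have [R3 R4] := run_right true s1 ls (c, true) ((c, false) :: s2) k.
rewrite run_cat (cable_cat _ _ R1) R1 obindE R3 R4; split=> //.
by rewrite R2 K_cat.
Qed.

Lemma run_cap c s1 s2 k :
  run (s1 ++ (c, true) :: (c, false) :: s2) [:: Cap (size s1)] = Some (s1 ++ s2) /\
  cable_from k (s1 ++ (c, true) :: (c, false) :: s2) [:: Cap (size s1)] = capn (k c) (K k s1).
Proof. by rewrite run_cons cable_cons !cableE eqxx cats0. Qed.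

Lemma run_circle c f s1 ls s2 k :
  let w := circle c f (size s1) (size ls) in
  run (s1 ++ ls ++ s2) w = Some (s1 ++ ls ++ s2) /\
  cable_from k (s1 ++ ls ++ s2) w =~ cupn (k c) (K k s1 + K k ls) ++
    X true (K k ls) (k c) (K k s1) ++ X true (k c) (K k ls) (K k s1) ++
    kinkw f (k c) (K k s1 + K k ls) ++ capn (k c) (K k s1 + K k ls).
Proof.
move=> w; rewrite {}/w circleE; have [R1 R2] := run_circle_head c s1 ls s2 k.
have [R3 R4] := run_kinks f (s1 ++ ls) c true ((c, false) :: s2) k.
have [R5 R6] := run_cap c (s1 ++ ls) s2 k.
rewrite run_cat (cable_cat _ _ R1) R1 obindE -size_cat run_cat R3 obindE R5 -catA; split=> //.
by rewrite R2 (cable_cat _ _ R3) R4 R6 K_cat -!catA.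
Qed.

Lemma run_circle1 c s1 ls s2 k :
  cable_from k (s1 ++ ls ++ s2) (circle c 1 (size s1) (size ls)) =~
  sh (K k s1) (circ1 (k c) (K k ls)).
Proof.
rewrite (run_circle c 1 s1 ls s2 k).2 /circ1 !sh_cat sh_cupn !sh_X sh_curlR sh_capn !addn0.
by rewrite /kinkw /= cats0.
Qed.

Lemma run_cyc b s1 t u s2 k N : size t + size u = N.+1 ->
  let w := flatten (nseq (size t) [seq Cross b (size s1 + i)%N | i <- iota 0 N]) in
  run (s1 ++ (t ++ u) ++ s2) w = Some (s1 ++ (u ++ t) ++ s2) /\
  cable_from k (s1 ++ (t ++ u) ++ s2) w = Pw b [seq k x.1 | x <- t] [seq k x.1 | x <- u] (K k s1).
Proof.
elim: t u => [|x t IH] u sz /=; first by rewrite cats0.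
have sz' : size (t ++ u) = N by move: sz; rewrite /= size_cat; lia.
have [R1 R2] := run_right b s1 (t ++ u) x s2 k; rewrite sz' in R1 R2.
have [|IH1 IH2] := IH (rcons u x); first by move: sz; rewrite size_rcons /=; lia.
have E : (t ++ u) ++ x :: s2 = (t ++ rcons u x) ++ s2 by rewrite -cats1 -!catA.
rewrite run_cat (cable_cat _ _ R1) R1 R2 obindE E IH1 IH2 K_cat map_rcons; split=> //.
by rewrite cat_rcons.
Qed.

Lemma run_curls b p j s1 ls' ls s2 s' k : size s1 = (p + j)%N -> size ls = size ls' ->
  let w := flatten [seq kink x.2 b (p + x.1)%N | x <- zip (iota j (size ls)) ls] in
  run (s1 ++ ls' ++ s2) w = Some s' ->
  [/\ ls = ls', s' = s1 ++ ls' ++ s2 &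
   cable_from k (s1 ++ ls' ++ s2) w = curls b [seq k x.1 | x <- ls'] (K k s1)].
Proof.
elim: ls ls' j s1 => [|l ls IH] [|x ls'] // j s1 s1p; first by move=> _ /= [<-].
case=> sz w; have -> : w = kink l b (size s1) ++
    flatten [seq kink x.2 b (p + x.1)%N | x <- zip (iota j.+1 (size ls)) ls].
  by rewrite s1p.
move=> {w} /run_catP[t R1 R2].
have lx := run_kinkP R1; subst l; case: x R1 => c d R1.
have [R3 R4] := run_kink b s1 c d (ls' ++ s2) k.
move: R1; rewrite R3 => -[Et]; subst t.
rewrite (cable_cat _ _ R3) R4.
have E : s1 ++ (c, d) :: ls' ++ s2 = (s1 ++ [:: (c, d)]) ++ ls' ++ s2 by rewrite -catA.
rewrite E in R2 *; case: (IH ls' j.+1 _ _ sz R2); first by rewrite size_cat s1p addn1 addnS.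
by move=> <- -> ->; split; rewrite // K_cat K_cons /K /= addn0.
Qed.

(** A kink closes up on a strand only if their labels agree ([run_kinkP]), so a twist that can be
    run carries exactly the labels met on the line. *)
Lemma run_full_twist b s1 ls' ls s2 s' k : size ls = size ls' ->
  run (s1 ++ ls' ++ s2) (full_twist b (size s1) ls) = Some s' ->
  [/\ ls = ls', s' = s1 ++ ls' ++ s2 &
   cable_from k (s1 ++ ls' ++ s2) (full_twist b (size s1) ls) =~ curlR b (K k ls') (K k s1)].
Proof.
move=> sz; rewrite /full_twist => /run_catP[t R1 R2].
have [R3 R4] : run (s1 ++ ls' ++ s2) (flatten (nseq (size ls)
     [seq Cross b (size s1 + i)%N | i <- iota 0 (size ls).-1])) = Some (s1 ++ ls' ++ s2) /\
   cable_from k (s1 ++ ls' ++ s2) (flatten (nseq (size ls)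
     [seq Cross b (size s1 + i)%N | i <- iota 0 (size ls).-1])) =
   Pw b [seq k x.1 | x <- ls'] [::] (K k s1).
  case: ls' sz {R1 R2} => [|x ls'] -> //.
  by have := @run_cyc b s1 (x :: ls') [::] s2 k (size ls') (addn0 _); rewrite !cats0.
move: R1; rewrite R3 => -[Et]; subst t.
have [|E1 E2 E3] := @run_curls b (size s1) 0 s1 ls' ls s2 s' k _ sz R2; first by rewrite addn0.
split=> //; rewrite (cable_cat _ _ R3) R4 E3; exact: full_twist_curl.
Qed.
End CableBlocks.

(* Up to the loop value this is the projection e of the header. *)
Definition ew p : seq (slice unit) := [:: Cap p; Cup tt p].

(** * Colouring one component *)

Lemma cup_cupn k p : Cup tt p :: cupn k p.+2 =~ cupn k p ++ [:: Cup tt p].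
Proof.
have := @far p 0 [:: Cup tt 0] (cupn k 0) isT; rewrite !sh_cupn /= !addn0.
by rewrite addn2.
Qed.

Lemma capn_cap k p : capn k p.+2 ++ [:: Cap p] =~ Cap p :: capn k p.
Proof.
have := @far p 2 [:: Cap 0] (capn k 0) isT; rewrite !sh_capn /= !addn0.
by rewrite addn2 => <-.
Qed.

Section Nested.
Variables (j r o : nat).
Let n := (j + r)%N.

Lemma cupn_jr : cupn n.+2 o =
  cupn j o ++ [:: Cup tt (o + j); Cup tt (o + j).+1] ++ cupn r (o + j).+2.
Proof.
have -> : n.+2 = (j + (2 + r))%N by rewrite /n; lia.
by rewrite !cupn_add [cupn 2 _]/cupn /= addn0 addn1 addn2.
Qed.

Lemma capn_jr : capn n.+2 o =
  capn r (o + j).+2 ++ [:: Cap (o + j).+1; Cap (o + j)] ++ capn j o.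
Proof.
have -> : n.+2 = (j + (2 + r))%N by rewrite /n; lia.
by rewrite !capn_add [capn 2 _]/capn /= addn0 addn1 addn2 -catA.
Qed.

Lemma cup_capL : cupn n.+2 o ++ [:: Cap (o + j)] =~ cupn n o ++ [:: Cup tt (o + n + r)].
Proof.
rewrite cupn_jr -!catA /n cupn_add -catA.
have -> : (o + (j + r) + r = o + j + r.*2)%N by lia.
have H : cupn r (o + j).+2 ++ [:: Cap (o + j)] =~ [:: Cap (o + j)] ++ cupn r (o + j).
  have := @far (o + j) 2 [:: Cap 0] (cupn r 0) isT.
  by rewrite !sh_cupn /= !addn0 addn2 => <-.
rewrite H -[[:: _; _] ++ _]/([:: Cup tt (o + j)] ++ [:: Cup tt (o + j).+1; Cap (o + j)] ++ cupn r (o + j)).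
have H2 := @farcup r (o + j) [:: Cup tt 0] (o + j) (leqnn _).
rewrite /= !addn0 in H2.
by rewrite zig1 /= H2.
Qed.

Lemma cup_capR : cupn n.+2 o ++ [:: Cap (o + n.+2 + r)] =~ cupn n o ++ [:: Cup tt (o + j)].
Proof.
rewrite cupn_jr -!catA /n cupn_add -catA.
have -> : (o + (j + r).+2 + r = (o + j).+2 + r.*2)%N by lia.
have H := @farcup r (o + j).+2 [:: Cap 0] (o + j).+2 (leqnn _).
rewrite /= !addn0 in H; rewrite H.
rewrite -[[:: _; _] ++ _]/([:: Cup tt (o + j)] ++ [:: Cup tt (o + j).+1; Cap (o + j).+2] ++ cupn r (o + j).+2).
by rewrite zig2 /= cup_cupn.
Qed.

Lemma cap_cupL : Cup tt (o + j) :: capn n.+2 o =~ Cap (o + n + r) :: capn n o.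
Proof.
rewrite capn_jr /n capn_add.
have -> : (o + (j + r) + r = o + j + r.*2)%N by lia.
have H : Cup tt (o + j) :: capn r (o + j).+2 =~ capn r (o + j) ++ [:: Cup tt (o + j)].
  have := @far (o + j) 0 [:: Cup tt 0] (capn r 0) isT.
  by rewrite !sh_capn /= !addn0 addn2.
rewrite -cat_cons H -catA.
rewrite -[[:: Cup tt _] ++ _]/([:: Cup tt (o + j); Cap (o + j).+1] ++ Cap (o + j) :: capn j o) zig2.
have H2 := @farcap r (o + j) [:: Cap 0] (o + j) (leqnn _).
rewrite /= !addn0 in H2.
by rewrite -[X in _ =~ X]cat_cons -H2 -catA.
Qed.

Lemma cap_cupR : Cup tt (o + n.+2 + r) :: capn n.+2 o =~ Cap (o + j) :: capn n o.
Proof.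
rewrite capn_jr /n capn_add.
have -> : (o + (j + r).+2 + r = (o + j).+2 + r.*2)%N by lia.
have H := @farcap r (o + j).+2 [:: Cup tt 0] (o + j).+2 (leqnn _).
rewrite /= !addn0 in H; rewrite -cat_cons -H -catA.
rewrite -[[:: Cup tt _] ++ _]/([:: Cup tt (o + j).+2; Cap (o + j).+1] ++ Cap (o + j) :: capn j o) zig1.
by rewrite -[X in _ =~ X]cat_cons -capn_cap -catA.
Qed.

(** A turnback slides along the nested arcs from one foot to the other, where it arrives in the
    mirror position. *)
Lemma cup_ew : cupn n.+2 o ++ ew (o + j) =~ cupn n.+2 o ++ ew (o + n.+2 + r).
Proof.
rewrite /ew -[[:: _; _]]/([:: Cap (o + j)] ++ [:: Cup tt (o + j)]).
rewrite -[[:: Cap (o + n.+2 + r); _]]/([:: Cap (o + n.+2 + r)] ++ [:: Cup tt (o + n.+2 + r)]).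
rewrite !catA cup_capL cup_capR -!catA; apply: eqv_cat => //.
have := @far (o + j) 0 [:: Cup tt 0] [:: Cup tt (n + r - j)] isT.
rewrite /= !addn0.
have [-> ->] : ((o + j + 2 + (n + r - j) = o + n.+2 + r) /\ (o + j + (n + r - j) = o + n + r))%N by split; rewrite /n; lia.
by move=> <-.
Qed.

Lemma cap_ew : ew (o + j) ++ capn n.+2 o =~ ew (o + n.+2 + r) ++ capn n.+2 o.
Proof.
rewrite /ew /= cap_cupL cap_cupR.
have := @far (o + j) 2 [:: Cap 0] [:: Cap (n + r - j)] isT.
rewrite /= !addn0.
have [-> ->] : ((o + j + 2 + (n + r - j) = o + n.+2 + r) /\ (o + j + (n + r - j) = o + n + r))%N by split; rewrite /n; lia.
by move=> H; rewrite -[X in X =~ _]/([:: Cap (o + j); Cap (o + n + r)] ++ capn n o) H.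
Qed.
End Nested.

(** The value of a closed diagram cut at the line [s], with an operator [Y] inserted that need not
    come from a diagram. *)
Definition Phi (C : finType) (k : C -> nat) (u v : word (label C)) s
    (Y : (seq nat -> F) -> seq nat -> F) : F :=
  ops 0 (cable_from k [::] u) (Y (ops 0 (cable_from k s v) (fun=> 1))) [::].

(* Operators on the first q strands, not necessarily given by a diagram. *)
Record coupon q (D : (seq nat -> F) -> seq nat -> F) : Prop := Coupon {
  coupon_lin : forall c f g, D (fun r => c * f r + g r) = fun r => c * D f r + D g r;
  coupon_ext : forall f g r, path adj 0%N r -> (q <= size r)%N ->
    (forall r', path adj 0%N r' -> size r' = size r -> f r' = g r') -> D f r = D g r;
  coupon_comm : forall x f r, path adj 0%N r -> (q <= size r)%N -> wf (size r - q) x ->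
    D (ops 0 (sh q x) f) r = ops 0 (sh q x) (D f) r }.

Lemma coupon0 q D : coupon q D -> D (fun=> 0) = fun=> 0.
Proof.
move=> cD; have := coupon_lin cD (-1) (fun=> 0) (fun=> 0).
have -> : (fun _ : seq nat => -1 * 0 + 0) = (fun _ : seq nat => 0 : F).
  by apply: funext => u; rewrite mulr0 addr0.
by move=> ->; apply: funext => u; rewrite mulN1r addNr.
Qed.

Lemma couponZ q D c f : coupon q D -> D (fun r => c * f r) = fun r => c * D f r.
Proof.
move=> cD; have -> : (fun r => c * f r) = (fun r => c * f r + 0).
  by apply: funext => r; rewrite addr0.
by rewrite (coupon_lin cD) (coupon0 cD); apply: funext => r; rewrite addr0.
Qed.

Section Projector.
Variables (C : finType) (c0 : C) (k : C -> nat) (n i : nat) (d0 : bool).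
Hypothesis i_le : (i <= n)%N.
Implicit Types (s ls : seq (label C)) (w : word (label C)) (e : slice (label C)).

Let kk := upd k c0 n.+2.
Let kt := upd k c0 n.
(** The parallel copies keep their order relative to the direction of the knot, so a turnback at i
    on the strands directed as [d0] is seen at n - i on the others. *)
Definition ix d := if d == d0 then i else (n - i)%N.

Lemma ix_neg d : ix (~~ d) = (n - ix d)%N.
Proof. by rewrite /ix; case: d; case: d0 => /=; lia. Qed.
Lemma ix_le d : (ix d <= n)%N.
Proof. by rewrite /ix; case: ifP => _ //; exact: leq_subr. Qed.

Lemma kk0 : kk c0 = n.+2. Proof. by rewrite /kk /upd eqxx. Qed.
Lemma kt0 : kt c0 = n. Proof. by rewrite /kt /upd eqxx. Qed.
Lemma kkt c : c != c0 -> kk c = kt c.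
Proof. by rewrite /kk /kt /upd => /negPf->. Qed.

(* Passage from n to n + 2 parallel copies of c0: one cup in each strand. *)
Fixpoint Jw o s : seq (slice unit) :=
  if s is x :: s' then
    (if x.1 == c0 then [:: Cup tt (o + ix x.2)%N] else [::]) ++ Jw (o + kk x.1)%N s'
  else [::].

Lemma Jw_cat o s1 s2 : Jw o (s1 ++ s2) = Jw o s1 ++ Jw (o + K kk s1) s2.
Proof.
elim: s1 o => [|x s1 IH] o /=; first by rewrite addn0.
by rewrite IH K_cons addnA catA.
Qed.

Lemma sh_Jw q o s : sh q (Jw o s) = Jw (q + o) s.
Proof.
elim: s o => //= x s IH o; rewrite sh_cat IH addnA; congr (_ ++ _).
by case: eqP => //= _; rewrite addnA.
Qed.

Lemma wf_Jw o s N : (o + K kt s <= N)%N ->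
  wf N (Jw o s) /\ (outs N (Jw o s) + K kt s = N + K kk s)%N.
Proof.
elim: s o N => //= x s IH o N; rewrite !K_cons wf_cat outs_cat => h.
case: eqP => [xc|/eqP xc] /=.
  rewrite xc kt0 in h; have := ix_le x.2; rewrite xc kk0 kt0 /outs1 /= => ixl.
  by have [|-> E] := IH (o + n.+2)%N (N + 2 - 0)%N; lia.
by rewrite -(kkt xc) in h *; have [|-> E] := IH (o + kk x.1)%N N; lia.
Qed.

Lemma wfJ s : wf (K kt s) (Jw 0 s).
Proof. by have [] := @wf_Jw 0 s (K kt s) (leqnn _). Qed.
Lemma outsJ s : outs (K kt s) (Jw 0 s) = K kk s.
Proof. by have [_] := @wf_Jw 0 s (K kt s) (leqnn _); lia. Qed.

Lemma Jw_local s1 i1 o1 s2 xT xL :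
  wf (K kk i1) xT -> outs (K kk i1) xT = K kk o1 ->
  Jw 0 i1 ++ xT =~ xL ++ Jw 0 o1 ->
  Jw 0 (s1 ++ i1 ++ s2) ++ sh (K kk s1) xT =~ sh (K kt s1) xL ++ Jw 0 (s1 ++ o1 ++ s2).
Proof.
move=> wT oT H; rewrite !Jw_cat !add0n -!catA.
have F1 : Jw (K kk s1 + K kk i1) s2 ++ sh (K kk s1) xT =~ sh (K kk s1) xT ++ Jw (K kk s1 + K kk o1) s2.
  by have := far (K kk s1) (Jw 0 s2) wT; rewrite oT !sh_Jw !addn0 => ->.
rewrite F1.
have F2 : Jw (K kk s1) i1 ++ sh (K kk s1) xT =~ sh (K kk s1) xL ++ Jw (K kk s1) o1.
  by have := eqv_sh (K kk s1) H; rewrite !sh_cat !sh_Jw addn0.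
rewrite (tl2 F2) -catA.
have F3 : Jw 0 s1 ++ sh (K kk s1) xL =~ sh (K kt s1) xL ++ Jw 0 s1.
  by have := eqv_far xL (wfJ s1); rewrite outsJ.
by rewrite (tl2 F3) -catA.
Qed.

Definition is0 e := match e with Cup (c, _) _ => c == c0 | _ => false end.

Definition markT s e : seq (slice unit) :=
  match e with
  | Cup (c, d) p => if c == c0 then ew (K kk (take p s) + ix d) else [::]
  | _ => [::]
  end.

(** The thick cable with a turnback at every cup of [c0]: the term that survives when 1 = e + (1 -
    e) is inserted everywhere. *)
Fixpoint cableT s w : seq (slice unit) :=
  if w is e :: w' then
    cable_slice kk s e ++ markT s e ++ cableT (odflt [::] (step s e)) w'
  else [::].

Definition loopL s e : seq (slice unit) :=
  match e with
  | Cap p => if onth s p is Some x then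
               (if x.1 == c0 then [:: Cup tt 0; Cap 0] else [::]) else [::]
  | _ => [::]
  end.

(** The thin cable with a free loop for every cap of [c0]: what is left below once the cups of [Jw]
    have risen through the marked thick cable. *)
Fixpoint cableL s w : seq (slice unit) :=
  if w is e :: w' then
    loopL s e ++ cable_slice kt s e ++ cableL (odflt [::] (step s e)) w'
  else [::].

Lemma loop_move p : [:: Cup tt p; Cap p] =~ [:: Cup tt 0; Cap 0].
Proof. by exists p => a s f am ps h; rewrite !ops_loop. Qed.

(** The cups of [Jw] rise through one slice. At a cup of [c0] the turnback opens the two extra arcs
    into one cup on each foot; at a cap the two cups close up with the extra arcs into a free loop;
    crossings are passed by naturality. *)
Lemma Jw_step s e s' : step s e = Some s' ->
  Jw 0 s ++ cable_slice kk s e ++ markT s e =~ loopL s e ++ cable_slice kt s e ++ Jw 0 s'.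
Proof.
case/stepP => [c d s1 s2 ->|c d s1 s2 ->|b x y s1 s2 ->].
- rewrite !cable_cup /markT take_size_cat // /loopL.
  have := @Jw_local s1 [::] [:: (c, d); (c, ~~ d)] s2
    (cupn (kk c) 0 ++ if c == c0 then ew (ix d) else [::]) (cupn (kt c) 0).
  rewrite !sh_cat !sh_cupn !addn0.
  have -> : sh (K kk s1) (if c == c0 then ew (ix d) else [::]) =
            if c == c0 then ew (K kk s1 + ix d) else [::] by case: eqP.
  apply.
  + rewrite wf_cat wf_cupn // outs_cupn; case: eqP => //= ->.
    by rewrite kk0 /outs1 /= /K /=; have := ix_le d; lia.
  + by rewrite outs_cat outs_cupn /K /=; case: eqP => [->|_]; rewrite /= ?kk0 /outs1 /=; lia.
  rewrite /= !add0n; case: eqP => [->|/eqP cc] /=; last by rewrite !cats0 (kkt cc).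
  rewrite kk0 kt0; have := @cup_capL (ix d) (n - ix d) 0; have := ix_le d => ixl.
  rewrite !subnKC // !add0n => H.
  rewrite /ew -[[:: Cap (ix d); _]]/([:: Cap (ix d)] ++ [:: Cup tt (ix d)]) catA H -catA.
  apply: eqv_cat => //; rewrite ix_neg.
  have := @far (ix d) 0 [:: Cup tt 0] [:: Cup tt (n + (n - ix d) - ix d)] isT.
  rewrite /= !addn0.
  have [-> ->] : (ix d + 2 + (n + (n - ix d) - ix d) = n.+2 + (n - ix d) /\
    ix d + (n + (n - ix d) - ix d) = n + (n - ix d))%N by lia.
  by move=> <-.
- rewrite !cable_cap /markT cats0 /loopL.
  have -> : onth (s1 ++ [:: (c, d), (c, ~~ d) & s2]) (size s1) = Some (c, d).
    by rewrite onth_cat ltnn subnn.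
  have := @Jw_local s1 [:: (c, d); (c, ~~ d)] [::] s2
    (capn (kk c) 0) ((if c == c0 then [:: Cup tt (ix d); Cap (ix d)] else [::]) ++ capn (kt c) 0).
  rewrite sh_cat !sh_capn !addn0 => H; rewrite H.
  + rewrite /= -catA; case: eqP => [->|_] /=; last by [].
    by rewrite -[X in X =~ _]/([:: Cup tt (K kt s1 + ix d)%N; Cap (K kt s1 + ix d)] ++ _) loop_move /=.
  + by rewrite wf_capn // /K /=; lia.
  + by rewrite outs_capn /K /=; lia.
  rewrite /= !cats0; case: eqP => [->|/eqP cc] /=; last by rewrite ?cats0 (kkt cc).
  rewrite kk0 kt0 !add0n; have := @cap_cupR (ix d) (n - ix d) 0; have := ix_le d => ixl.
  by rewrite !subnKC // !add0n ix_neg => ->.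
- rewrite !cable_cross /markT cats0 /loopL /=.
  have := @Jw_local s1 [:: x; y] [:: y; x] s2 (X b (kk x.1) (kk y.1) 0) (X b (kt x.1) (kt y.1) 0).
  rewrite !sh_X !addn0; apply.
  + by rewrite wf_X // /K /= addn0.
  + by rewrite outs_X /K /=; lia.
  have K1 (z : label C) (q : C -> nat) : K q [:: z] = q z.1 by rewrite /K /= addn0.
  have w1 (z : label C) : wf (kt z.1) (Jw 0 [:: z]) by rewrite -K1 wfJ.
  have o1 (z : label C) : outs (kt z.1) (Jw 0 [:: z]) = kk z.1 by rewrite -!K1 outsJ.
  have J2 z t : Jw 0 [:: z; t] = Jw 0 [:: z] ++ sh (kk z.1) (Jw 0 [:: t]).
    by rewrite -(cat1s z) Jw_cat K1 sh_Jw addn0.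
  rewrite !J2 -catA.
  have H1 := natr b (kk x.1) 0 (w1 y); rewrite o1 add0n sh0 in H1; rewrite H1.
  have H2 := natl b (kt y.1) 0 (w1 x); rewrite o1 add0n sh0 in H2; rewrite (tl2 H2) -catA.
  by have := eqv_far (Jw 0 [:: x]) (w1 y); rewrite o1 => ->.
Qed.

Lemma Jw_conv s w s' : run s w = Some s' -> Jw 0 s ++ cableT s w =~ cableL s w ++ Jw 0 s'.
Proof.
elim: w s => [|e w IH] s; first by case=> ->; rewrite cats0.
case/run_consP => t st rt /=; rewrite st /= 2!catA -[X in X ++ _]catA (Jw_step st) -!catA.
by rewrite IH // -!catA.
Qed.

Lemma cableT_wf s w s' : run s w = Some s' ->
  wf (K kk s) (cableT s w) /\ outs (K kk s) (cableT s w) = K kk s'.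
Proof.
elim: w s => [|e w IH] s; first by case=> ->.
case/run_consP => t st /IH[w2 o2]; have [w1 o1] := cable_step_wf kk st.
have [w3 o3] : wf (K kk t) (markT s e) /\ outs (K kk t) (markT s e) = K kk t.
  case/stepP: st => [c d s1 s2 ->|//|//]; rewrite /markT take_size_cat //.
  case: eqP => // ->; rewrite /= /outs1 /= !K_cat !K_cons /= kk0; have := ix_le d; lia.
by rewrite /= st /= !wf_cat !outs_cat w1 o1 w3 o3.
Qed.

Definition ncup w := count is0 w.

Fixpoint ncap s w : nat :=
  if w is e :: w' then (~~ nilp (loopL s e) + ncap (odflt [::] (step s e)) w')%N else 0%N.

Lemma cableL_ops s w s' f t : run s w = Some s' -> size t = K kt s -> path adj 0%N t ->
  ops 0 (cableL s w) f t = delta ^+ ncap s w * ops 0 (cable_from kt s w) f t.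
Proof.
elim: w s t => [|e w IH] s t; first by rewrite mul1r.
case/run_consP => u st ru tk pt; have [w1 o1] := cable_step_wf kt st.
rewrite /= st /= ops_cat.
have E : ops 0 (cable_slice kt s e ++ cableL u w) f t =
   delta ^+ ncap u w * ops 0 (cable_slice kt s e ++ cable_from kt u w) f t.
  rewrite !ops_cat -opsZ; apply: ops_ext_wf => //; first by rewrite tk.
  by move=> v pv sv _; rewrite (IH u) // sv tk o1.
have [->|->] : loopL s e = [::] \/ loopL s e = [:: Cup tt 0; Cap 0].
- rewrite /loopL; case: (e) => *; try by left.
  by case: onth => [x|]; [case: eqP; [right|left]|left].
- by rewrite /= E.
by rewrite -ops_cat ops_loop // E mulrA exprS.
Qed.

(** Cups and caps of [c0] handle two strands each, so a closed diagram has equally many. This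
    cancels the powers of [delta] in [coupon_thin], those of the loops against those of the
    projections. *)
Lemma ncap_ncup w s : run s w = Some [::] ->
  (count (fun x : label C => x.1 == c0) s + (ncup w).*2 = (ncap s w).*2)%N.
Proof.
elim: w s => [|e w IH] s; first by case=> ->.
case/run_consP => t st /IH; rewrite /ncup /= st /= => E.
case/stepP: st E => [c d s1 s2 ->|c d s1 s2 ->|b x y s1 s2 ->]; rewrite !count_cat /=.
- by case: eqP => _ /=; lia.
- rewrite onth_cat ltnn subnn /=; case: eqP => _ /=; lia.
- by lia.
Qed.

(* Colours: the strands of c0 carry the eigenvalue of the turnback [ew]. *)
Notation C2 := (C * bool)%type.
Definition proj (l : label C2) : label C := (l.1.1, l.2).
Let k2 : C2 -> nat := fun c => kk c.1.
Implicit Types (z : label C2) (a b t : seq (label C2)) (v : word (label C2)).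

Definition colp (Lm : (seq nat -> F) -> F) p (c : bool) :=
  forall g, Lm (ops 0 (ew p) g) = if c then delta * Lm g else 0.

(** [Lm] is the part of the diagram already read, as a functional on functions on the current line;
    under it every strand of [c0] has a definite colour. Other components get the colour [false], so
    that a lift is a colouring of [c0] alone. *)
Record Inv (Lm : (seq nat -> F) -> F) t : Prop := MkInv {
  inv_lin : forall c f g, Lm (fun u => c * f u + g u) = c * Lm f + Lm g;
  inv_ext : forall f g,
    (forall u, path adj 0%N u -> size u = K k2 t -> f u = g u) -> Lm f = Lm g;
  inv_col : forall a c d b, t = a ++ ((c0, c), d) :: b -> colp Lm (K k2 a + ix d) c;
  inv_other : all (fun z => (z.1.1 != c0) ==> ~~ z.1.2) t }.

(** The idempotent e, a turnback divided by the loop value, for [true], and 1 - e for [false]. *)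
Definition pr (c : bool) p (g : seq nat -> F) : seq nat -> F :=
  if c then fun u => delta^-1 * ops 0 (ew p) g u
  else fun u => - delta^-1 * ops 0 (ew p) g u + g u.

Lemma K_proj t : K kk (map proj t) = K k2 t.
Proof. by rewrite /K -map_comp. Qed.

Lemma inv_eqv Lm t x y g : Inv Lm t -> x =~ y -> wf (K k2 t) x -> wf (K k2 t) y ->
  Lm (ops 0 x g) = Lm (ops 0 y g).
Proof.
move=> I xy wx wy; apply: (inv_ext I) => u pu su.
by apply: eqv_wf; rewrite ?su.
Qed.

Lemma lin0 Lm t : Inv Lm t -> Lm (fun=> 0) = 0.
Proof.
move=> I; have := inv_lin I (-1) (fun=> 0) (fun=> 0).
have -> : (fun _ : seq nat => -1 * 0 + 0) = (fun _ : seq nat => 0 : F).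
  by apply: funext => u; rewrite mulr0 addr0.
by move=> ->; rewrite mulN1r addNr.
Qed.

Lemma linZ Lm t c f : Inv Lm t -> Lm (fun u => c * f u) = c * Lm f.
Proof.
move=> I; have := inv_lin I c f (fun=> 0); rewrite (lin0 I) addr0 => <-.
by congr Lm; apply: funext => u; rewrite addr0.
Qed.

Lemma ops_ew2 p u g : path adj 0%N u -> (p.+2 <= size u)%N ->
  ops 0 (ew p) (ops 0 (ew p) g) u = delta * ops 0 (ew p) g u.
Proof.
move=> pu su; transitivity (ops 0 [:: Cap p] (fun r => delta * ops 0 [:: Cup tt p] g r) u).
  rewrite -[LHS]/(ops 0 [:: Cap p] (ops 0 (Cup tt p :: Cap p :: [:: Cup tt p]) g) u).
  apply: ops_ext_wf => //= [|t pt]; first by rewrite andbT addn2.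
  by rewrite /outs1 /= => st _; apply: (@ops_loop p [:: Cup tt p]) => //; rewrite st; lia.
by rewrite opsZ.
Qed.

Lemma split_cons a b t1 t2 z : t1 ++ t2 = a ++ z :: b ->
  (exists2 b', t1 = a ++ z :: b' & b = b' ++ t2) \/
  (exists2 a', a = t1 ++ a' & t2 = a' ++ z :: b).
Proof.
elim: t1 a => [|y t1 IH] [|w' a] //=.
- by move=> E; right; exists [::].
- by move=> E; right; exists (w' :: a).
- by case=> -> <-; left; exists t1.
case=> -> /IH[[b' -> ->]|[a' -> ->]]; [left|right]; first by exists b'.
by exists a'.
Qed.

Lemma wf_ew p N : wf N (ew p) = (p + 2 <= N)%N.
Proof. by rewrite /ew /= /outs1 /=; apply/idP/idP; lia. Qed.

Lemma outs_ew p N : (p + 2 <= N)%N -> outs N (ew p) = N.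
Proof. by rewrite /= /outs1 /=; lia. Qed.

Lemma sh_ew q p : sh q (ew p) = ew (q + p).
Proof. by []. Qed.

Lemma K_strand a c d b : (K k2 a + ix d + 2 <= K k2 (a ++ ((c0, c), d) :: b))%N.
Proof. by rewrite K_cat K_cons /k2 /= kk0; have := ix_le d; lia. Qed.

Section LocalStep.
Variables (Lm : (seq nat -> F) -> F) (s1 i1 o1 s2 : seq (label C2)) (x0 : seq (slice unit)).
Hypotheses (I : Inv Lm (s1 ++ i1 ++ s2)) (wx : wf (K k2 i1) x0)
  (ox : outs (K k2 i1) x0 = K k2 o1).
Let x := sh (K k2 s1) x0.
Let Lm' g := Lm (ops 0 x g).

Lemma wf_loc : wf (K k2 (s1 ++ i1 ++ s2)) x.
Proof.
have w1 := wf_sh (K k2 s1) wx; have [w2 _] := wf_weak (K k2 s2) w1.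
by rewrite !K_cat addnA.
Qed.

Lemma outs_loc : outs (K k2 (s1 ++ i1 ++ s2)) x = K k2 (s1 ++ o1 ++ s2).
Proof.
have w1 := wf_sh (K k2 s1) wx; have [_ o2] := wf_weak (K k2 s2) w1.
by rewrite !K_cat !addnA o2 outs_sh // ox.
Qed.

Lemma loc_lin c f g : Lm' (fun u => c * f u + g u) = c * Lm' f + Lm' g.
Proof.
rewrite -(inv_lin I) /Lm'; congr Lm; apply: funext => u; exact: ops_lin.
Qed.

Lemma loc_ext f g : (forall u, path adj 0%N u -> size u = K k2 (s1 ++ o1 ++ s2) ->
  f u = g u) -> Lm' f = Lm' g.
Proof.
move=> H; apply: (inv_ext I) => u pu su; apply: ops_ext_wf => //.
  by rewrite su wf_loc.
by move=> t pt; rewrite su outs_loc => st _; apply: H.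
Qed.

Lemma loc_slide p p' g : x ++ ew p' =~ ew p ++ x ->
  (p + 2 <= K k2 (s1 ++ i1 ++ s2))%N -> (p' + 2 <= K k2 (s1 ++ o1 ++ s2))%N ->
  Lm' (ops 0 (ew p') g) = Lm (ops 0 (ew p) (ops 0 x g)).
Proof.
move=> H h h'; rewrite /Lm' -[LHS](_ : Lm (ops 0 (x ++ ew p') g) = _); last by rewrite ops_cat.
rewrite (inv_eqv g I H) ?ops_cat // wf_cat ?wf_loc ?outs_loc ?wf_ew //.
by rewrite h outs_ew // wf_loc.
Qed.

Lemma loc_spect a c d b : s1 ++ o1 ++ s2 = a ++ ((c0, c), d) :: b ->
  (exists a' b', [/\ o1 = a' ++ ((c0, c), d) :: b', a = s1 ++ a' & b = b' ++ s2]) \/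
  (K k2 a + ix d + 2 <= K k2 s1 \/ K k2 s1 + K k2 o1 <= K k2 a + ix d)%N /\
  colp Lm' (K k2 a + ix d) c.
Proof.
move=> E; have h' := K_strand a c d b.
case: (split_cons E) => [[b' Es1 Eb]|[a' Ea]].
  have h := K_strand a c d b'; rewrite -Es1 in h.
  right; split=> [|g]; first by left.
  rewrite (@loc_slide (K k2 a + ix d)) ?E //.
  - by have := inv_col I; rewrite Es1 -catA /= => /(_ _ _ _ _ erefl) ->.
  - have := @eqv_far (K k2 s1) (ew (K k2 a + ix d)) x0.
    by rewrite wf_ew outs_ew // => /(_ h) ->.
  - by rewrite K_cat; lia.
move=> E2; case: (split_cons E2) => [[b' Eo Eb]|[a2 Ea' Es2]].
  by left; exists a', b'.
right; split=> [|g]; first by right; rewrite Ea Ea' !K_cat; lia.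
pose q := (K k2 a2 + ix d)%N.
have hq : (q + 2 <= K k2 s2)%N by rewrite /q Es2 K_strand.
rewrite (@loc_slide (K k2 s1 + K k2 i1 + q)) ?E //.
- have := inv_col I; rewrite Es2 !catA => /(_ _ _ _ _ erefl).
  by rewrite !K_cat -addnA => ->.
- have := far (K k2 s1) (ew q) wx; rewrite ox !sh_ew Ea Ea' /q !K_cat !addnA => ->.
  by [].
- by rewrite !K_cat; lia.
Qed.

Lemma loc_Inv : (forall a c d b, o1 = a ++ ((c0, c), d) :: b ->
     colp Lm' (K k2 s1 + K k2 a + ix d) c) ->
  all (fun z => (z.1.1 != c0) ==> ~~ z.1.2) o1 -> Inv Lm' (s1 ++ o1 ++ s2).
Proof.
move=> H o1c; split; [exact: loc_lin|exact: loc_ext| |].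
  move=> a c d b E; case: (loc_spect E) => [[a' [b' [Eo -> _]]]|[]//].
  by rewrite K_cat; apply: H Eo.
by have := inv_other I; rewrite !all_cat o1c => /and3P[-> _ ->].
Qed.
End LocalStep.

Lemma inv_cross Lm (b : bool) (s1 : seq (label C2)) (x y : label C2) (s2 : seq (label C2)) : Inv Lm (s1 ++ [:: x; y] ++ s2) ->
  Inv (fun g => Lm (ops 0 (X b (k2 x.1) (k2 y.1) (K k2 s1)) g)) (s1 ++ [:: y; x] ++ s2).
Proof.
move=> I; have K2 (z z' : label C2) : K k2 [:: z; z'] = (k2 z.1 + k2 z'.1)%N.
  by rewrite /K /= addn0.
have wx : wf (K k2 [:: x; y]) (X b (k2 x.1) (k2 y.1) 0) by rewrite K2 wf_X.
have ox : outs (K k2 [:: x; y]) (X b (k2 x.1) (k2 y.1) 0) = K k2 [:: y; x].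
  by rewrite outs_X !K2 addnC.
have we d N : N = n.+2 -> wf N (ew (ix d)) by move=> ->; rewrite wf_ew; have := ix_le d; lia.
have oe d N : N = n.+2 -> outs N (ew (ix d)) = N.
  by move=> ->; rewrite outs_ew //; have := ix_le d; lia.
have := loc_Inv I wx ox; rewrite sh_X addn0; apply.
- move=> [|z a] c d r [E1 E2] g.
    have Ey : k2 y.1 = n.+2 by rewrite E1 /k2 kk0.
    rewrite [K k2 [::]]/= addn0.
    have := @loc_slide _ _ _ _ s2 _ I wx ox (K k2 s1 + k2 x.1 + ix d) (K k2 s1 + ix d) g.
    rewrite sh_X addn0 => ->.
    + have := @inv_col _ _ I (s1 ++ [:: x]) c d s2; rewrite -catA E1 => /(_ erefl).
      by rewrite K_cat K_cons [K k2 [::]]/= addn0 => ->.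
    + by have := natr b (k2 x.1) (K k2 s1) (we d _ Ey); rewrite oe // !sh_ew => <-.
    + by rewrite !K_cat K2 Ey; have := ix_le d; lia.
    + by rewrite !K_cat K2 Ey; have := ix_le d; lia.
  case: a E2 => [|? [|? ?]] // [E2 _]; subst z.
  have Ex : k2 x.1 = n.+2 by rewrite E2 /k2 kk0.
  rewrite [K k2 [:: y]]K_cons addn0.
  have := @loc_slide _ _ _ _ s2 _ I wx ox (K k2 s1 + ix d) (K k2 s1 + k2 y.1 + ix d) g.
  rewrite sh_X addn0 => ->.
  + by have := inv_col I; rewrite E2 => /(_ _ _ _ _ erefl) ->.
  + by have := natl b (k2 y.1) (K k2 s1) (we d _ Ex); rewrite oe // !sh_ew => <-.
  + by rewrite !K_cat K2 Ex; have := ix_le d; lia.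
  + by rewrite !K_cat K2 Ex; have := ix_le d; lia.
have := inv_other I; rewrite !all_cat /= => /and3P[_ /and3P[-> -> _] _]; by [].
Qed.

Lemma inv_cap Lm (s1 : seq (label C2)) (x y : label C2) (s2 : seq (label C2)) : Inv Lm (s1 ++ [:: x; y] ++ s2) -> x.1 = y.1 ->
  Inv (fun g => Lm (ops 0 (capn (k2 x.1) (K k2 s1)) g)) (s1 ++ s2).
Proof.
move=> I xy; have K2 : K k2 [:: x; y] = (k2 x.1).*2 by rewrite /K /= -xy addn0 addnn.
have wx : wf (K k2 [:: x; y]) (capn (k2 x.1) 0) by rewrite K2 wf_capn.
have ox : outs (K k2 [:: x; y]) (capn (k2 x.1) 0) = K k2 [::] by rewrite outs_capn K2 subnn.
by have := @loc_Inv _ _ _ [::] _ _ I wx ox; rewrite sh_capn addn0; apply => // -[].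
Qed.

(** By [cap_ew] the turnback moves from one foot of the caps to the other, so the value is
    multiplied by [delta] and by 0 at once. *)
Lemma cap_mismatch Lm (s1 s2 : seq (label C2)) c c' d h :
  Inv Lm (s1 ++ [:: ((c0, c), d); ((c0, c'), ~~ d)] ++ s2) -> c != c' ->
  Lm (ops 0 (capn n.+2 (K k2 s1)) h) = 0.
Proof.
move=> I cc; set g := ops 0 _ h.
have H1 := inv_col I (erefl _) g; rewrite /= in H1.
have := @inv_col _ _ I (s1 ++ [:: ((c0, c), d)]) c' (~~ d) s2; rewrite -catA => /(_ erefl g).
rewrite K_cat K_cons /K /= addn0 /k2 /= kk0 ix_neg -/(K k2 s1) => H2.
have := @cap_ew (ix d) (n - ix d) (K k2 s1); have := ix_le d => ixl.
rewrite subnKC // => E.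
have := inv_eqv h I E; rewrite !ops_cat -/g H1 H2.
have K2 : (K k2 s1 + (n.+2).*2 <= K k2 (s1 ++ [:: ((c0, c), d); ((c0, c'), ~~ d)] ++ s2))%N.
  by rewrite !K_cat !K_cons /k2 /= kk0; lia.
rewrite !wf_cat !wf_ew !outs_ew ?wf_capn; [|lia..].
have -> : (K k2 s1 + ix d + 2 <= K k2 (s1 ++ [:: ((c0, c), d); ((c0, c'), ~~ d)] ++ s2))%N by lia.
have -> : (K k2 s1 + n.+2 + (n - ix d) + 2 <= K k2 (s1 ++ [:: ((c0, c), d); ((c0, c'), ~~ d)] ++ s2))%N by lia.
move=> /(_ isT isT); move: cc; case: (c); case: (c') => // _ /eqP.
  by rewrite mulf_eq0 (negPf delta_neq0) => /eqP.
by rewrite eq_sym mulf_eq0 (negPf delta_neq0) => /eqP.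
Qed.

Lemma inv_cup Lm (s1 s2 : seq (label C2)) c d d' : c != c0 -> Inv Lm (s1 ++ s2) ->
  Inv (fun g => Lm (ops 0 (cupn (kk c) (K k2 s1)) g))
    (s1 ++ [:: ((c, false), d); ((c, false), d')] ++ s2).
Proof.
move=> cc I.
have wx : wf (K k2 [::]) (cupn (kk c) 0) by rewrite wf_cupn.
have ox : outs (K k2 [::]) (cupn (kk c) 0) = K k2 [:: ((c, false), d); ((c, false), d')].
  by rewrite outs_cupn /K /= /k2 /=; lia.
have := @loc_Inv _ s1 [::] [:: ((c, false), d); ((c, false), d')] s2 _ I wx ox.
rewrite sh_cupn addn0; apply; last by rewrite /= !implybT.
by move=> [|z [|z' [|? ?]]] c' d2 r //= [] *; subst; rewrite eqxx in cc.
Qed.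

Lemma ew_comm p p' u g : (p + 2 <= p' \/ p' + 2 <= p)%N -> path adj 0%N u ->
  (p + 2 <= size u)%N -> (p' + 2 <= size u)%N ->
  ops 0 (ew p) (ops 0 (ew p') g) u = ops 0 (ew p') (ops 0 (ew p) g) u.
Proof.
wlog pp : p p' / (p + 2 <= p')%N.
  by move=> W [h|h] *; [apply: W => //; left|symmetry; apply: W => //; left].
move=> _ pu h h'; rewrite -!ops_cat; apply: eqv_wf => //.
- have := @eqv_far (p + 2) (ew p) (ew (p' - (p + 2))); rewrite wf_ew outs_ew // leqnn => /(_ isT).
  by rewrite !sh_ew subnKC.
- by rewrite wf_cat !wf_ew outs_ew // h h'.
- by rewrite wf_cat !wf_ew outs_ew // h h'.
Qed.

Lemma pr_lin c p (a : F) f g :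
  pr c p (fun u => a * f u + g u) = fun u => a * pr c p f u + pr c p g u.
Proof.
by case: c; apply: funext => u; rewrite /pr ops_lin; ring.
Qed.

Lemma pr_ext c p f g u : path adj 0%N u -> (p + 2 <= size u)%N ->
  (forall r, path adj 0%N r -> size r = size u -> f r = g r) -> pr c p f u = pr c p g u.
Proof.
move=> pu h H.
have E : ops 0 (ew p) f u = ops 0 (ew p) g u.
  by apply: ops_ext_wf; rewrite ?wf_ew // => r pr_; rewrite outs_ew // => sr _; apply: H.
by case: c; rewrite /pr E // (H u).
Qed.

Lemma pr_comm c p p' u g : (p + 2 <= p' \/ p' + 2 <= p)%N -> path adj 0%N u ->
  (p + 2 <= size u)%N -> (p' + 2 <= size u)%N ->
  pr c p (ops 0 (ew p') g) u = ops 0 (ew p') (pr c p g) u.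
Proof.
move=> pp pu h h'; case: c; rewrite /pr ?opsZ ?ops_lin (@ew_comm p p') //.
Qed.

Lemma pr_ew c p u g : path adj 0%N u -> (p + 2 <= size u)%N ->
  pr c p (ops 0 (ew p) g) u = if c then delta * pr c p g u else 0.
Proof.
move=> pu h; rewrite /pr; case: c; rewrite ops_ew2 //; try lia.
  by rewrite mulrCA.
by rewrite mulrA mulNr mulVf ?delta_neq0 // mulN1r addNr.
Qed.

Lemma ew_pr c p u g : path adj 0%N u -> (p + 2 <= size u)%N ->
  ops 0 (ew p) (pr c p g) u = if c then delta * pr c p g u else 0.
Proof.
move=> pu h; rewrite -(pr_ew c g pu h) /pr; case: c; first by rewrite opsZ.
by rewrite ops_lin.
Qed.

(** The projection is inserted on one foot only: by [cup_ew] the other foot has the same colour, and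
    the turnbacks of other strands are distant from it and commute with it. *)
Lemma inv_cup0 Lm (s1 s2 : seq (label C2)) c d : Inv Lm (s1 ++ s2) ->
  Inv (fun g => Lm (ops 0 (cupn n.+2 (K k2 s1)) (pr c (K k2 s1 + ix d) g)))
    (s1 ++ [:: ((c0, c), d); ((c0, c), ~~ d)] ++ s2).
Proof.
move=> I; set o1 := [:: _; _]; set p := (K k2 s1 + ix d)%N.
have wx : wf (K k2 [::]) (cupn n.+2 0) by rewrite wf_cupn.
have Ko : K k2 o1 = (n.+2).*2 by rewrite /K /= /k2 /= kk0; lia.
have ox : outs (K k2 [::]) (cupn n.+2 0) = K k2 o1 by rewrite outs_cupn Ko.
have ixl := ix_le d.
have pK : (p + 2 <= K k2 (s1 ++ o1 ++ s2))%N by rewrite !K_cat Ko /p; lia.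
have LI := @loc_lin _ s1 [::] s2 (cupn n.+2 0) I.
have LE := @loc_ext _ s1 [::] o1 s2 _ I wx ox.
have LS := @loc_spect _ s1 [::] o1 s2 _ I wx ox.
have wl := @wf_loc s1 [::] s2 _ wx.
have ol := @outs_loc s1 [::] o1 s2 _ wx ox.
rewrite sh_cupn addn0 in LI LE LS wl ol.
split.
- by move=> a f g; rewrite pr_lin LI.
- move=> f g H; apply: LE => u pu su; apply: pr_ext => //; first by rewrite su.
  by move=> r pr_ sr; apply: H; rewrite // sr.
- have colO pos c' : (p + 2 <= pos \/ pos + 2 <= p)%N -> (pos + 2 <= K k2 (s1 ++ o1 ++ s2))%N ->
     colp (fun g => Lm (ops 0 (cupn n.+2 (K k2 s1)) g)) pos c' ->
     colp (fun g => Lm (ops 0 (cupn n.+2 (K k2 s1)) (pr c p g))) pos c'.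
    move=> pp ph H g; rewrite -H; apply: LE => u pu su; apply: pr_comm; rewrite ?su //.
  move=> a c' d' b E; have hs := K_strand a c' d' b; rewrite -E in hs.
  case: (LS _ _ _ _ E) => [[a' [b' [Eo Ea _]]]|[pos H]]; last first.
    by apply: colO => //; move: pos; rewrite Ko /p; lia.
  have col c2 (Lc : c2 = c) : colp (fun g => Lm (ops 0 (cupn n.+2 (K k2 s1)) (pr c p g))) p c2.
    move=> g; rewrite Lc.
    transitivity (Lm (ops 0 (cupn n.+2 (K k2 s1)) (fun u => if c then delta * pr c p g u else 0))).
      by apply: LE => u pu su; apply: pr_ew; rewrite ?su.
    case: (c); last first.
      rewrite -(mulr0 0) -[in RHS](mulr0 (Lm (ops 0 (cupn n.+2 (K k2 s1)) (fun=> 0)))).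
      have := LI (-1) (fun=> 0) (fun=> 0).
      have -> : (fun _ : seq nat => -1 * 0 + 0) = (fun _ : seq nat => 0 : F).
        by apply: funext => u; rewrite mulr0 addr0.
      by rewrite mulN1r addNr !mulr0.
    have := LI delta (pr true p g) (fun=> 0).
    have -> : (fun u => delta * pr true p g u + 0) = (fun u => delta * pr true p g u).
      by apply: funext => u; rewrite addr0.
    move=> ->; have := LI (-1) (fun=> 0) (fun=> 0).
    have -> : (fun _ : seq nat => -1 * 0 + 0) = (fun _ : seq nat => 0 : F).
      by apply: funext => u; rewrite mulr0 addr0.
    by rewrite mulN1r addNr => ->; rewrite addr0.
  case: a' Eo Ea => [|z [|z' [|? ?]]] // [].
    by move=> <- <- _ ->; rewrite cats0; apply: col.
  move=> <- <- <- _ Ea; rewrite Ea K_cat K_cons addn0 /k2 /= kk0.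
  set p' := (_ + ix (~~ d))%N => g; rewrite -(col c erefl).
  have p'E : p' = (K k2 s1 + n.+2 + (n - ix d))%N by rewrite /p' ix_neg.
  have p'K : (p' + 2 <= K k2 (s1 ++ o1 ++ s2))%N by rewrite !K_cat Ko p'E; lia.
  transitivity (Lm (ops 0 (cupn n.+2 (K k2 s1) ++ ew p') (pr c p g))).
    rewrite ops_cat; apply: LE => u pu su; apply: pr_comm; rewrite ?su //; rewrite p'E /p; lia.
  transitivity (Lm (ops 0 (cupn n.+2 (K k2 s1) ++ ew p) (pr c p g))).
    apply: (inv_eqv _ I); rewrite ?wf_cat ?wl ?ol ?wf_ew ?pK ?p'K //.
    by have := @cup_ew (ix d) (n - ix d) (K k2 s1); rewrite subnKC // p'E /p => ->.
  rewrite ops_cat; apply: LE => u pu su; rewrite ew_pr ?su // -pr_ew ?su //.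
- have := inv_other I; rewrite !all_cat => /andP[-> ->]; by rewrite /= eqxx.
Qed.

Lemma map_cat_inv (T U : Type) (f : T -> U) (r : seq T) (s1 s2 : seq U) : map f r = s1 ++ s2 ->
  exists r1 r2, [/\ r = r1 ++ r2, map f r1 = s1 & map f r2 = s2].
Proof.
move=> E; exists (take (size s1) r), (drop (size s1) r).
by rewrite cat_take_drop map_take map_drop E take_size_cat // drop_size_cat.
Qed.

Definition allt v := all (fun e : slice (label C2) => if e is Cup z _ then (z.1.1 == c0) ==> z.1.2 else true) v.

Notation lift := (map (map_slice proj)).

(* Each cup of c0 is multiplied by 1 = e + (1 - e).  The colour of a strand then
   says on which summand e acts, crossings and caps carry it along, and a cap
   joining two colours gives zero. *)
Lemma lift_main w s s' t Lm g g' (P : bool) :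
  run s w = Some s' -> map proj t = s -> Inv Lm t ->
  (forall wt t' Lm', lift wt = w -> run t wt = Some t' -> Inv Lm' t' ->
     Lm' g = if P && allt wt then Lm' g' else 0) ->
  Lm (ops 0 (cable_from kk s w) g) =
  if P then delta^-1 ^+ ncup w * Lm (ops 0 (cableT s w) g') else 0.
Proof.
elim: w s t Lm P => [|e w IH] s t Lm P.
  move=> _ _ I /(_ [::] t Lm erefl erefl I) /= ->.
  by rewrite andbT expr0 mul1r.
case/run_consP => u st ru ts I H.
have E : cable_from kk s (e :: w) = cable_slice kk s e ++ cable_from kk u w by rewrite cable_cons st.
have ET : cableT s (e :: w) = cable_slice kk s e ++ markT s e ++ cableT u w by rewrite /= st.
rewrite E ET {E ET} /ncup /= -/(ncup w); case/stepP: st ts H ru => [c d s1 s2 ->|c d s1 s2 ->|b x y s1 s2 ->].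
- move=> /map_cat_inv[t1 [t2 [Et E1 E2]]] H ru; subst t.
  have sz : size s1 = size t1 by rewrite -E1 size_map.
  have Kp : K kk s1 = K k2 t1 by rewrite -E1 K_proj.
  rewrite /markT take_size_cat // !cable_cup Kp /=.
  have Ets c1 d1 : map proj (t1 ++ [:: ((c, c1), d1); ((c, c1), ~~ d1)] ++ t2) =
     s1 ++ (c, d1) :: (c, ~~ d1) :: s2 by rewrite map_cat /= E1 E2.
  have rt (cb : bool) wt : run (t1 ++ t2) (Cup ((c, cb), d) (size s1) :: wt) =
      run (t1 ++ [:: ((c, cb), d); ((c, cb), ~~ d)] ++ t2) wt.
    by rewrite run_cons sz step_cup.
  case: eqP => [cc|cc]; last first.
    rewrite add0n !ops_cat; apply: (IH _ _ _ P ru (Ets false d) (inv_cup _ _ (negbT (introF eqP cc)) I)).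
    move=> wt t' Lm' lw rw I'.
    rewrite (H (Cup ((c, false), d) (size s1) :: wt) t' Lm') ?rt //=; last by rewrite lw.
    by case: eqP cc.
  subst c; rewrite kk0 !ops_cat.
  set p := (K k2 t1 + ix d)%N; set g0 := ops 0 (cable_from _ _ _) g.
  have D : g0 = fun u => 1 * pr true p g0 u + pr false p g0 u.
    by apply: funext => r; rewrite /pr; ring.
  have IL := @loc_lin _ t1 [::] t2 (cupn n.+2 0) I.
  rewrite sh_cupn addn0 in IL; rewrite [in LHS]D IL mul1r {IL D}.
  have T : Lm (ops 0 (cupn n.+2 (K k2 t1)) (pr true p g0)) =
    if P then delta^-1 ^+ ncup w * Lm (ops 0 (cupn n.+2 (K k2 t1)) (pr true p (ops 0 (cableT (s1 ++ (c0, d) :: (c0, ~~ d) :: s2) w) g'))) else 0.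
    apply: (IH _ _ _ P ru (Ets true d) (inv_cup0 _ d I)) => wt t' Lm' lw rw I'.
    rewrite (H (Cup ((c0, true), d) (size s1) :: wt) t' Lm') ?rt //=; last by rewrite lw.
    by rewrite implybT.
  (* A cup coloured [false] makes every completion vanish, whatever follows; the flag [P] records
     this in the induction. *)
  have T0 : Lm (ops 0 (cupn n.+2 (K k2 t1)) (pr false p g0)) = 0.
    apply: (IH _ _ _ false ru (Ets false d) (inv_cup0 _ d I)) => wt t' Lm' lw rw I'.
    rewrite (H (Cup ((c0, false), d) (size s1) :: wt) t' Lm') ?rt //=; last by rewrite lw.
    by rewrite eqxx andbF.
  rewrite T T0 addr0; case: (P) => //.
  rewrite exprD expr1 -mulrA [RHS]mulrCA; congr (_ * _).
  rewrite -(linZ _ _ I); congr Lm; apply: funext => r; rewrite -opsZ.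
  by congr (ops _ _ _ _); apply: funext => r'; rewrite /pr.
- move=> /map_cat_inv[t1 [r [Et E1 E3]]] H ru.
  case: r Et E3 => [|x [|y t2]] // Et [Ex1 Ex2 Ey1 Ey2 E2]; subst t.
  have sz : size s1 = size t1 by rewrite -E1 size_map.
  have Kp : K kk s1 = K k2 t1 by rewrite -E1 K_proj.
  rewrite !cable_cap /= Kp !ops_cat.
  have xE : x = ((c, x.1.2), d) by rewrite -Ex1 -Ex2; case: (x) => [[]].
  have yE : y = ((c, y.1.2), ~~ d) by rewrite -Ey1 -Ey2; case: (y) => [[]].
  have [xy|xy] := eqVneq x.1.2 y.1.2; last first.
    have cc : c = c0.
      apply/eqP/negPn/negP => cc; have := inv_other I.
      rewrite !all_cat /= xE yE /= cc /= => /andP[_ /and3P[/negPf Ex0 /negPf Ey0 _]].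
      by rewrite Ex0 Ey0 in xy.
    rewrite cc kk0; have M f : Lm (ops 0 (capn n.+2 (K k2 t1)) f) = 0.
      by apply: (@cap_mismatch Lm t1 t2 _ _ d f _ xy); rewrite /= -cc -xE -yE.
    by rewrite !M mulr0; case: (P).
  have xy1 : x.1 = y.1 by rewrite xE yE /= xy.
  have kx : kk c = k2 x.1 by rewrite xE.
  rewrite kx; apply: (IH _ _ _ P ru _ (@inv_cap _ t1 x y t2 I xy1)); first by rewrite map_cat E1 E2.
  move=> wt t' Lm' lw rw I'.
  rewrite (H (Cap (size s1) :: wt) t' Lm') //=; first by rewrite lw.
  by rewrite run_cons sz step_cap xy1 eqxx xE yE; case: (d).
- move=> /map_cat_inv[t1 [r [Et E1 E3]]] H ru.
  case: r Et E3 => [|x' [|y' t2]] // Et [Ex Ey E2]; subst t.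
  have sz : size s1 = size t1 by rewrite -E1 size_map.
  have Kp : K kk s1 = K k2 t1 by rewrite -E1 K_proj.
  rewrite !cable_cross Kp !ops_cat.
  have -> : kk x.1 = k2 x'.1 by rewrite -Ex.
  have -> : kk y.1 = k2 y'.1 by rewrite -Ey.
  apply: (IH _ _ _ P ru _ (@inv_cross _ b t1 x' y' t2 I)); first by rewrite map_cat /= E1 E2 Ex Ey.
  move=> wt t' Lm' lw rw I'.
  rewrite (H (Cross b (size s1) :: wt) t' Lm') //=; first by rewrite lw.
  by rewrite run_cons sz step_cross.
Qed.

Lemma step_proj t (e : slice (label C2)) t' : step t e = Some t' ->
  step (map proj t) (map_slice proj e) = Some (map proj t').
Proof.
case/stepP => [c d t1 t2 ->|c d t1 t2 ->|b x y t1 t2 ->]; rewrite !map_cat.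
- by have := step_cup (map proj t1) (map proj t2) c.1 d; rewrite size_map.
- have H : ((c.1, d).1 == (c.1, ~~ d).1) && ((c.1, d).2 != (c.1, ~~ d).2).
    by rewrite eqxx; case: (d).
  by have := step_cap (map proj t1) (map proj t2) (c.1, d) (c.1, ~~ d); rewrite size_map H.
- by have := step_cross b (map proj t1) (map proj t2) (proj x) (proj y); rewrite size_map.
Qed.

Lemma run_proj wt t t' : run t wt = Some t' -> run (map proj t) (lift wt) = Some (map proj t').
Proof.
elim: wt t => [|e wt IH] t; first by case=> ->.
by case/run_consP => r /step_proj st /IH; rewrite /= run_cons st.
Qed.

Let tru (z : label C2) := (z.1.1 == c0) && z.1.2.
Definition hast v := has (fun e : slice (label C2) => if e is Cup z _ then tru z else false) v.

Lemma run_parity wt t t' : run t wt = Some t' -> odd (count tru t) = odd (count tru t').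
Proof.
elim: wt t => [|e wt IH] t; first by case=> ->.
case/run_consP => r st /IH <-.
case/stepP: st => [c d t1 t2 ->|c d t1 t2 ->|b x y t1 t2 ->]; rewrite !count_cat /= /tru /= !oddD !oddb.
- by rewrite addKb.
- by rewrite addKb.
- by congr (_ (+) _); rewrite addbCA.
Qed.

Lemma run_hast wt t t' : run t wt = Some t' -> has tru t' -> has tru t || hast wt.
Proof.
elim: wt t => [|e wt IH] t; first by case=> -> ->.
case/run_consP => r st /IH{}IH /IH; rewrite /hast /= -/(hast wt).
case/stepP: st => [c d t1 t2 ->|c d t1 t2 ->|b x y t1 t2 ->]; rewrite !has_cat /= /tru /=.
- by case: (_ && _); rewrite ?orbT.
- by case/orP=> [/orP[->|->]|->]; rewrite ?orbT.
- by case/orP => [/orP[->|/or3P[->|->|->]]|->]; rewrite ?orbT.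
Qed.

Let q := n.+2.

Section Coupon.
Variable D : (seq nat -> F) -> seq nat -> F.
Hypothesis cD : coupon q D.

Lemma pr_far c x f r : path adj 0%N r -> (q <= size r)%N -> wf (size r - q) x ->
  pr c i (ops 0 (sh q x) f) r = ops 0 (sh q x) (pr c i f) r.
Proof.
move=> pr_ h w; have wi : wf q (ew i) by rewrite wf_ew /q; lia.
have oi : outs q (ew i) = q by rewrite outs_ew // /q; lia.
have iq : (i + 2 <= q)%N by rewrite /q; lia.
have E : ops 0 (ew i) (ops 0 (sh q x) f) r = ops 0 (sh q x) (ops 0 (ew i) f) r.
  rewrite -!ops_cat; apply: eqv_wf => //.
  - by have := eqv_far x wi; rewrite oi.
  - have w1 := wf_sh q w; rewrite subnKC // in w1.
    by rewrite wf_cat wf_ew outs_ew ?w1 ?andbT; lia.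
  - have w1 := wf_sh q w; have o1 := outs_sh q w; rewrite subnKC // in w1 o1.
    by rewrite wf_cat w1 o1 wf_ew; move: iq; lia.
by case: c; rewrite /pr ?ops_lin ?opsZ E.
Qed.

Lemma mid_comm c c' x f r : path adj 0%N r -> (q <= size r)%N -> wf (size r - q) x ->
  pr c i (D (pr c' i (ops 0 (sh q x) f))) r =
  ops 0 (sh q x) (pr c i (D (pr c' i f))) r.
Proof.
move=> pr_ h w; rewrite -pr_far //; apply: pr_ext => //; first by move: h; rewrite /q; lia.
move=> r1 p1 s1; rewrite -(coupon_comm cD) ?s1 //; apply: (coupon_ext cD) => //; first by rewrite s1.
move=> r2 p2 s2.
by apply: pr_far; rewrite // s2 s1.
Qed.

Lemma inv_pr Lm c d t c' f : Inv Lm (((c0, c), d) :: t) ->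
  Lm (pr c' (ix d) f) = if c' == c then Lm f else 0.
Proof.
move=> I; have := @inv_col _ _ I [::] c d t erefl; rewrite /K add0n => H.
case: c'; rewrite /pr; first rewrite (linZ _ _ I) H.
  by case: (c); rewrite ?mulr0 // mulKf ?delta_neq0.
rewrite (inv_lin I) H; case: (c); last by rewrite mulr0 add0r.
by rewrite mulrA mulNr mulVf ?delta_neq0 // mulN1r addNr.
Qed.

Lemma ix0 : ix d0 = i. Proof. by rewrite /ix eqxx. Qed.

Lemma inv_mid Lm c t c1 c2 : Inv Lm (((c0, c), d0) :: t) ->
  Inv (fun f => Lm (pr c1 i (D (pr c2 i f)))) (((c0, c2), d0) :: t).
Proof.
move=> I; have Kq (z : bool) : K k2 (((c0, z), d0) :: t) = (q + K k2 t)%N by rewrite K_cons /k2 /= kk0.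
have iq : (i + 2 <= q)%N by rewrite /q; lia.
have mext f g : (forall r, path adj 0%N r -> size r = (q + K k2 t)%N -> f r = g r) ->
    Lm (pr c1 i (D (pr c2 i f))) = Lm (pr c1 i (D (pr c2 i g))).
  move=> H; apply: (inv_ext I) => r pr_; rewrite Kq => sr.
  apply: pr_ext => //; first by rewrite sr; lia.
  move=> r1 p1 s1; apply: (coupon_ext cD) => //; first by rewrite s1 sr; lia.
  move=> r2 p2 s2; apply: pr_ext => //; first by rewrite s2 s1 sr; lia.
  by move=> r3 p3 s3; apply: H => //; rewrite s3 s2 s1.
split.
- by move=> c' f g; rewrite pr_lin (coupon_lin cD) pr_lin (inv_lin I).
- by move=> f g; rewrite Kq; apply: mext.
- case=> [|z a] c' d b; [case=> E1 E2 _ g|case=> E1 E2 g].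
    subst c' d; rewrite [K _ _]/= add0n ix0.
    have -> : Lm (pr c1 i (D (pr c2 i (ops 0 (ew i) g)))) =
        Lm (fun r => (if c2 then delta else 0) * pr c1 i (D (pr c2 i g)) r).
      apply: (inv_ext I) => r pr_; rewrite Kq => sr.
      have -> : pr c1 i (D (pr c2 i (ops 0 (ew i) g))) r =
        pr c1 i (D (fun r => (if c2 then delta else 0) * pr c2 i g r)) r.
        apply: pr_ext => //; first by rewrite sr; lia.
        move=> r1 p1 s1; apply: (coupon_ext cD) => //; first by rewrite s1 sr; lia.
        move=> r2 p2 s2; by rewrite pr_ew ?s2 ?s1 ?sr //; [case: (c2) => //; rewrite mul0r|lia].
      have -> : (fun r => (if c2 then delta else 0) * pr c2 i g r) =
                (fun r => (if c2 then delta else 0) * pr c2 i g r + 0) by apply: funext => ?; rewrite addr0.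
      rewrite (coupon_lin cD) (pr_lin _ _ _ _ (D (fun=> 0))) (coupon0 cD).
      by case: (c1); rewrite /pr ops0 ?mulr0 ?addr0.
    by rewrite (linZ _ _ I); case: (c2); rewrite ?mul0r.
  subst z; have Ka (z : bool) : K k2 (((c0, z), d0) :: a) = (q + K k2 a)%N by rewrite K_cons /k2 /= kk0.
  have hs := K_strand a c' d b; rewrite -E2 in hs.
  have Ix := @inv_col _ _ I (((c0, c), d0) :: a) c' d b (congr1 (cons _) E2).
  rewrite Ka -addnA -sh_ew.
  rewrite /colp Ka -addnA -sh_ew in Ix; rewrite -Ix.
  apply: (inv_ext I) => r pr_; rewrite Kq => sr.
  by apply: mid_comm => //; [rewrite sr; lia|rewrite wf_ew sr addKn].
- by have := inv_other I; rewrite /= eqxx.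
Qed.

Lemma cableL_wf s w s' : run s w = Some s' ->
  wf (K kt s) (cableL s w) /\ outs (K kt s) (cableL s w) = K kt s'.
Proof.
elim: w s => [|e w IH] s; first by case=> ->.
case/run_consP => t st /IH[w2 o2]; have [w1 o1] := cable_step_wf kt st.
have [w3 o3] : wf (K kt s) (loopL s e) /\ outs (K kt s) (loopL s e) = K kt s.
  have [->|->] : loopL s e = [::] \/ loopL s e = [:: Cup tt 0; Cap 0]; last 1 first.
  - by rewrite /= /outs1 /=; split; lia.
  - rewrite /loopL; case: (e) => *; try by left.
    by case: onth => [x|]; [case: eqP; [right|left]|left].
  by [].
by rewrite /= st /= !wf_cat !outs_cat w3 o3 w1 o1 w2 o2.
Qed.

Lemma ncap_cat s w1 w2 s' : run s w1 = Some s' -> ncap s (w1 ++ w2) = (ncap s w1 + ncap s' w2)%N.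
Proof.
elim: w1 s => [|e w1 IH] s; first by case=> ->.
by case/run_consP => t st /IH; rewrite /= st /= => ->; rewrite addnA.
Qed.

(** Connectedness of the component [c0] in the form that the colour argument needs; [knot_conn]
    derives it from the loop count. *)
Definition conn w := forall wt, lift wt = w -> run [::] wt = Some [::] -> hast wt -> allt wt.

Variables (u v : word (label C)) (s2 : seq (label C)).
Let s := (c0, d0) :: s2.
Hypotheses (ru : run [::] u = Some s) (rv : run s v = Some [::]) (uv : conn (u ++ v)).

Lemma inv_ev : Inv (fun f => f [::]) [::].
Proof. by split => //; [move=> f g H; apply: H|case]. Qed.

Lemma lift_head ut t : lift ut = u -> run [::] ut = Some t ->
  exists c t', t = ((c0, c), d0) :: t' /\ map proj t' = s2.
Proof.
move=> lu /run_proj; rewrite lu ru => -[].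
by case: t => //= -[[c1 c] d] t [-> -> ->]; exists c, t.
Qed.

Lemma lift_end vt t t3 : map proj t = s -> lift vt = v -> run t vt = Some t3 -> t3 = [::].
Proof. by move=> ts lv /run_proj; rewrite ts lv rv => -[]; case: t3. Qed.

(* The number of strands coloured by e is even, which fails above the operator
   D if it changes the colour. *)
Lemma mid_zero c1 c2 : c1 != c2 ->
  Phi kk u v s (fun f => pr c1 i (D (pr c2 i f))) = 0.
Proof.
move=> cc; rewrite /Phi; set gv := ops _ _ (fun=> 1).
apply: (@lift_main u [::] s [::] (fun f => f [::]) _ (fun=> 0) false ru erefl inv_ev).
move=> ut t Lm' lu rt I /=; have [c [t' [E E2]]] := lift_head lu rt; subst t.
have := inv_pr c1 (D (pr c2 i gv)) I; rewrite ix0 => ->.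
case: eqP => // Ec; subst c.
have I2 := inv_mid c1 c2 I.
have := inv_pr c1 (D (pr c2 i gv)) I; rewrite ix0 eqxx => <-.
have ts : map proj (((c0, c2), d0) :: t') = s by rewrite /s -E2.
have L := @lift_main v s [::] _ _ (fun=> 1) (fun=> 0) false rv ts I2; apply: L.
move=> vt t3 Lm3 lv rv3 _; have E3 := lift_end _ lv rv3; rewrite E3 /= ?E2 // in rv3.
have := run_parity rt; have := run_parity rv3; rewrite /= !oddD /tru /= eqxx !oddb.
by move: cc; case: (c1); case: (c2); case: (odd _).
Qed.

(** The projections around [D] force the colour [true] at the cut, and connectedness propagates it
    to every cup. There remains the marked cable, with one factor [delta^-1] for each mark. *)
Lemma mid_true : Phi kk u v s (fun f => pr true i (D (pr true i f))) =
  delta^-1 ^+ (ncup u + ncup v) * ops 0 (cableT [::] u)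
    (pr true i (D (pr true i (ops 0 (cableT s v) (fun=> 1))))) [::].
Proof.
rewrite /Phi; set gv := ops _ _ (fun=> 1); set gT := ops 0 (cableT s v) _.
pose cst := delta^-1 ^+ ncup v.
rewrite exprD -mulrA.
have -> : delta^-1 ^+ ncup v * ops 0 (cableT [::] u) (pr true i (D (pr true i gT))) [::] =
   ops 0 (cableT [::] u) (fun r => cst * pr true i (D (pr true i gT)) r) [::].
  by rewrite [RHS]opsZ.
apply: (@lift_main u [::] s [::] (fun f => f [::]) _ _ true ru erefl inv_ev).
move=> ut t Lm' lu rt I; rewrite [true && _]/=; have [c [t' [E E2]]] := lift_head lu rt; subst t.
rewrite (linZ cst _ I).
have H f : Lm' (pr true i f) = if true == c then Lm' f else 0.
  by rewrite -(inv_pr true f I) ix0.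
case: c rt I H => rt I H; last by rewrite !H mulr0; case: (allt ut).
have I2 := inv_mid true true I.
have ts : map proj (((c0, true), d0) :: t') = s by rewrite /s -E2.
have L := @lift_main v s [::] _ _ (fun=> 1) (fun=> 1) (allt ut) rv ts I2; apply: L.
move=> vt t3 Lm3 lv rv3 I3; have E3 := lift_end _ lv rv3; rewrite E3 /= ?E2 // in rv3.
have := @uv (ut ++ vt); rewrite map_cat lu lv run_cat rt /= rv3 => /(_ erefl erefl).
rewrite /allt all_cat -!/(allt _) => -> //.
have := run_hast rt; rewrite /= /tru /= eqxx /= => /(_ isT).
by rewrite /hast has_cat => ->.
Qed.

Let iq : (i + 2 <= q)%N. Proof. by rewrite /q; lia. Qed.

(** The cups of [Jw] are carried through the marked cable below the cut and then above it. At the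
    cut, the projections on the two sides of [D] become the cup and the cap that enclose it. *)
Lemma mid_thin : ops 0 (cableT [::] u)
    (pr true i (D (pr true i (ops 0 (cableT s v) (fun=> 1))))) [::] =
  delta^-1 * delta ^+ (ncap [::] u + ncap s v) *
  Phi kt u v s (fun f => ops 0 [:: Cup tt i] (D (ops 0 [:: Cap i] f))).
Proof.
rewrite /Phi; set gT := ops 0 (cableT s v) _; set gv := ops 0 (cable_from _ _ v) _.
set h := pr true i (D _).
have Ks : K kt s = (n + K kt s2)%N by rewrite K_cons kt0.
have JE : Jw 0 s = Cup tt i :: sh q (Jw 0 s2) by rewrite /= eqxx ix0 kk0 !add0n sh_Jw addn0.
have [wT oT] := cableT_wf ru; have [wT' oT'] := cableT_wf rv.
have [wL oL] := cableL_wf ru; have [wL' oL'] := cableL_wf rv.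
have uE : ops 0 (cableT [::] u) h [::] = ops 0 (cableL [::] u) (ops 0 (Jw 0 s) h) [::].
  rewrite -ops_cat; apply: eqv_wf => //; first exact: (Jw_conv ru).
  by rewrite wf_cat wL oL wfJ.
have vE r : path adj 0%N r -> size r = K kt s ->
    ops 0 (Jw 0 s) gT r = delta ^+ ncap s v * gv r.
  move=> pr_ sr; rewrite -(cableL_ops _ rv) // -ops_cat; apply: eqv_wf => //.
  - by have := Jw_conv rv; rewrite cats0.
  - by rewrite sr wf_cat wfJ outsJ wT'.
  - by rewrite sr wL'.
pose c1 := delta^-1 * delta ^+ ncap s v.
have mE r : path adj 0%N r -> size r = K kt s -> ops 0 (Jw 0 s) h r =
    c1 * ops 0 [:: Cup tt i] (D (ops 0 [:: Cap i] gv)) r.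
  move=> pr_ sr; have wc : wf (size r) [:: Cup tt i] by rewrite /= sr Ks; lia.
  have oc : outs (size r) [:: Cup tt i] = (q + K kt s2)%N by rewrite /= /outs1 /= sr Ks /q; lia.
  rewrite JE -cat1s ops_cat.
  transitivity (ops 0 [:: Cup tt i] (pr true i (D (pr true i (ops 0 (sh q (Jw 0 s2)) gT)))) r).
    apply: ops_ext_wf => // t pt; rewrite oc => st _; rewrite /h -mid_comm //; first by rewrite st; lia.
    by rewrite st addKn wfJ.
  set H := pr true i (ops 0 _ gT).
  rewrite {1}/pr opsZ -ops_cat cat1s ops_loop //; last by rewrite /= sr Ks; lia.
  rewrite mulKf ?delta_neq0 // -opsZ -(couponZ _ _ cD).
  apply: ops_ext_wf => // t pt; rewrite oc => st _; apply: (coupon_ext cD) => //.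
    by rewrite st; lia.
  move=> t1 pt1 st1.
  rewrite /H /pr /c1 -mulrA -opsZ; congr (_ * _).
  rewrite -[ew i]cat1s ops_cat; apply: ops_ext_wf => //; first by rewrite /= st1 st; lia.
  move=> t2 pt2 st2 _; rewrite -ops_cat cat1s -JE; apply: vE => //.
  by rewrite st2 /= /outs1 /= st1 st Ks /q; lia.
rewrite uE (cableL_ops _ ru) // exprD.
have -> : ops 0 (cable_from kt [::] u) (ops 0 (Jw 0 s) h) [::] = c1 *
   ops 0 (cable_from kt [::] u) (ops 0 [:: Cup tt i] (D (ops 0 [:: Cap i] gv))) [::].
  rewrite -opsZ; have [w1 o1] := cable_wf kt ru.
  apply: ops_ext_wf => // r pr_; rewrite o1 => sr _; exact: mE.
by rewrite /c1; ring.
Qed.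

(** A turnback is [delta] times the projection to [true]. When 1 is split into the two projections
    on the other side of [D], [mid_zero] removes the mixed term, so both placements give the term
    with [true] twice. *)
Lemma coupon_thin :
  Phi kk u v s (fun f => ops 0 (ew i) (D f)) =
    Phi kt u v s (fun f => ops 0 [:: Cup tt i] (D (ops 0 [:: Cap i] f))) /\
  Phi kk u v s (fun f => D (ops 0 (ew i) f)) =
    Phi kt u v s (fun f => ops 0 [:: Cup tt i] (D (ops 0 [:: Cap i] f))).
Proof.
set X := Phi kt u v s _.
have E : delta * Phi kk u v s (fun f => pr true i (D (pr true i f))) = X.
  rewrite mid_true mid_thin -/X.
  have := @ncap_ncup (u ++ v) [::]; rewrite run_cat ru /= rv => /(_ erefl).
  rewrite (ncap_cat _ ru) /ncup count_cat add0n -!/(ncup _) => /double_inj ->.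
  have dn0 := delta_neq0.
  set N := (_ + _)%N; have DN : delta ^+ N != 0 by apply: expf_neq0.
  by rewrite exprVn; field; rewrite dn0 DN.
have ewE f : ops 0 (ew i) f = fun r => delta * pr true i f r.
  by apply: funext => r; rewrite /pr mulVKf ?delta_neq0.
have sp f : f = fun r => 1 * pr true i f r + pr false i f r.
  by apply: funext => r; rewrite /pr; ring.
have A1 := @mid_zero true false isT; have A2 := @mid_zero false true isT.
rewrite /Phi in E A1 A2 *; set gv := ops 0 (cable_from kk s v) _ in E A1 A2 *.
split.
- rewrite ewE opsZ -E; congr (_ * _).
  by rewrite {1}(sp gv) (coupon_lin cD) pr_lin ops_lin A1 mul1r addr0.
- rewrite ewE (couponZ _ _ cD) opsZ -E; congr (_ * _).
  by rewrite [in LHS](sp (D (pr true i gv))) ops_lin A2 mul1r addr0.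
Qed.
End Coupon.
End Projector.

(** A matrix unit of the path model on the first strands. It is not presented by a diagram, which is
    why [coupon] is axiomatic. *)
Definition Eop (P Q : seq nat) (f : seq nat -> F) r :=
  if take (size P) r == P then f (Q ++ drop (size P) r) else 0.

Lemma coupon_Eop q P Q : size P = q -> size Q = q -> path adj 0%N Q ->
  last 0%N P = last 0%N Q -> coupon q (Eop P Q).
Proof.
move=> sP sQ pQ PQ; split.
- by move=> c f g; apply: funext => r; rewrite /Eop; case: eqP => // _; rewrite mulr0 addr0.
- move=> f g r pr_ h H; rewrite /Eop; case: eqP => // E; apply: H.
    have pd : path adj (last 0%N P) (drop (size P) r).
      by move: pr_; rewrite -{1}(cat_take_drop (size P) r) E cat_path => /andP[].
    by rewrite cat_path pQ -PQ.
  by rewrite size_cat sQ size_drop -sP subnKC // sP.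
- move=> x f r pr_ h w; have [p1 [p2 [E E1]]] := split3 h; subst r.
  rewrite -{2}E1 ops_sh.
  have -> : (fun r => Eop P Q f (p1 ++ r)) = fun r => if p1 == P then f (Q ++ r) else 0.
    by apply: funext => r; rewrite /Eop sP -E1 take_size_cat // drop_size_cat.
  rewrite /Eop sP -E1 take_size_cat // drop_size_cat //.
  case: eqP => [EP|_]; last by rewrite ops0.
  have -> : size p1 = size Q by rewrite E1 sQ.
  by rewrite ops_sh -PQ -EP.
Qed.

Lemma coupon_ops q w : wf q w -> outs q w = q -> coupon q (ops 0 w).
Proof.
move=> ww ow; split.
- by move=> c f g; apply: funext => r; rewrite ops_lin.
- move=> f g r pr_ h H; have [w1 o1] := wf_weak (size r - q) ww; rewrite subnKC // in w1 o1.
  by apply: ops_ext_wf => // t pt st _; apply: H; rewrite // st o1 ow subnKC.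
- move=> x f r pr_ h wx; have [w1 o1] := wf_weak (size r - q) ww; rewrite subnKC // in w1 o1.
  have w2 := wf_sh q wx; have o2 := outs_sh q wx; rewrite subnKC // in w2 o2.
  rewrite -!ops_cat; apply: eqv_wf => //.
  + by have := eqv_far x ww; rewrite ow.
  + by rewrite wf_cat w1 o1 ow subnKC.
  + by rewrite wf_cat w2 o2; have [] := wf_weak (outs (size r - q) x) ww.
Qed.

Lemma coupon_comp q D D' : coupon q D -> coupon q D' -> coupon q (fun f => D (D' f)).
Proof.
move=> cD cD'; split.
- by move=> c f g; rewrite (coupon_lin cD') (coupon_lin cD).
- move=> f g r pr_ h H; apply: (coupon_ext cD) => // r' pr' sr'.
  by apply: (coupon_ext cD'); rewrite ?sr' // => r2 p2 s2; apply: H; rewrite // s2 sr'.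
- move=> x f r pr_ h w; rewrite -(coupon_comm cD) //; apply: (coupon_ext cD) => // r' pr' sr'.
  by apply: (coupon_comm cD'); rewrite ?sr'.
Qed.

Lemma sum_nbs1 x b (g : nat -> F) : b \in nbs x ->
  \sum_(c <- nbs x) (if c == b then g c else 0) = g b.
Proof.
by move=> bx; rewrite (bigD1_seq b) ?nbs_uniq //= eqxx big1 ?addr0 // => c /negPf->.
Qed.

Lemma ew_at R y z r f : ops 0 (ew (size R)) f (R ++ [:: y, z & r]) =
  if z == last 0%N R then (lam z)^-1 * \sum_(c <- nbs z) lam c * f (R ++ [:: c, z & r]) else 0.
Proof.
have := ops_sh [:: Cap 0; Cup tt 0] 0 f R [:: y, z & r]; rewrite /sh /= !addn0 => ->.
by case: eqP => [->|].
Qed.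

Lemma cap_at R y z r f : ops 0 [:: Cap (size R)] f (R ++ [:: y, z & r]) =
  if z == last 0%N R then (lam z)^-1 * f (R ++ r) else 0.
Proof.
have := ops_sh [:: Cap 0] 0 f R [:: y, z & r]; rewrite /sh /= !addn0 => ->.
by case: eqP => [->|].
Qed.

Lemma cup_at R r f : ops 0 [:: Cup tt (size R)] f (R ++ r) =
  \sum_(c <- nbs (last 0%N R)) lam c * f (R ++ [:: c, last 0%N R & r]).
Proof. by have := ops_sh [:: Cup tt 0] 0 f R r; rewrite /sh /= !addn0 => ->. Qed.

Lemma seq_diff (P Q : seq nat) : size P = size Q -> P != Q ->
  exists R x y P' Q', [/\ P = R ++ x :: P', Q = R ++ y :: Q' & x != y].
Proof.
elim: P Q => [|a P IH] [|b Q] //= [sz] PQ.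
have [ab|ab] := eqVneq a b; last by exists [::], a, b, P, Q.
rewrite ab eqseq_cons eqxx /= in PQ.
by have [R [x [y [P' [Q' [-> -> xy]]]]]] := IH _ sz PQ; rewrite ab; exists (b :: R), x, y, P', Q'.
Qed.

Lemma last_iota1 n : last 0%N (iota 1 n) = n.
Proof. by case: n => // n; rewrite -{1}(addn1 n) iotaD last_cat /= add1n. Qed.

(** The start 0 is an end of the graph, so a path that never turns back must climb: it is the
    canonical path to its end. *)
Lemma path_turn P : path adj 0%N P -> P = iota 1 (size P) \/
  exists R b x T, P = R ++ [:: b, x & T] /\ last 0%N R = x.
Proof.
elim/last_ind: P => [|P z IH]; first by left.
rewrite rcons_path size_rcons => /andP[pP az].
case: (IH pP) => [EP|[R [b [x [T [-> lx]]]]]]; last first.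
  by right; exists R, b, x, (rcons T z); rewrite rcons_cat.
have lm := path_le (leq0n m) pP; rewrite EP last_iota1 in az lm.
move: az; rewrite adjE // => /andP[_ /orP[/eqP ->|/eqP E]].
  by left; rewrite -[in RHS](addn1 (size P)) iotaD -EP cats1 add1n.
right; exists (iota 1 z), z.+1, z, [::]; rewrite last_iota1; split=> //.
by rewrite {1}EP E -{1}(addn1 z) iotaD /= add1n -cats1 -catA.
Qed.

(** The quotient of the two eigenvalues is A to the power 4(x + 1), which differs from 1 by the
    order of A^4. *)
Lemma mon_inj x y z : (x <= m)%N -> adj x y -> adj x z -> y != z ->
  mon true x y != mon true x z.
Proof.
move=> xm; rewrite !adjE // => /andP[ym] /orP hy /andP[zm] /orP hz yz.
wlog Ey : y z ym zm hy hz yz / y = x.+1.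
  move=> W; case: hy hz => /eqP Ey [] /eqP Ez.
  - by move: yz; rewrite Ey Ez eqxx.
  - by apply: W => //; [left|right]; apply/eqP.
  - by rewrite eq_sym; apply: W; rewrite 1?eq_sym //; [left|right]; apply/eqP.
  - by move: yz; rewrite (_ : y = z) ?eqxx //; lia.
case: hz => /eqP Ez; first by move: yz; rewrite Ey Ez eqxx.
have zx : (z == x.+1) = false by apply/eqP; lia.
rewrite /mon Ey eqxx zx /=; apply/negP => /eqP E.
have hx : (0 < x.+1 < m.+2)%N by lia.
have /negP[] := @A_prim _ hx; apply/eqP.
have -> : (4 * x.+1 = 2 * x + (2 * x + 4))%N by lia.
by rewrite exprD E mulVf // expf_neq0.
Qed.

Section Connected.
Variables (C : finType) (c0 : C) (k : C -> nat) (d0 : bool) (u v : word (label C))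
  (s2 : seq (label C)).
Let s := (c0, d0) :: s2.
Hypotheses (ru : run [::] u = Some s) (rv : run s v = Some [::]) (uv : conn c0 (u ++ v)).
Let Ph q Y := Phi (upd k c0 q) u v s Y.

Lemma Ph_ext q Y Y' : (forall f r, path adj 0%N r -> (q <= size r)%N -> Y f r = Y' f r) ->
  Ph q Y = Ph q Y'.
Proof.
move=> H; rewrite /Ph /Phi; have [w1 o1] := cable_wf (upd k c0 q) ru.
apply: ops_ext_wf => // r pr_; rewrite o1 K_cons /upd /= eqxx => sr _.
by apply: H => //; rewrite sr leq_addr.
Qed.

Lemma Ph_lin q c Y Y' : Ph q (fun f r => c * Y f r + Y' f r) = c * Ph q Y + Ph q Y'.
Proof. exact: ops_lin. Qed.

Lemma Ph_sum q (I : eqType) (r : seq I) (c : I -> F) Y :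
  Ph q (fun f t => \sum_(a <- r) c a * Y a f t) = \sum_(a <- r) c a * Ph q (Y a).
Proof.
by rewrite /Ph /Phi ops_sum; apply: eq_bigr => a _; rewrite opsZ.
Qed.

Lemma PhZ q c Y : Ph q (fun f r => c * Y f r) = c * Ph q Y.
Proof. exact: opsZ. Qed.

Lemma trace_ew q i D : (i + 2 <= q)%N -> coupon q D ->
  Ph q (fun f => ops 0 (ew i) (D f)) = Ph q (fun f => D (ops 0 (ew i) f)) /\
  Ph q (fun f => ops 0 (ew i) (D f)) =
    Ph (q - 2) (fun f => ops 0 [:: Cup tt i] (D (ops 0 [:: Cap i] f))).
Proof.
case: q => [|[|n]]; rewrite ?addn2 // !ltnS => iq cD; rewrite subn2 /=.
by have [E1 E2] := coupon_thin k iq cD ru rv uv; rewrite /Ph E1 E2.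
Qed.

(* Hence D may be moved around the component past any braid on its q copies. *)
Lemma trace_cross q b i D : (i + 2 <= q)%N -> coupon q D ->
  Ph q (fun f => ops 0 [:: Cross b i] (D f)) = Ph q (fun f => D (ops 0 [:: Cross b i] f)).
Proof.
move=> iq cD; have [E _] := trace_ew iq cD.
have cr f : ops 0 [:: Cross b i] f = fun r => Ab b * f r + (Ab b)^-1 * ops 0 (ew i) f r by [].
transitivity (Ph q (fun f r => Ab b * D f r + (Ab b)^-1 * ops 0 (ew i) (D f) r)); first by [].
rewrite Ph_lin PhZ E.
transitivity (Ph q (fun f r => Ab b * D f r + (Ab b)^-1 * D (ops 0 (ew i) f) r)).
  by rewrite Ph_lin PhZ.
by congr Ph; apply: funext => f; rewrite cr (coupon_lin cD) (couponZ _ _ cD).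
Qed.

Definition crosses q (w : word unit) := all (fun e => if e is Cross _ p then (p + 2 <= q)%N else false) w.

Lemma crosses_wf q w : crosses q w -> wf q w /\ outs q w = q.
Proof.
elim: w => //= -[//|//|b p] w IH /andP[h /IH[w1 o1]].
have E : outs1 q (Cross b p) = q by rewrite /outs1 /=; lia.
by rewrite /= in h *; rewrite E w1 o1 h.
Qed.

Lemma trace_crosses q w D : crosses q w -> coupon q D ->
  Ph q (fun f => ops 0 w (D f)) = Ph q (fun f => D (ops 0 w f)).
Proof.
elim: w D => // -[//|//|b p] w IH D /= /andP[h cw] cD.
have [w1 o1] := crosses_wf cw; have cwD := coupon_comp (coupon_ops w1 o1) cD.
transitivity (Ph q (fun f => ops 0 [:: Cross b p] (ops 0 w (D f)))); first by [].
rewrite (trace_cross b h cwD) (IH (fun f => D (ops 0 [:: Cross b p] f))) //.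
apply: coupon_comp => //; have [w2 o2] : wf q [:: Cross b p] /\ outs q [:: Cross b p] = q.
  by apply: crosses_wf; rewrite /= h.
exact: coupon_ops.
Qed.

Lemma crosses_mon q j : (j < q)%N -> crosses q (L true 0 j ++ Rr true 0 j).
Proof.
move=> jq; rewrite /crosses all_cat /L /Rr !all_map all_rev andbb.
by apply/allP => x; rewrite mem_iota /= => hx; lia.
Qed.

(* The monodromies of the j-th strand around the previous ones are diagonal,
   and tell P from Q where they first differ. *)
Lemma offdiag q P Q : size P = q -> size Q = q -> path adj 0%N P -> path adj 0%N Q ->
  last 0%N P = last 0%N Q -> P != Q -> Ph q (Eop P Q) = 0.
Proof.
move=> sP sQ pP pQ PQ nPQ; have sPQ : size P = size Q by rewrite sP.
have [R [x [y [P' [Q' [EP EQ xy]]]]]] := seq_diff sPQ nPQ.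
have jq : (size R < q)%N by rewrite -sP EP size_cat /=; lia.
have T := trace_crosses (crosses_mon jq) (coupon_Eop sP sQ pQ PQ).
have xR : (last 0%N R <= m)%N.
  by move: pP; rewrite EP cat_path => /andP[/path_le -> //].
have aRx : adj (last 0%N R) x by move: pP; rewrite EP cat_path => /and3P[].
have aRy : adj (last 0%N R) y by move: pQ; rewrite EQ cat_path => /and3P[].
have V z T' : vx (R ++ z :: T') (size R) = last 0%N R /\ vx (R ++ z :: T') (size R).+1 = z.
  by rewrite vx_last -[(size R).+1]addn1 vx_cat.
have pQd r : path adj 0%N r -> take (size P) r = P -> path adj 0%N (Q ++ drop (size P) r).
  move=> pr_ E; rewrite cat_path pQ -PQ.
  by move: pr_; rewrite -{1}(cat_take_drop (size P) r) E cat_path => /andP[].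
have E1 : Ph q (fun f => ops 0 (L true 0 (size R) ++ Rr true 0 (size R)) (Eop P Q f)) =
    mon true (last 0%N R) x * Ph q (Eop P Q).
  rewrite -PhZ; apply: Ph_ext => f r pr_ h; rewrite mon_diag //; last by lia.
  rewrite /Eop; case: eqP => [E|_]; last by rewrite !mulr0.
  rewrite -{1 2}(cat_take_drop (size P) r) E EP -catA /=.
  by have [-> ->] := V x (P' ++ drop (size (R ++ x :: P')) r).
have E2 : Ph q (fun f => Eop P Q (ops 0 (L true 0 (size R) ++ Rr true 0 (size R)) f)) =
    mon true (last 0%N R) y * Ph q (Eop P Q).
  rewrite -PhZ; apply: Ph_ext => f r pr_ h; rewrite /Eop; case: eqP => [E|_]; last by rewrite mulr0.
  rewrite mon_diag; [|exact: pQd|by rewrite size_cat sQ; lia].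
  by rewrite {1 2}EQ -catA /=; have [-> ->] := V y (Q' ++ drop (size P) r).
move: T; rewrite E1 E2 => /eqP; rewrite -subr_eq0 -mulrBl mulf_eq0 subr_eq0.
by rewrite (negPf (mon_inj xR aRx aRy xy)) /= => /eqP.
Qed.

(* Two copies of the component cancel along a backtracking of the path. *)
Lemma reduce R b x T : last 0%N R = x -> path adj 0%N (R ++ [:: b, x & T]) ->
  let P := R ++ [:: b, x & T] in
  Ph (size P) (Eop P P) = Ph (size (R ++ T)) (Eop (R ++ T) (R ++ T)).
Proof.
move=> lR pP P; set q := size P.
have qE : q = (size R + (size T).+2)%N by rewrite /q /P size_cat.
have iq : (size R + 2 <= q)%N by rewrite qE; lia.
have sP : size P = q by [].
have [_ T2] := trace_ew iq (coupon_Eop sP sP pP erefl).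
have xm : (x <= m)%N by rewrite -lR; move: pP; rewrite cat_path => /andP[/path_le ->].
have xb : b \in nbs x by move: pP; rewrite cat_path lR => /and3P[].
have bm : (b <= m)%N by apply: adj_le xm xb.
have lx := lam_neq0 xm; have lb := lam_neq0 bm.
have sp r : (q <= size r)%N -> exists R' y z r', r = R' ++ [:: y, z & r'] /\ size R' = size R.
  move=> h; have hR : (size R <= size r)%N by lia.
  have [R' [r' [Er ER]]] := split3 hR; move: h; rewrite Er size_cat ER qE.
  by case: r' Er => [|y [|z r']] /= Er h; try lia; exists R', y, z, r'.
have EopP Q' R' c z r' f : size R' = size R ->
    Eop (R ++ [:: Q', x & T]) P f (R' ++ [:: c, z & r']) =
    if [&& R' == R, c == Q', z == x & take (size T) r' == T] then f (P ++ drop (size T) r') else 0.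
  move=> sR; rewrite /Eop size_cat -sR /= take_cat drop_cat ltnNge leq_addr /= addKn.
  by rewrite eqseq_cat // !eqseq_cons.
(* The turnback replaces b by any neighbour a of x in the first path of the unit; [offdiag] keeps
   only a = b. *)
have E1 : Ph q (fun f => ops 0 (ew (size R)) (Eop P P f)) = lam b / lam x * Ph q (Eop P P).
  transitivity (Ph q (fun f r => \sum_(a <- nbs x) lam b / lam x * Eop (R ++ [:: a, x & T]) P f r)).
    apply: Ph_ext => f r pr_ /sp[R' [y [z [r' [Er sR]]]]]; subst r.
    rewrite -{1}sR ew_at.
    under eq_bigr do rewrite EopP //.
    under [RHS]eq_bigr do rewrite EopP //.
    have [ER|nR] := eqVneq R' R; last first.
      rewrite [RHS]big1 => [|c _]; last by rewrite mulr0.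
      by case: eqP => // _; rewrite big1 ?mulr0 // => c _; rewrite mulr0.
    subst R'; have [zx|nz] := eqVneq z x; last first.
      by rewrite lR (negPf nz) [RHS]big1 // => c _; rewrite andbF mulr0.
    subst z; rewrite lR eqxx.
    have [_|_] := eqVneq (take (size T) r') T; last first.
      rewrite [RHS]big1 => [|c _]; last by rewrite !andbF mulr0.
      by rewrite big1 ?mulr0 // => c _; rewrite !andbF mulr0.
    have yx : y \in nbs x by move: pr_; rewrite cat_path lR => /and3P[].
    rewrite (eq_bigr (fun c => if c == b then lam c * f (P ++ drop (size T) r') else 0)); last first.
      by move=> c _; rewrite andbT /=; case: eqP; rewrite ?mulr0.
    rewrite sum_nbs1 // [RHS](eq_bigr (fun c => if c == y then lam b / lam x * f (P ++ drop (size T) r') else 0)); last first.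
      by move=> c _; rewrite andbT /= eq_sym; case: eqP; rewrite ?mulr0.
    by rewrite sum_nbs1 //; ring.
  rewrite Ph_sum (bigD1_seq b) ?nbs_uniq //= big1_seq ?addr0 // => a /andP[ab ax].
  have pa : path adj 0%N (R ++ [:: a, x & T]).
    move: pP; rewrite !cat_path lR /= => /and4P[-> _ _ ->].
    by rewrite /= andbT; apply/andP; split=> //; apply: adj_sym.
  rewrite offdiag ?mulr0 ?size_cat //= ?last_cat //.
  by rewrite /P eqseq_cat // !eqseq_cons eqxx (negPf ab).
have EopRT R' r' g : size R' = size R -> Eop (R ++ T) (R ++ T) g (R' ++ r') =
    if (R' == R) && (take (size T) r' == T) then g ((R ++ T) ++ drop (size T) r') else 0.
  move=> sR; rewrite /Eop size_cat -sR take_cat drop_cat ltnNge leq_addr /= addKn.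
  by rewrite eqseq_cat.
(* With two copies fewer, the cup must choose b and the cap divides by the weight of x: the same
   factor, which therefore cancels. *)
have E2 : Ph (q - 2) (fun f => ops 0 [:: Cup tt (size R)] (Eop P P (ops 0 [:: Cap (size R)] f))) =
    lam b / lam x * Ph (size (R ++ T)) (Eop (R ++ T) (R ++ T)).
  have -> : (q - 2 = size (R ++ T))%N by rewrite qE size_cat; lia.
  rewrite -PhZ; apply: Ph_ext => f r pr_; rewrite size_cat => h.
  have hR : (size R <= size r)%N by lia.
  have [R' [r' [Er sR]]] := split3 hR; subst r; rewrite -{1}sR cup_at.
  under eq_bigr do rewrite EopP //.
  rewrite EopRT //.
  have [ER|nR] := eqVneq R' R; last by rewrite big1 ?mulr0 // => c _; rewrite mulr0.
  subst R'; rewrite lR eqxx andTb.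
  have [_|_] := eqVneq (take (size T) r') T; last first.
    by rewrite big1 ?mulr0 // => c _; rewrite !andbF mulr0.
  rewrite (eq_bigr (fun c => if c == b then lam c * ((lam x)^-1 * f ((R ++ T) ++ drop (size T) r')) else 0)); last first.
    move=> c _; rewrite !andbT andTb; case: eqP; rewrite ?mulr0 // => _.
    have -> : P ++ drop (size T) r' = R ++ [:: b, x & T ++ drop (size T) r'] by rewrite /P -catA.
    by rewrite cap_at lR eqxx catA.
  by rewrite sum_nbs1 // mulrA.
move: T2; rewrite E1 E2 => /(mulfI _); apply.
by rewrite mulf_neq0 ?invr_neq0.
Qed.

Let Y x := Ph x (Eop (iota 1 x) (iota 1 x)).

Lemma psi P : path adj 0%N P -> Ph (size P) (Eop P P) = Y (last 0%N P).
Proof.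
have [N] := ubnP (size P); elim: N P => // N IH P sP pP.
case: (path_turn pP) => [EP|[R [b [x [T [EP lR]]]]]].
  by rewrite EP last_iota1 size_iota.
subst P; rewrite reduce //; rewrite size_cat /= in sP.
rewrite IH ?size_cat; [|lia|].
  by rewrite !last_cat /= lR.
by move: pP; rewrite !cat_path lR /= => /and4P[-> _ _ ->].
Qed.

(** The prefix R is refined one step at a time; a complete path contributes its diagonal unit, whose
    value [psi] depends only on the end. *)
Lemma diag_sum l R q h : path adj 0%N R -> (size R + l)%N = q ->
  Ph q (fun f r => if take (size R) r == R then h (vx r q) * f r else 0) =
  walks l (last 0%N R) (fun b => h b * Y b).
Proof.
elim: l R => [|l IH] R pR sR.
  rewrite addn0 in sR; rewrite /= -psi // sR -PhZ; apply: Ph_ext => f r pr_ hq.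
  rewrite /Eop sR; case: eqP => [E|_]; last by rewrite mulr0.
  rewrite -{2}E cat_take_drop; congr (h _ * _).
  by rewrite -{1}(cat_take_drop q r) E -{2}sR vx_last.
transitivity (Ph q (fun f r => \sum_(c <- nbs (last 0%N R))
    1 * (if take (size (rcons R c)) r == rcons R c then h (vx r q) * f r else 0))).
  apply: Ph_ext => f r pr_ hq; have hR : (size R <= size r)%N by lia.
  have [R' [[|y r'] [Er ER]]] := split3 hR; first by move: hq; rewrite Er size_cat /=; lia.
  rewrite {1}Er -ER take_size_cat //.
  rewrite (eq_bigr (fun c => if c == y then (if R' == R then h (vx r q) * f r else 0) else 0)).
    have [ERR|nR] := eqVneq R' R; last by rewrite big1 // => c _; rewrite if_same.
    rewrite sum_nbs1 //.
    by move: pr_; rewrite Er cat_path ERR => /and3P[].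
  move=> c _; rewrite mul1r size_rcons -ER Er -cat_rcons take_size_cat ?size_rcons //.
  by rewrite eqseq_rcons [c == y]eq_sym andbC; case: (y == c).
rewrite Ph_sum /=; apply: eq_big_seq => c cR; rewrite mul1r IH ?last_rcons //.
  by rewrite rcons_path pR.
by rewrite size_rcons; lia.
Qed.

(** The weights y depend neither on the number q of copies nor on h; only so can a Chebyshev
    polynomial combine different values of q. *)
Lemma diag_insert : exists y : nat -> F, forall q h,
  Ph q (fun f r => h (vx r q) * f r) = walks q 0 (fun b => h b * y b).
Proof.
exists Y => q h; rewrite -(@diag_sum q [::] q h) //.
by apply: Ph_ext => f r _ _; rewrite take0.
Qed.
End Connected.

(** * Chebyshev polynomials *)

Fixpoint chb (k : nat) : {poly F} :=
  match k with
  | 0 => 1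
  | k1.+1 => match k1 with
             | 0 => 'X
             | k2.+1 => 'X * chb k1 - chb k2
             end
  end.

Lemma chbSS n : chb n.+2 = 'X * chb n.+1 - chb n.
Proof. by []. Qed.

Lemma nat_ind2 (P : nat -> Prop) : P 0%N -> P 1%N ->
  (forall n, P n -> P n.+1 -> P n.+2) -> forall n, P n.
Proof.
move=> P0 P1 PS n; suff: P n /\ P n.+1 by case.
by elim: n => // n [Pn Pn1]; split=> //; apply: PS.
Qed.

Lemma pevB B p p' u : pev B (p - p') u = pev B p u - pev B p' u.
Proof. by rewrite /pev -sumrB; apply: eq_bigr => j _; rewrite coefB mulrBl. Qed.

Lemma pevXM B p u : pev B.+1 ('X * p) u = pev B p (fun j => u j.+1).
Proof.
rewrite /pev big_ord_recl coefXM mul0r add0r; apply: eq_bigr => j _.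
by rewrite coefXM.
Qed.

Lemma pev_sum B p (I : Type) (r : seq I) (u : I -> nat -> F) :
  pev B p (fun j => \sum_(c <- r) u c j) = \sum_(c <- r) pev B p (u c).
Proof. by rewrite /pev exchange_big; apply: eq_bigr => j _; rewrite mulr_sumr. Qed.

Lemma pev1 B u : pev B.+1 1 u = u 0%N.
Proof.
by rewrite /pev big_ord_recl coef1 mul1r big1 ?addr0 // => j _; rewrite coef1 mul0r.
Qed.

(** The n-th Chebyshev polynomial in the adjacency matrix of the graph, applied to [h], at the
    vertex a; [walks] plays the same part for powers. *)
Fixpoint vv n a (h : nat -> F) : F :=
  match n with
  | 0 => h a
  | n1.+1 => match n1 with
             | 0 => \sum_(c <- nbs a) h c
             | n2.+1 => \sum_(c <- nbs a) vv n1 c h - vv n2 a h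
             end
  end.

Lemma vvSS n a h : vv n.+2 a h = \sum_(c <- nbs a) vv n.+1 c h - vv n a h.
Proof. by []. Qed.

Lemma pev_chb n B a h : (n < B)%N -> pev B (chb n) (fun j => walks j a h) = vv n a h.
Proof.
elim/nat_ind2: n B a => [||n IH1 IH2] [|B] a // nB; first exact: pev1.
  rewrite [chb _]/= -['X]mulr1 pevXM; case: B nB => // B _.
  by rewrite pev1.
rewrite chbSS pevB pevXM IH1 ?pev_sum; last by lia.
by congr (_ - _); apply: eq_bigr => c _; apply: IH2.
Qed.

Lemma vv_adj n a h : \sum_(c <- nbs a) vv n c h = vv n a (fun x => \sum_(c <- nbs x) h c).
Proof.
elim/nat_ind2: n a => // n IH1 IH2 a.
rewrite vvSS -IH1 -sumrB; apply: eq_bigr => c _.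
by rewrite vvSS IH2.
Qed.

(** By [vv_adj] the recursion may be carried out on the side of [h], where from the vertex 0 it
    climbs one step at a time. This is fusion with the trivial colour. *)
Lemma vv0 n h : (n <= m)%N -> vv n 0 h = h n.
Proof.
elim/nat_ind2: n h => // [h|n IH1 IH2 h nm].
  by rewrite /= /nbs => ->; rewrite big_seq1.
rewrite vvSS vv_adj IH2 ?IH1; [|lia..].
by rewrite /nbs nm big_cat !big_seq1 /= addrK.
Qed.

(** The S matrix up to scale, in labels shifted by 1. Its recursions then extend to the labels 0 and
    m + 2, where it vanishes. *)
Definition Sg (N B : nat) : F :=
  (-1) ^+ (N + B) * (A ^+ (2 * (N * B)) - A ^- (2 * (N * B))) / (A ^+ 2 - A ^- 2).
Definition sg n a := Sg n.+1 a.+1.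

Lemma sg_sym n a : sg n a = sg a n.
Proof. by rewrite /sg /Sg (addnC n.+1) (mulnC n.+1). Qed.

Lemma sg0 a : sg 0 a = lam a.
Proof.
rewrite /sg /Sg /lam mul1n (_ : (-1) ^+ (1 + a.+1) = (-1) ^+ a :> F) //.
by rewrite add1n exprS exprS mulN1r mulN1r opprK.
Qed.

Lemma SgAb b N B : Sg N B =
  (-1) ^+ (N + B) * (Ab b ^+ (2 * (N * B)) - Ab b ^- (2 * (N * B))) / (Ab b ^+ 2 - Ab b ^- 2).
Proof.
case: b => //=; rewrite /Sg !exprVn !invrK -!mulrA; congr (_ * _).
by rewrite -(opprB (A ^+ 2)) -(opprB (A ^+ (2 * _))) invrN mulrNN.
Qed.

Lemma Sg0 N : Sg N 0 = 0.
Proof. by rewrite /Sg muln0 expr0 invr1 subrr mulr0 mul0r. Qed.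

Lemma Sg0l B : Sg 0 B = 0.
Proof. by rewrite /Sg mul0n expr0 invr1 subrr mulr0 mul0r. Qed.

Lemma Sg_top N : Sg N m.+2 = 0.
Proof.
rewrite /Sg; suff -> : A ^+ (2 * (N * m.+2)) - A ^- (2 * (N * m.+2)) = 0 by rewrite mulr0 mul0r.
have E : A ^+ (2 * (N * m.+2)) * A ^+ (2 * (N * m.+2)) = 1.
  rewrite -exprD (_ : _ + _ = 4 * m.+2 * N)%N; last by lia.
  by rewrite exprM A_order expr1n.
by apply/eqP; rewrite subr_eq0; apply/eqP/(mulIf (expf_neq0 (2 * (N * m.+2)) A_neq0));
  rewrite E mulVf // expf_neq0.
Qed.

Lemma thS b a : th b a.+1 = - Ab b ^+ (2 * a + 3) * th b a.
Proof.
rewrite /th (_ : (a.+1 ^ 2 + 2 * a.+1 = (2 * a + 3) + (a ^ 2 + 2 * a))%N); last by lia.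
by rewrite exprS exprD; ring.
Qed.

(** The recursion [vvSS] for the eigenvalues of a circle, after division by the twists of a and
    n. *)
Lemma Sg_rec b n a :
  - Ab b ^+ (2 * a + 3) * Sg n.+1 a.+2 - Ab b ^- (2 * a + 1) * Sg n.+1 a
  + Ab b ^- (2 * n + 1) * Sg n a.+1 = - Ab b ^+ (2 * n + 3) * Sg n.+2 a.+1.
Proof.
rewrite !(SgAb b); set x := Ab b; have x0 : x != 0 := Ab_neq0 b; have D0 := AbD_neq0 b.
rewrite -/x in D0; set D := x ^+ 2 - x ^- 2 in D0 *.
have -> : (2 * (n.+1 * a.+2) = 2 * (n * a) + (2 * n + 2 * n) + 2 * a + 4)%N by lia.
have -> : (2 * (n.+1 * a) = 2 * (n * a) + 2 * a)%N by lia.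
have -> : (2 * (n * a.+1) = 2 * (n * a) + 2 * n)%N by lia.
have -> : (2 * (n.+2 * a.+1) = 2 * (n * a) + 2 * n + (2 * a + 2 * a) + 4)%N by lia.
have -> : (n.+1 + a.+2 = n + a + 3)%N by lia.
have -> : (n.+1 + a = n + a + 1)%N by lia.
have -> : (n + a.+1 = n + a + 1)%N by lia.
have -> : (n.+2 + a.+1 = n + a + 3)%N by lia.
rewrite !exprD.
set X := x ^+ (2 * n); set Z := x ^+ (2 * a); set T := x ^+ (2 * (n * a)).
set e := (-1) ^+ n; set e' := (-1) ^+ a.
have X0 : X != 0 by apply: expf_neq0.
have Z0 : Z != 0 by apply: expf_neq0.
have T0 : T != 0 by apply: expf_neq0.
by field; rewrite D0 x0 !expf_neq0.
Qed.

(* The eigenvalues of a circle are, up to twists, the entries of the S matrix. *)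
Lemma vv_sg b n a : (a <= m)%N -> vv n a (fun x => lam x * th b x) = th b a * th b n * sg n a.
Proof.
have x0 := Ab_neq0 b.
have R k c : (c <= m)%N -> (forall d, (d <= m)%N -> vv k d (fun x => lam x * th b x) = th b d * th b k * sg k d) ->
    \sum_(d <- nbs c) vv k d (fun x => lam x * th b x) + Ab b ^- (2 * k + 1) * th b c * th b k * Sg k c.+1 =
    th b c * th b k.+1 * sg k.+1 c.
  move=> cm H; have -> : \sum_(d <- nbs c) vv k d (fun x => lam x * th b x) =
      th b c.+1 * th b k * Sg k.+1 c.+2 - Ab b ^- (2 * c + 1) * th b c * th b k * Sg k.+1 c.
    rewrite /nbs big_cat /=; congr (_ + _).
      case: ltnP => h; first by rewrite big_seq1 H.
      have -> : c = m by lia.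
      by rewrite Sg_top mulr0 big_nil.
    case: c cm => [|c] cm; first by rewrite big_nil Sg0 mulr0 oppr0.
    rewrite big_seq1 H ?thS; last by lia.
    rewrite (_ : (2 * c.+1 + 1 = 2 * c + 3)%N); last by lia.
    by rewrite /sg; set y := _ ^+ (2 * c + 3); have y0 : y != 0 by [apply: expf_neq0]; field.
  rewrite !thS; transitivity (th b c * th b k * (- Ab b ^+ (2 * c + 3) * Sg k.+1 c.+2 -
     Ab b ^- (2 * c + 1) * Sg k.+1 c + Ab b ^- (2 * k + 1) * Sg k c.+1)); first by ring.
  by rewrite Sg_rec /sg; ring.
elim/nat_ind2: n a => [a am|a am|n IH1 IH2 a am].
- by rewrite /= sg0 /th /= expr0 expr0 mulr1 mulr1 mulrC.
- rewrite -(R 0%N a am) => [|d dm]; last by rewrite /= sg0 /th /= expr0 expr0 mulr1 mulr1 mulrC.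
  by rewrite Sg0l mulr0 addr0.
- rewrite -(R n.+1 a am IH2) vvSS; congr (_ + _).
  rewrite IH1 // thS (_ : (2 * n.+1 + 1 = 2 * n + 3)%N); last by lia.
  by rewrite /sg; set y := _ ^+ (2 * n + 3); have y0 : y != 0 by [apply: expf_neq0]; field.
Qed.

Lemma sum_nbs_ord n (g : nat -> F) : (n <= m)%N ->
  \sum_(c <- nbs n) g c = \sum_(c < m.+1 | adj n c) g c.
Proof.
move=> nm; rewrite -(big_mkord (adj n)) -big_filter; apply: perm_big.
apply: uniq_perm; rewrite ?nbs_uniq ?filter_uniq ?iota_uniq // => c.
rewrite mem_filter mem_index_iota /= ltnS -[c \in nbs n]/(adj n c).
by case h: (adj n c) => //=; rewrite (adj_le nm h).
Qed.

Lemma lam_adj (g : nat -> F) :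
  \sum_(n < m.+1) lam n * \sum_(c <- nbs n) g c = delta * \sum_(n < m.+1) lam n * g n.
Proof.
have E (n : 'I_m.+1) : lam n * \sum_(c <- nbs n) g c = \sum_(c < m.+1 | adj n c) lam n * g c.
  by rewrite (sum_nbs_ord _ (leq_ord n)) mulr_sumr.
rewrite (eq_bigr _ (fun n _ => E n)) (exchange_big_dep xpredT) //= mulr_sumr.
apply: eq_bigr => c _; rewrite mulrA -(sum_lam_nbs (leq_ord c)) (sum_nbs_ord _ (leq_ord c)) mulr_suml.
by apply: eq_bigl => n; apply/idP/idP => /adj_sym; apply; apply: leq_ord.
Qed.

(** The adjacency matrix is symmetric with eigenvector [lam], so its a-th Chebyshev polynomial acts
    on [lam] by the value at [delta], which is [lam a]. *)
Lemma lam_vv a h : \sum_(n < m.+1) lam n * vv a n h = lam a * \sum_(n < m.+1) lam n * h n.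
Proof.
elim/nat_ind2: a => [||a IH1 IH2].
- by rewrite lam0 mul1r.
- by rewrite lam_adj lam1.
rewrite (eq_bigr (fun n : 'I_m.+1 => lam n * (\sum_(c <- nbs n) vv a.+1 c h) - lam n * vv a n h)).
  by rewrite sumrB lam_adj IH2 IH1 lamSS; ring.
by move=> n _; rewrite mulrBr.
Qed.

(** By [vv_sg] and the symmetry of S the summands are values of [vv a], and [lam_vv] sums them. In
    coordinates, this is the sliding property of the Kirby color. *)
Lemma Omega_full b a : (a <= m)%N -> \sum_(n < m.+1) lam n * (th b n * sg n a) =
  lam a * (th b a)^-1 * \sum_(n < m.+1) lam n * (lam n * th b n).
Proof.
move=> am; rewrite -mulrA mulrCA -(lam_vv a (fun x => lam x * th b x)) mulr_sumr; apply: eq_bigr => n _.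
rewrite (vv_sg b a (leq_ord n)) (sg_sym a); have := th_neq0 b a => t0.
by field; rewrite t0.
Qed.

(** Up to the denominator the squares are z^k + z^-k - 2 for a root of unity z other than 1 with
    z^(m+2) = 1; the two geometric sums over k = 1, ..., m + 1 are both -1. *)
Lemma sg_norm a : (a <= m)%N ->
  \sum_(n < m.+1) sg n a * sg n a = - (2 * m.+2%:R) / (A ^+ 2 - A ^- 2) ^+ 2.
Proof.
move=> am; pose z := A ^+ (4 * a.+1); have z0 : z != 0 by apply: expf_neq0.
have hz : (0 < a.+1 < m.+2)%N by lia.
have z1 := A_prim hz; have zr : z ^+ m.+2 = 1 by rewrite /z -exprM mulnAC exprM A_order expr1n.
have G (y : F) : y != 1 -> y ^+ m.+2 = 1 -> \sum_(n < m.+1) y ^+ n.+1 = -1.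
  move=> y1 yr; have := subrX1 y m.+2; rewrite yr subrr big_ord_recl expr0 => /esym/eqP.
  by rewrite mulf_eq0 subr_eq0 (negPf y1) addrC addr_eq0 => /eqP.
have zi1 : z^-1 != 1 by rewrite invr_eq1.
have zir : z^-1 ^+ m.+2 = 1 by rewrite exprVn zr invr1.
transitivity (\sum_(n < m.+1) (z ^+ n.+1 + z^-1 ^+ n.+1 - 2) / (A ^+ 2 - A ^- 2) ^+ 2).
  apply: eq_bigr => n _; rewrite /sg /Sg exprVn -exprM.
  have -> : (4 * a.+1 * n.+1 = 2 * (n.+1 * a.+1) * 2)%N by lia.
  rewrite (exprM A (2 * (n.+1 * a.+1)) 2); set X := A ^+ (2 * _); have X0 : X != 0 by apply: expf_neq0.
  have S : (-1) ^+ (n.+1 + a.+1) * (-1) ^+ (n.+1 + a.+1) = 1 :> F by rewrite -expr2 sqrr_sign.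
  have D0 := A2_neq0; rewrite mulrACA (mulrACA ((-1) ^+ _)) S mul1r -invfM -expr2; congr (_ / _).
  by field; rewrite X0.
rewrite -mulr_suml !big_split /= G // G // sumr_const card_ord; congr (_ / _).
by rewrite -mulr_natl -[m.+2]add1n natrD; ring.
Qed.

(** Solutions of a three-term recursion with different eigenvalues are orthogonal. Distinct labels
    would not do: for SO(3) the vertices a and m - a share an eigenvalue. *)
Lemma sg_orth a c : A ^+ (2 * a.+1) + A ^- (2 * a.+1) != A ^+ (2 * c.+1) + A ^- (2 * c.+1) ->
  \sum_(n < m.+1) (-1) ^+ (a + c) * (sg n a * sg n c) = 0.
Proof.
move=> ac; pose f (x k : nat) := A ^+ (2 * (k * x.+1)) - A ^- (2 * (k * x.+1)).
have fr x : f x m.+2 = 0.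
  have := Sg_top x.+1; rewrite /Sg (mulnC x.+1) -/(f x m.+2) => /eqP.
  by rewrite !mulf_eq0 signr_eq0 invr_eq0 (negPf A2_neq0) orbF => /eqP.
have f0 x : f x 0%N = 0 by rewrite /f mul0n expr0 invr1 subrr.
have frec x k : (A ^+ (2 * x.+1) + A ^- (2 * x.+1)) * f x k.+1 = f x k.+2 + f x k.
  rewrite /f; have -> : (2 * (k.+2 * x.+1) = 2 * (k * x.+1) + 2 * x.+1 + 2 * x.+1)%N by lia.
  have -> : (2 * (k.+1 * x.+1) = 2 * (k * x.+1) + 2 * x.+1)%N by lia.
  rewrite !exprD; set X := A ^+ (2 * x.+1); set Y := A ^+ (2 * (k * x.+1)).
  have X0 : X != 0 by apply: expf_neq0.
  have Y0 : Y != 0 by apply: expf_neq0.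
  by field; rewrite ?expf_neq0 ?A_neq0.
rewrite -mulr_sumr.
have -> : \sum_(n < m.+1) sg n a * sg n c = (-1) ^+ (a + c) / (A ^+ 2 - A ^- 2) ^+ 2 * \sum_(n < m.+1) f a n.+1 * f c n.+1.
  rewrite mulr_sumr; apply: eq_bigr => n _; rewrite /sg /Sg -/(f a n.+1) -/(f c n.+1).
  have sgn x : (-1) ^+ (n.+1 + x.+1) = (-1) ^+ n * (-1) ^+ x :> F.
    by rewrite addSn addnS !exprS exprD !mulN1r opprK.
  have S : (-1) ^+ n * (-1) ^+ n = 1 :> F by rewrite -expr2 sqrr_sign.
  have D0 := A2_neq0; rewrite !sgn exprD; set D := A ^+ 2 - A ^- 2 in D0 *.
  set e := (-1) ^+ n in S *; set e1 := (-1) ^+ a; set e2 := (-1) ^+ c.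
  transitivity (e * e * (e1 * e2 / D ^+ 2 * (f a n.+1 * f c n.+1))); last by rewrite S mul1r.
  by field.
suff -> : \sum_(n < m.+1) f a n.+1 * f c n.+1 = 0 by rewrite !mulr0.
(* A discrete Wronskian: it vanishes at both ends, and its increments are the products to be summed,
   times the difference of the eigenvalues. *)
pose w k := f a k.+1 * f c k - f a k * f c k.+1.
have : \sum_(n < m.+1) (w n.+1 - w n) = 0.
  rewrite -(big_mkord xpredT (fun n => w n.+1 - w n)) telescope_sumr // /w !fr !f0.
  by rewrite !mulr0 !mul0r !subrr.
rewrite (eq_bigr (fun n : 'I_m.+1 => (A ^+ (2 * a.+1) + A ^- (2 * a.+1) - (A ^+ (2 * c.+1) + A ^- (2 * c.+1))) * (f a n.+1 * f c n.+1))).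
  rewrite -mulr_sumr => /eqP; rewrite mulf_eq0 subr_eq0 (negPf ac) => /eqP //.
move=> n _; rewrite mulrBl mulrA frec [_ * (f a _ * _)]mulrCA frec /w; ring.
Qed.

(** * Colours and connectedness *)

Lemma drop_two (T : Type) (s1 s2 : seq T) x y : drop (size s1).+2 (s1 ++ [:: x, y & s2]) = s2.
Proof. by elim: s1 => //= ; rewrite drop0. Qed.

Lemma nth_two (T : Type) (a : T) (s1 s2 : seq T) x y :
  (nth a (s1 ++ [:: x, y & s2]) (size s1) = x) * (nth a (s1 ++ [:: x, y & s2]) (size s1).+1 = y).
Proof. by elim: s1. Qed.

Section Connectivity.
Variables (C : finType) (c : C).
Notation C2 := (C * bool)%type.
Notation lift := (map (map_slice (@proj C))).
Let one (c' : C) := nat_of_bool (c' == c).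
Implicit Types (t : seq (label C2)) (wt : word (label C2)).

Definition colours t := [seq z.1.2 | z <- t & z.1.1 == c].

Lemma colours_cat t t' : colours (t ++ t') = colours t ++ colours t'.
Proof. by rewrite /colours filter_cat map_cat. Qed.

Lemma colours2 (z z' : label C2) t :
  colours (z :: z' :: t) = colours [:: z] ++ colours [:: z'] ++ colours t.
Proof. by rewrite -!colours_cat. Qed.

Lemma colours1 (z : label C2) : colours [:: z] = if z.1.1 == c then [:: z.1.2] else [::].
Proof. by rewrite /colours /=; case: eqP. Qed.

Lemma K_colours t : K one (map (@proj C) t) = size (colours t).
Proof.
elim: t => // z t IH; rewrite map_cons K_cons IH /colours /= /one.
by case: eqP => _ //=.
Qed.

Definition occurs (b : bool) t wt := (b \in colours t) ||
  has (fun e : slice (label C2) => if e is Cup z _ then (z.1.1 == c) && (z.1.2 == b) else false) wt.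

(* Two strands of different colours are never joined, so the curves of both
   colours are closed separately. *)
Lemma loops_colours wt t n s (g : nat -> bool) : run t wt = Some [::] ->
  map g s = colours t -> (forall x, x \in s -> (x < n)%N) ->
  (forall x, ~~ odd (count_mem x s)) ->
  (occurs true t wt + occurs false t wt <=
     loops_from n s (cable_from one (map (@proj C) t) (lift wt)))%N.
Proof.
elim: wt t n s g => [|e wt IH] t n s g; first by case=> ->.
case/run_consP => r st rr gs sn sev.
have st' := step_proj st.
rewrite map_cons cable_cons st' odfltE.
case/stepP: st st' rr => [z d t1 t2 Et|z d t1 t2 Et|b x y t1 t2 Et] st' rr; subst t.
- have -> : cable_slice one (map (@proj C) (t1 ++ t2)) (map_slice (@proj C) (Cup (z, d) (size t1))) =
      cupn (one z.1) (size (colours t1)).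
    by have := cable_cup one (map (@proj C) t1) (map (@proj C) t2) z.1 d; rewrite size_map K_colours map_cat.
  move: gs; rewrite colours_cat => /map_cat_inv[s1 [s2 [Es g1 g2]]]; subst s.
  have sz : size s1 = size (colours t1) by rewrite -g1 size_map.
  have occE b : occurs b (t1 ++ t2) (Cup (z, d) (size t1) :: wt) =
      occurs b (t1 ++ [:: (z, d), (z, ~~ d) & t2]) wt.
    rewrite /occurs /= !colours_cat colours2 !colours1 /= !mem_cat; case: (z.1 == c) => //=.
    by rewrite !mem_seq1 [z.2 == b]eq_sym; case: (b == z.2); rewrite ?orbT //= !orbF.
  rewrite !occE /one; case zc : (z.1 == c); last first.
    rewrite /= ; apply: (IH _ _ _ g) => //.
    by rewrite colours_cat colours2 !colours1 /= zc map_cat g1 g2.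
  rewrite /cupn /= addn0 -sz take_size_cat // drop_size_cat //.
  (* [g] gives the colour of each arc name; the fresh name takes the colour of the cup. *)
  apply: (IH _ _ _ (fun x => if x == n then z.2 else g x)) => //.
  + have gE s0 : (forall x, x \in s0 -> (x < n)%N) -> map (fun x => if x == n then z.2 else g x) s0 = map g s0.
      by move=> H; apply/eq_in_map => x /H; rewrite ltn_neqAle => /andP[/negPf->].
    rewrite map_cat /= eqxx !gE ?g1 ?g2; last 2 first.
      by move=> x xs; apply: sn; rewrite mem_cat xs orbT.
      by move=> x xs; apply: sn; rewrite mem_cat xs.
    by rewrite colours_cat colours2 !colours1 /= zc.
  + move=> x; rewrite mem_cat !inE => /orP[xs|/orP[/eqP->|/orP[/eqP->|xs]]] //.
      by apply: leqW; apply: sn; rewrite mem_cat xs.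
    by apply: leqW; apply: sn; rewrite mem_cat xs orbT.
  + by move=> x; have := sev x; rewrite !count_cat /= !oddD !oddb addKb.
- have -> : cable_slice one (map (@proj C) (t1 ++ [:: (z, d), (z, ~~ d) & t2])) (map_slice (@proj C) (Cap (size t1))) =
      capn (one z.1) (size (colours t1)).
    have := cable_cap one (map (@proj C) t1) (map (@proj C) t2) (z.1, d) (z.1, ~~ d).
    by rewrite size_map K_colours map_cat.
  move: gs; rewrite colours_cat colours2 !colours1 /= /one; case zc : (z.1 == c); last first.
    move=> gs; rewrite /=; apply: leq_trans (IH _ _ _ g rr _ sn sev); last by rewrite colours_cat.
    by rewrite /occurs /= !colours_cat colours2 !colours1 /= zc.
  move=> /map_cat_inv[s1 [[|x [|y s2]] [Es g1]]] //= [gx gy g2]; subst s.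
  have sz : size s1 = size (colours t1) by rewrite -g1 size_map.
  rewrite /capn /= addn0 -sz take_size_cat // drop_two !nth_two.
  set s' := map _ _.
  have oldE w : w \in s1 ++ s2 -> w \in s1 ++ [:: x, y & s2].
    by rewrite !mem_cat !inE => /orP[->|->]; rewrite ?orbT.
  have ce w : odd (count_mem w (s1 ++ s2)) = (x == w) (+) (y == w).
    have := sev w; rewrite !count_cat /= !oddD !oddb.
    by case: (x == w); case: (y == w); case: (odd _); case: (odd _).
  have gs' : map g s' = colours (t1 ++ t2).
    rewrite /s' -map_comp colours_cat -g1 -g2 -map_cat; apply: eq_map => w /=.
    by case: eqP => // ->; rewrite gx gy.
  have := IH _ n s' g rr gs'; rewrite -/(one _).
  have b1 w : w \in s' -> (w < n)%N.
    case/mapP => w' w's ->; case: eqP => _; apply: sn; last exact: oldE.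
    by rewrite mem_cat !inE eqxx !orbT.
  move=> /(_ b1) {}IH.
  have ev w : ~~ odd (count_mem w s').
    rewrite /s' count_map; have [xy|xy] := eqVneq x y.
      rewrite (eq_count (a2 := pred1 w)); first by rewrite ce xy addbb.
      by move=> w' /=; case: (eqVneq w' x) => // ->; rewrite xy.
    have [wx|wx] := eqVneq w x.
      rewrite (eq_count (a2 := pred0)) ?count_pred0 // => w' /=; rewrite wx.
      by case: (eqVneq w' x) => [_|/negPf->] //; rewrite eq_sym (negPf xy).
    have [wy|wy] := eqVneq w y.
      have E : count (preim (fun w0 => if w0 == x then y else w0) (pred1 w)) (s1 ++ s2) =
          (count_mem x (s1 ++ s2) + count_mem y (s1 ++ s2))%N.
        rewrite -count_predUI [X in (_ + X)%N](eq_count (a2 := pred0)) ?count_pred0 ?addn0.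
          by apply: eq_count => w' /=; rewrite wy; case: (eqVneq w' x) => //=; rewrite eqxx.
        by move=> w' /=; case: (eqVneq w' x) => [->|] //=; rewrite (negPf xy).
      by rewrite E oddD !ce !eqxx [y == x]eq_sym (negPf xy).
    rewrite (eq_count (a2 := pred1 w)); first by rewrite ce ![_ == w]eq_sym (negPf wx) (negPf wy).
    by move=> w' /=; case: (eqVneq w' x) => // ->; rewrite ![_ == w]eq_sym (negPf wx) (negPf wy).
  move: (IH ev); rewrite -/s'.
  have occE b : occurs b (t1 ++ [:: (z, d), (z, ~~ d) & t2]) (Cap (size t1) :: wt) =
      (b == z.2) || occurs b (t1 ++ t2) wt.
    rewrite /occurs /= !colours_cat colours2 !colours1 /= zc !mem_cat !inE.
    by case: (b == z.2); rewrite ?orbT.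
  (* When the cap joins two arcs with different names, x still occurs elsewhere on the line by
     parity, so its colour is not lost and no closed curve need be counted. *)
  have zocc : x != y -> occurs z.2 (t1 ++ t2) wt.
    move=> xy; rewrite /occurs -gs' -gx; have : odd (count_mem x (s1 ++ s2)).
      by rewrite ce eqxx [y == x]eq_sym (negPf xy).
    case E : (count_mem x (s1 ++ s2)) => [|k0] // _.
    have xs : x \in s1 ++ s2 by rewrite -has_pred1 has_count E.
    apply/orP; left; rewrite gx -gy map_f //; apply/mapP; exists x; rewrite ?eqxx //.
  rewrite !occE; have [xy|xy] := eqVneq x y; last first.
    rewrite add0n => h; apply: leq_trans h.
    by have := zocc xy; case: (z.2) => /= ->.
  move=> h; rewrite -(leq_add2l 1) in h; apply: leq_trans h.
  by case: (z.2) => /=; case: (occurs true _ _); case: (occurs false _ _).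
- have -> : cable_slice one (map (@proj C) (t1 ++ [:: x, y & t2])) (map_slice (@proj C) (Cross b (size t1))) =
      X b (one x.1.1) (one y.1.1) (size (colours t1)).
    have := cable_cross b one (map (@proj C) t1) (map (@proj C) t2) (proj x) (proj y).
    by rewrite size_map K_colours map_cat.
  have occE b' : occurs b' (t1 ++ [:: x, y & t2]) (Cross b (size t1) :: wt) =
      occurs b' (t1 ++ [:: y, x & t2]) wt.
    rewrite /occurs /= !colours_cat !colours2 !mem_cat.
    by case: (b' \in colours [:: x]); case: (b' \in colours [:: y]); rewrite ?orbT.
  rewrite !occE.
  have [two|ntwo] := boolP ((x.1.1 == c) && (y.1.1 == c)); last first.
    have -> : X b (one x.1.1) (one y.1.1) (size (colours t1)) = [::].
      by move: ntwo; rewrite /one; case: (x.1.1 == c); case: (y.1.1 == c).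
    apply: (IH _ _ _ g) => //; rewrite gs !colours_cat !colours2 !colours1.
    by move: ntwo; case: (x.1.1 == c); case: (y.1.1 == c).
  case/andP: two => xc yc; rewrite /one xc yc /X /= !addn0.
  move: gs; rewrite colours_cat colours2 !colours1 xc yc /=.
  move=> /map_cat_inv[s1 [[|x' [|y' s2]] [Es g1]]] //= [gx gy g2]; subst s.
  have sz : size s1 = size (colours t1) by rewrite -g1 size_map.
  rewrite -sz take_size_cat // drop_two !nth_two.
  apply: (IH _ _ _ g) => //.
  + by rewrite map_cat /= gx gy g1 g2 colours_cat colours2 !colours1 xc yc.
  + move=> w; rewrite mem_cat !inE => h; apply: sn; rewrite mem_cat !inE.
    by case/orP: h => [->|/or3P[->|->|->]]; rewrite ?orbT.
  + move=> w; have := sev w; rewrite !count_cat /= !oddD !oddb.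
    by case: (x' == w); case: (y' == w).
Qed.

(** If both colours occurred, [loops_colours] would find at least two closed curves. *)
Lemma knot_conn w : loops (cable one w) == 1%N -> conn c w.
Proof.
move=> l1 wt lw rw ht; apply/negPn/negP => na.
have := @loops_colours wt [::] 0 [::] (fun=> true) rw erefl (fun x (h : x \in [::]) => False_ind _ (notF h)) (fun=> isT).
rewrite lw -/(cable one w) -/(loops _) (eqP l1) /occurs /=.
have -> : has (fun e : slice (label C2) => if e is Cup z _ then (z.1.1 == c) && (z.1.2 == true) else false) wt.
  by apply: sub_has ht => -[z p|//|//] /=; rewrite eqb_id.
suff -> : has (fun e : slice (label C2) => if e is Cup z _ then (z.1.1 == c) && (z.1.2 == false) else false) wt by [].
move: na; rewrite /allt -has_predC; apply: sub_has => -[z p|//|//] /=.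
by rewrite negb_imply eqbF_neg.
Qed.
End Connectivity.

(** * Circles, kinks and twists *)

Lemma size_chbE n : size (chb n) = n.+1.
Proof.
elim/nat_ind2: n => [||n IH1 IH2]; rewrite ?size_poly1 ?size_polyX // chbSS.
have nz : chb n.+1 != 0 by rewrite -size_poly_eq0 IH2.
by rewrite mulrC size_polyDl size_mulX // IH2 // size_polyN IH1.
Qed.

Lemma msum_comp (C : finType) (c0 : C) a B P P' G G' : (forall c, c != c0 -> P c = P' c) ->
  (forall k, pev B.+1 (P c0) (fun j => G (upd k c0 j)) =
     a * pev B.+1 (P' c0) (fun j => G' (upd k c0 j))) ->
  msum B.+1 P G = a * msum B.+1 P' G'.
Proof.
move=> Pe H; rewrite !(msumE c0) mulr_sumr; apply: eq_bigr => k _.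
rewrite mulrCA; congr (_ * _); last exact: H.
by apply: eq_bigr => c /Pe ->.
Qed.

Lemma msum_int (C : finType) (c : C) B P G (G' : (C -> nat) -> F) :
  (forall k j, G' (upd k c j) = G' k) ->
  (forall k, pev B.+1 (P c) (fun j => G (upd k c j)) = G' k) ->
  msum B.+1 P G = msum B.+1 (fun c' => if c' == c then 1 else P c') G'.
Proof.
move=> G1 H; rewrite -[RHS]mul1r; apply: (@msum_comp _ c) => [c' /negPf->//|k].
by rewrite H eqxx pev1 G1 mul1r.
Qed.

(** Naturality of the braiding moves a word from the middle of the line to its left end, where
    eigenvalues are known. *)
Lemma sh_conj o n x : wf n x -> outs n x = n ->
  sh o x =~ X true o n 0 ++ x ++ X false n o 0.
Proof.
move=> wx ox; have := natr true o 0 wx; rewrite ox add0n sh0 => H.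
by rewrite catA -H -catA X_inv cats0.
Qed.

Lemma eqv_ops x y w g s : x =~ y -> wf (size s) x -> wf (size s) y -> path adj 0%N s ->
  ops 0 (x ++ w) g s = ops 0 (y ++ w) g s.
Proof. by move=> E wx wy ps; rewrite !ops_cat; apply: eqv_wf. Qed.

Section Insertion.
Variables (C : finType) (u v : word (label C)) (s1 ls s2 : seq (label C)).
Let s := s1 ++ ls ++ s2.
Hypotheses (ru : run [::] u = Some s) (rv : run s v = Some [::]).
Implicit Types k : C -> nat.

(* The diagram with a diagonal operator placed on the strands [ls], once they
   have been pulled to the left of [s1]. *)
Definition insertion k (h : nat -> F) : F :=
  ops 0 (cable_from k [::] u ++ X true (K k s1) (K k ls) 0)
    (fun r => h (vx r (K k ls)) *
       ops 0 (X false (K k ls) (K k s1) 0 ++ cable_from k s v) (fun=> 1) r) [::].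

Lemma insertion_wf k : wf 0 (cable_from k [::] u ++ X true (K k s1) (K k ls) 0) /\
  outs 0 (cable_from k [::] u ++ X true (K k s1) (K k ls) 0) = K k s.
Proof.
have [w1 o1] := cable_wf k ru; have E : K k [::] = 0%N by [].
rewrite E in w1 o1; rewrite wf_cat outs_cat w1 o1 outs_X wf_X //.
by rewrite /s !K_cat; lia.
Qed.

Lemma insertion_ext k h h' : (forall x, (x <= m)%N -> h x = h' x) -> insertion k h = insertion k h'.
Proof.
move=> H; apply: ops_ext_wf => //; first by have [] := insertion_wf k.
by move=> r pr_ _ _; rewrite H // vx_le.
Qed.

Lemma insertion_sum k (I : finType) (Q : pred I) (c : I -> F) (h : I -> nat -> F) :
  insertion k (fun x => \sum_(i | Q i) c i * h i x) = \sum_(i | Q i) c i * insertion k (h i).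
Proof.
rewrite /insertion; under [RHS]eq_bigr do rewrite -opsZ; rewrite -ops_sum.
congr (ops _ _ _ _); apply: funext => r; rewrite mulr_suml.
by apply: eq_bigr => i _; rewrite mulrA.
Qed.

Lemma insertionZ k c h : insertion k (fun x => c * h x) = c * insertion k h.
Proof.
by rewrite /insertion -opsZ; congr (ops _ _ _ _); apply: funext => r; rewrite mulrA.
Qed.

Lemma cval_insert k z x h : run s z = Some s -> cable_from k s z =~ sh (K k s1) x ->
  wf (K k ls) x -> outs (K k ls) x = K k ls ->
  (forall r g, path adj 0%N r -> (K k ls <= size r)%N ->
     ops 0 x g r = h (vx r (K k ls)) * g r) ->
  cval k (u ++ z ++ v) = insertion k h.
Proof.
move=> rz E wx ox H; rewrite /cval /cable (cable_cat _ _ ru) (cable_cat _ _ rz) ops_cat.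
rewrite /insertion [in RHS]ops_cat; have [wu ou] := cable_wf k ru.
apply: ops_ext_wf => // r pr_; rewrite ou => sr _.
have [wz oz] := cable_wf k rz.
have Ks : K k s = (K k s1 + K k ls + K k s2)%N by rewrite /s !K_cat addnA.
have wl : wf (size r) (X true (K k s1) (K k ls) 0) by rewrite wf_X // sr Ks; lia.
have [wx' ox'] := wf_weak (K k s1 + K k s2) wx.
have sE : size r = (K k ls + (K k s1 + K k s2))%N by rewrite sr Ks; lia.
rewrite (@eqv_ops _ (X true (K k s1) (K k ls) 0 ++ x ++ X false (K k ls) (K k s1) 0)) //.
- rewrite -!catA !ops_cat; apply: ops_ext_wf => // t pt; rewrite outs_X => st _.
  by rewrite H // st sE; lia.
- by rewrite E (sh_conj _ wx ox).
- by rewrite sr.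
- by rewrite !wf_cat wl outs_X sE wx' ox' ox wf_X //; lia.
Qed.

Lemma insertion1 k : insertion k (fun=> 1) = cval k (u ++ v).
Proof.
by rewrite -(@cval_insert k [::] [::]) // => r g _ _; rewrite mul1r.
Qed.
End Insertion.

Lemma lift_crosses (C : finType) (b : bool) (l : seq nat) (w : word (label (C * bool)%type)) :
  map (map_slice (@proj C)) w = [seq Cross b i | i <- l] -> w = [seq Cross b i | i <- l].
Proof.
elim: l w => [|i l IH] [|[z p|p|b' p] w] //= [-> ->] /IH ->.
by [].
Qed.

Section ConnTransfer.
Variables (C : finType) (c : C).
Notation lift := (map (map_slice (@proj C))).

(** Every lift of the shorter diagram extends over z without changing the line, so a lift with both
    colours would give one of the longer diagram. *)
Lemma conn_remove (u z v : word (label C)) :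
  (forall ut t, lift ut = u -> run [::] ut = Some t -> exists2 zt, lift zt = z & run t zt = Some t) ->
  conn c (u ++ z ++ v) -> conn c (u ++ v).
Proof.
move=> H cn wt /map_cat_inv[ut [vt [E lu lv]]] rw; subst wt.
have [t rt rv] := run_catP rw; have [zt lz rz] := H ut t lu rt.
have := cn (ut ++ zt ++ vt); rewrite !map_cat lu lz lv !run_cat rt /= run_cat rz /= rv.
move=> /(_ erefl erefl); rewrite /hast /allt !has_cat !all_cat => {}H.
by case/orP => h; have := H; rewrite h ?orbT => /(_ isT)/and3P[-> _ ->].
Qed.

Lemma conn_kinks (u v : word (label C)) s1 c' d s2 f :
  run [::] u = Some (s1 ++ (c', d) :: s2) ->
  conn c (u ++ kinks (c', d) f (size s1) ++ v) -> conn c (u ++ v).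
Proof.
move=> ru; apply: conn_remove => ut t lu rt.
have := run_proj rt; rewrite lu ru => -[] /esym/map_cat_inv[t1 [[|[[c1 b] d1] t2] [Et E1]]] //= [Ec Ed _].
subst t; exists (kinks ((c1, b), d1) f (size s1)).
  by rewrite /kinks map_flatten map_nseq -Ec -Ed.
by have [R _] := run_kinks f t1 (c1, b) d1 t2 (fun=> 0%N); rewrite -E1 size_map R.
Qed.

Lemma conn_circle (u v : word (label C)) s1 ls s2 c' f :
  run [::] u = Some (s1 ++ ls ++ s2) ->
  conn c (u ++ circle c' f (size s1) (size ls) ++ v) -> conn c (u ++ v).
Proof.
move=> ru; apply: conn_remove => ut t lu rt.
have := run_proj rt; rewrite lu ru => -[] /esym/map_cat_inv[t1 [t' [Et E1]]].
move=> /map_cat_inv[t2 [t3 [Et' E2 _]]]; subst t t'.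
exists (circle (c', false) f (size s1) (size ls)).
  rewrite /circle /= !map_cat -!map_comp /kinks map_flatten map_nseq.
  by congr (_ :: _ ++ _ ++ _ ++ _).
by have [] := run_circle (c', false) f t1 t2 t3 (fun=> 0%N); rewrite -E1 -E2 !size_map.
Qed.

(** The added crossings contain no cup and bring the strand back to its place, so lifts of the new
    diagram restrict to lifts of the old one with the same colours. *)
Lemma conn_pull (u v : word (label C)) s1 x s2 :
  run [::] u = Some (s1 ++ x :: s2) -> conn c (u ++ v) ->
  conn c ((u ++ [seq Cross true (0 + i)%N | i <- rev (iota 0 (size s1))]) ++
          ([seq Cross false (0 + i)%N | i <- iota 0 (size s1)] ++ v)).
Proof.
move=> ru cn wt /map_cat_inv[w1 [w2 [E]]]; subst wt.
move=> /map_cat_inv[ut [lt [E lu ll]]] /map_cat_inv[rt [vt [E' lr lv]]]; subst w1 w2.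
rewrite (_ : [seq Cross true (0 + i)%N | i <- _] = [seq Cross true i | i <- rev (iota 0 (size s1))]) // in ll.
rewrite (_ : [seq Cross false (0 + i)%N | i <- _] = [seq Cross false i | i <- iota 0 (size s1)]) // in lr.
have El := lift_crosses ll; have Er := lift_crosses lr; subst lt rt.
rewrite -catA; case/run_catP => t r1 r2.
have := run_proj r1; rewrite lu ru => -[] /esym/map_cat_inv[t1 [[|y t2] [Et E1]]] //= _.
have [R1 _] := run_left true [::] t1 y t2 (fun=> 0%N).
have [R2 _] := run_right false [::] t1 y t2 (fun=> 0%N).
have sz : size t1 = size s1 by rewrite -E1 size_map.
rewrite /= sz in R1 R2; rewrite Et !run_cat in r2.
rewrite (_ : [seq Cross true (0 + i)%N | i <- _] = [seq Cross true i | i <- rev (iota 0 (size s1))]) // in R1.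
rewrite (_ : [seq Cross false (0 + i)%N | i <- _] = [seq Cross false i | i <- iota 0 (size s1)]) // in R2.
rewrite R1 /= run_cat R2 /= -Et in r2.
have := cn (ut ++ vt); rewrite map_cat lu lv run_cat r1 /= r2 => /(_ erefl erefl).
have nh b l : hast c (map (@Cross (label (C * bool)%type) b) l) = false.
  by rewrite /hast has_map; apply/hasP => -[].
have na b l : allt c (map (@Cross (label (C * bool)%type) b) l) = true.
  by rewrite /allt all_map; apply/allP.
rewrite /hast /allt in nh na *; rewrite !has_cat !all_cat !nh !na /=; exact.
Qed.
End ConnTransfer.

Section Coloured.
Variables (C : finType) (c0 : C) (d0 : bool) (u v : word (label C)) (s1 s2 : seq (label C)).
Let s := s1 ++ [:: (c0, d0)] ++ s2.
Hypotheses (ru : run [::] u = Some s) (rv : run s v = Some [::]) (uv : conn c0 (u ++ v)).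

(** Once its strand is pulled to the left end, the line starts with [c0], as [diag_insert] requires,
    and [conn_pull] keeps the component connected. *)
Lemma insertion_walks k : exists y : nat -> F, forall q h,
  insertion u v s1 [:: (c0, d0)] s2 (upd k c0 q) h = walks q 0 (fun b => h b * y b).
Proof.
have [L1 L2] : run s [seq Cross true (0 + i)%N | i <- rev (iota 0 (size s1))] = Some ((c0, d0) :: s1 ++ s2) /\
    forall k, cable_from k s [seq Cross true (0 + i)%N | i <- rev (iota 0 (size s1))] =~ X true (K k s1) (k c0) 0.
  split=> [|k']; first by have [] := run_left true [::] s1 (c0, d0) s2 k.
  by have [] := run_left true [::] s1 (c0, d0) s2 k'.
have [R1 R2] : run ((c0, d0) :: s1 ++ s2) [seq Cross false (0 + i)%N | i <- iota 0 (size s1)] = Some s /\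
    forall k, cable_from k ((c0, d0) :: s1 ++ s2) [seq Cross false (0 + i)%N | i <- iota 0 (size s1)] = X false (k c0) (K k s1) 0.
  split=> [|k']; first by have [] := run_right false [::] s1 (c0, d0) s2 k.
  by have [] := run_right false [::] s1 (c0, d0) s2 k'.
set lw := [seq _ | i <- rev _] in L1 L2; set rw := [seq _ | i <- iota _ _] in R1 R2.
have ru' : run [::] (u ++ lw) = Some ((c0, d0) :: s1 ++ s2) by rewrite run_cat ru.
have rv' : run ((c0, d0) :: s1 ++ s2) (rw ++ v) = Some [::] by rewrite run_cat R1.
have cn : conn c0 ((u ++ lw) ++ (rw ++ v)) by apply: conn_pull ru uv.
have [y H] := diag_insert k ru' rv' cn; exists y => q h; rewrite -H /Phi /insertion.
set k' := upd k c0 q; have Kl : K k' [:: (c0, d0)] = q by rewrite /K /= /k' /upd eqxx addn0.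
have kq : k' c0 = q by rewrite /k' /upd eqxx.
rewrite Kl (cable_cat _ _ ru) (cable_cat _ _ R1) R2 kq !ops_cat.
have [wu ou] := cable_wf k' ru; apply: ops_ext_wf => // r pr_; rewrite ou => sr _.
have [wl _] := cable_wf k' L1.
apply: eqv_wf => //; rewrite ?sr //; last by rewrite wf_X // !K_cat Kl; lia.
by rewrite L2 kq.
Qed.

(** The same weights y serve for h and for the constant 1, and by [vv0] the Chebyshev polynomial
    reads both at the vertex n. *)
Lemma pev_insertion k n B h : (n <= m)%N -> (n < B)%N ->
  pev B (chb n) (fun q => insertion u v s1 [:: (c0, d0)] s2 (upd k c0 q) h) =
  h n * pev B (chb n) (fun q => cval (upd k c0 q) (u ++ v)).
Proof.
move=> nm nB; have [y H] := insertion_walks k.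
transitivity (pev B (chb n) (fun q => walks q 0 (fun b => h b * y b))).
  by apply: eq_bigr => q _; rewrite H.
rewrite pev_chb // vv0 //; congr (_ * _).
transitivity (pev B (chb n) (fun q => walks q 0 (fun b => 1 * y b))).
  by rewrite pev_chb // vv0 // mul1r.
by apply: eq_bigr => q _; rewrite -H insertion1.
Qed.

Definition thf (f : int) (x : nat) : F := th (0 <= f) x ^+ `|f|%N.

Lemma kinkw_diag f q r g : path adj 0%N r -> (q <= size r)%N ->
  ops 0 (kinkw f q 0) g r = thf f (vx r q) * g r.
Proof.
move=> pr_ qr; rewrite /kinkw /thf; elim: `|f|%N => [|n IH]; first by rewrite mul1r.
by rewrite -[flatten _]/(curlR (0 <= f) q 0 ++ flatten (nseq n (curlR (0 <= f) q 0)))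
  ops_cat curl_diag // IH exprS mulrA.
Qed.

Lemma kinkw_wf f q : wf q (kinkw f q 0) /\ outs q (kinkw f q 0) = q.
Proof.
have wc : wf q (curlR (0 <= f) q 0) by apply: wf_curlR.
rewrite /kinkw; elim: `|f|%N => // n [IH1 IH2].
rewrite -[flatten _]/(curlR (0 <= f) q 0 ++ flatten (nseq n (curlR (0 <= f) q 0))).
by rewrite wf_cat outs_cat outs_curlR wc IH1 IH2.
Qed.

Lemma sh_kinkw o f q : sh o (kinkw f q 0) = kinkw f q o.
Proof.
rewrite /kinkw /sh map_flatten map_nseq; congr (flatten (nseq _ _)).
by rewrite -/(sh o _) sh_curlR addn0.
Qed.

Lemma SB_kinks f P n : P c0 = chb n -> (n <= m)%N ->
  SB P (u ++ kinks (c0, d0) f (size s1) ++ v) = thf f n * SB P (u ++ v).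
Proof.
move=> Pn nm; apply: (@SB_comp _ _ _ _ _ c0) => // k B sz _.
rewrite Pn size_chbE in sz *; rewrite -pev_insertion //.
apply: eq_bigr => q _; congr (_ * _).
have [Rk Ek] := run_kinks f s1 c0 d0 s2 (upd k c0 q).
have Kl : K (upd k c0 q) [:: (c0, d0)] = q by rewrite /K /= /upd eqxx addn0.
have [w1 o1] := kinkw_wf f q.
apply: (@cval_insert C u v s1 [:: (c0, d0)] s2 ru (upd k c0 q) _ (kinkw f q 0) (thf f) Rk); rewrite ?Kl //.
  by rewrite /= Ek sh_kinkw {1}/upd eqxx.
by move=> r g *; apply: kinkw_diag.
Qed.
End Coloured.

Lemma msumZ (C : finType) B (P : C -> {poly F}) a G : msum B P (fun k => a * G k) = a * msum B P G.
Proof. by rewrite /msum mulr_sumr; apply: eq_bigr => k _; rewrite mulrCA. Qed.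

Lemma msum_sum (C I : finType) B (P : C -> {poly F}) (c : I -> F) G :
  msum B P (fun k => \sum_i c i * G i k) = \sum_i c i * msum B P (G i).
Proof.
under [RHS]eq_bigr do rewrite mulr_sumr.
rewrite exchange_big; apply: eq_bigr => k _ /=; rewrite mulr_sumr.
by apply: eq_bigr => i _; rewrite mulrCA.
Qed.

Lemma msum_ext (C : finType) B (P P' : C -> {poly F}) G G' : P =1 P' -> G =1 G' ->
  msum B P G = msum B P' G'.
Proof.
move=> PP GG; apply: eq_bigr => k _; rewrite GG; congr (_ * _).
by apply: eq_bigr => c _; rewrite PP.
Qed.

Lemma th_neg b x : th (~~ b) x = (th b x)^-1.
Proof.
by rewrite /th Ab_neg exprVn invfM; congr (_ * _); rewrite -exprVn invrN1.
Qed.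

Lemma wf_circ1 k n : wf n (circ1 k n) /\ outs n (circ1 k n) = n.
Proof.
have wc : wf n (cupn k n) by rewrite wf_cupn.
have oc : outs n (cupn k n) = (n + k + k)%N by rewrite outs_cupn; lia.
have w1 : wf (n + k + k) (X true n k 0) by rewrite wf_X //; lia.
have w2 : wf (n + k + k) (X true k n 0) by rewrite wf_X //; lia.
have w3 : wf (n + k + k) (curlR true k n) by apply: wf_curlR; lia.
have w4 : wf (n + k + k) (capn k n) by rewrite wf_capn //; lia.
rewrite /circ1 !wf_cat !outs_cat wc oc w1 !outs_X w2 outs_curlR w3 w4 outs_capn; split=> //.
by lia.
Qed.

Section Absent.
Variables (C : finType) (c : C).
Implicit Types (k : C -> nat) (w : word (label C)).

Definition absent w := all (fun e : slice (label C) => if e is Cup z _ then z.1 != c else true) w.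
Let off s := all (fun z : label C => z.1 != c) s.

Lemma K_absent k j s : off s -> K (upd k c j) s = K k s.
Proof.
elim: s => // z s IH /= /andP[zc /IH]; rewrite !K_cons => ->.
by rewrite /upd (negPf zc).
Qed.

Lemma cable_absent k j w s s' : absent w -> off s -> run s w = Some s' ->
  off s' /\ cable_from (upd k c j) s w = cable_from k s w.
Proof.
elim: w s => [|e w IH] s /=; first by move=> _ os [<-].
case/andP => ec aw os /run_consP[t st rt].
have [ot Ee] : off t /\ cable_slice (upd k c j) s e = cable_slice k s e.
  case/stepP: st ec os => [c1 d t1 t2 ->|c1 d t1 t2 ->|b x y t1 t2 ->] ec; rewrite /off !all_cat.
  - by case/andP => o1 o2; rewrite !cable_cup /= o1 o2 ec K_absent // /upd (negPf ec).
  - rewrite !cable_cap; case/andP => o1 /= /and3P[h _ o2].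
    by rewrite o1 o2 K_absent // /upd (negPf h).
  - rewrite !cable_cross; case/andP => o1 /= /and3P[hx hy o2].
    by rewrite o1 o2 hx hy K_absent // /upd (negPf hx) (negPf hy).
have [os' Et] := IH t aw ot rt.
by rewrite st Ee Et.
Qed.

Lemma absent_cat w w' : absent (w ++ w') = absent w && absent w'.
Proof. exact: all_cat. Qed.
End Absent.

Lemma absent_relabel (C C' : finType) (g : C -> C') c (w : word (label C)) :
  (forall x, g x != c) -> absent c (relabel g w).
Proof. by move=> gc; rewrite /absent /relabel all_map; elim: w => // -[z p|p|b p] w IH /=; rewrite ?gc IH. Qed.

Section Circle.
Variables (C : finType) (u v : word (label C)) (s1 ls s2 : seq (label C)).
Let s := s1 ++ ls ++ s2.
Hypotheses (ru : run [::] u = Some s) (rv : run s v = Some [::]).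
Variables (c : C) (au : absent c u) (av : absent c v).

Lemma off_s : all (fun z : label C => z.1 != c) s.
Proof. by have [] := cable_absent (fun=> 0%N) 0 au (isT : all _ [::]) ru. Qed.

(** Once the circle is replaced by its eigenvalues its own multiplicity has disappeared from the
    diagram, and can be summed out. *)
Lemma insertion_absent k j h : insertion u v s1 ls s2 (upd k c j) h = insertion u v s1 ls s2 k h.
Proof.
have := off_s; rewrite /s !all_cat => /and3P[o1 ol o2].
rewrite /insertion !(@K_absent _ c) //.
have [_ ->] := cable_absent k j au (isT : all _ [::]) ru.
by have [_ ->] := cable_absent k j av off_s rv.
Qed.

Let merid f := u ++ circle c f (size s1) (size ls) ++ v.

Lemma SB_circle_framing f f' P n : P c = chb n -> (n <= m)%N -> conn c (merid f) ->
  thf f' n * SB P (merid f) = thf f n * SB P (merid f').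
Proof.
move=> Pn nm cn; have [Rh _] := run_circle_head c s1 ls s2 (fun=> 0%N).
have [Rc _] := run_cap c (s1 ++ ls) s2 (fun=> 0%N).
have ru' : run [::] (u ++ circle_head c (size s1) (size ls)) =
    Some ((s1 ++ ls) ++ [:: (c, true)] ++ (c, false) :: s2) by rewrite run_cat ru /= Rh.
have rv' : run ((s1 ++ ls) ++ [:: (c, true)] ++ (c, false) :: s2)
    ([:: Cap (size s1 + size ls)%N] ++ v) = Some [::].
  by rewrite run_cat -size_cat Rc /= -catA.
have E f1 : merid f1 = (u ++ circle_head c (size s1) (size ls)) ++
    kinks (c, true) f1 (size (s1 ++ ls)) ++ ([:: Cap (size s1 + size ls)%N] ++ v).
  by rewrite /merid circleE size_cat -!catA.
have cn' : conn c ((u ++ circle_head c (size s1) (size ls)) ++ ([:: Cap (size s1 + size ls)%N] ++ v)).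
  by apply: (conn_kinks (f := f) ru'); rewrite -E.
by rewrite !E !(SB_kinks ru' rv' cn' _ Pn nm) mulrCA.
Qed.

Lemma thf1 n : thf 1 n = th true n. Proof. by rewrite /thf expr1. Qed.

(** The framing is first brought to +1, where [circ1_diag] gives the eigenvalues of the cables of
    the circle; [vv_sg] evaluates their Chebyshev combination. *)
Lemma SB_circle f P n B : P c = chb n -> (n <= m)%N -> conn c (merid f) ->
  (forall c', (size (P c') <= B.+1)%N) ->
  SB P (merid f) = msum B.+1 (fun c' => if c' == c then 1 else P c')
    (fun k => insertion u v s1 ls s2 k (fun x => thf f n * sg n x / lam x)).
Proof.
move=> Pn nm cn szP; have t0 : th true n != 0 := th_neq0 _ _.
have := SB_circle_framing 1 Pn nm cn; rewrite thf1 => H.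
have {H} -> : SB P (merid f) = thf f n / th true n * SB P (merid 1).
  by rewrite mulrAC -H mulrAC mulfV // mul1r.
have nB : (n < B.+1)%N by have := szP c; rewrite Pn size_chbE.
rewrite (SBE _ szP) (@msum_int _ c _ _ _ (fun k => insertion u v s1 ls s2 k (fun x => th true n * sg n x / lam x))).
- rewrite -msumZ; apply: msum_ext => // k; rewrite -insertionZ.
  by apply: (@insertion_ext C u v s1 ls s2 ru) => x xm; field; rewrite t0 lam_neq0.
- by move=> k j; apply: insertion_absent.
move=> k; have [R1 _] := run_circle c 1 s1 ls s2 (fun=> 0%N).
have := off_s; rewrite /s !all_cat => /and3P[o1 ol o2].
pose hj j x := (lam x * th true x)^-1 * walks j x (fun b => lam b * th true b).
transitivity (\sum_(j < B.+1) (P c)`_j * insertion u v s1 ls s2 k (hj j)).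
  apply: eq_bigr => j _; rewrite -(insertion_absent k j); congr (_ * _).
  have kc : upd k c j c = j by rewrite /upd eqxx.
  have [w1 o1'] := wf_circ1 j (K (upd k c j) ls).
  apply: (@cval_insert C u v s1 ls s2 ru (upd k c j) _ (circ1 j (K (upd k c j) ls)) (hj j) R1) => //.
    by have := run_circle1 c s1 ls s2 (upd k c j); rewrite kc.
  by move=> r g pr_ hr; rewrite circ1_diag.
rewrite -insertion_sum; apply: (@insertion_ext C u v s1 ls s2 ru) => x xm.
transitivity ((lam x * th true x)^-1 * pev B.+1 (chb n) (fun j => walks j x (fun b => lam b * th true b))).
  by rewrite /pev mulr_sumr Pn; apply: eq_bigr => j _; rewrite mulrCA.
rewrite pev_chb // vv_sg //; have tx : th true x != 0 := th_neq0 _ _.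
by field; rewrite tx lam_neq0.
Qed.

(** The Gauss sum hypothesis on w says that, up to [cb], the coloured circle has the eigenvalues of
    a full twist of the opposite sign. *)
Lemma SB_Omega (b : bool) (w : nat -> F) cb P ls' : size ls' = size ls ->
  P c = \sum_(n < m.+1) w n *: chb n ->
  (forall x, (x <= m)%N -> \sum_(n < m.+1) w n * (th b n * sg n x / lam x) = cb * (th b x)^-1) ->
  conn c (merid (if b then 1 else -1)) ->
  run s (full_twist (~~ b) (size s1) ls') = Some s ->
  SB P (merid (if b then 1 else -1)) =
  cb * SB (fun c' => if c' == c then 1 else P c') (u ++ full_twist (~~ b) (size s1) ls' ++ v).
Proof.
move=> sls PO H cn rt; have thfb n : thf (if b then 1 else -1) n = th b n.
  by rewrite /thf; case: (b); rewrite expr1.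
rewrite (SB_lin _ (Q := xpredT) (a := fun n : 'I_m.+1 => w n) (p := fun n : 'I_m.+1 => chb n) PO).
pose B := (m + \max_c' size (P c'))%N.
have szP c' : (size (P c') <= B.+1)%N.
  by apply/leqW/(leq_trans _ (leq_addl _ _)); exact: (leq_bigmax c').
have szc (n : 'I_m.+1) c' : (size (if c' == c then chb n else P c') <= B.+1)%N.
  case: eqP => // _; rewrite size_chbE; apply: leq_trans (ltn_ord n) _.
  by rewrite ltnS leq_addr.
transitivity (\sum_(n < m.+1) w n * msum B.+1 (fun c' => if c' == c then 1 else P c')
    (fun k => insertion u v s1 ls s2 k (fun x => th b n * sg n x / lam x))).
  apply: eq_bigr => n _; congr (_ * _).
  rewrite (SB_circle (n := n) (B := B)) ?eqxx ?leq_ord //.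
  apply: msum_ext => [c'|k]; first by case: eqP.
  by apply: (@insertion_ext C u v s1 ls s2 ru) => x xm; rewrite thfb.
rewrite -msum_sum (@SBE _ _ _ B.+1); last by move=> c'; case: eqP; rewrite ?size_poly1.
rewrite -msumZ; apply: msum_ext => // k.
rewrite -(insertion_sum u v s1 ls s2 k xpredT (fun n : 'I_m.+1 => w n) (fun n x => th b n * sg n x / lam x)).
rewrite (@insertion_ext C u v s1 ls s2 ru k _ _ H) insertionZ; congr (_ * _).
have [El _ Et] := run_full_twist k sls rt; symmetry.
have wc : wf (K k ls) (curlR (~~ b) (K k ls) 0) by apply: wf_curlR.
apply: (@cval_insert C u v s1 ls s2 ru k _ (curlR (~~ b) (K k ls) 0) _ rt) => //.
- by rewrite Et sh_curlR addn0.
- by rewrite outs_curlR.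
- by move=> r g pr_ hr; rewrite curl_diag // th_neg.
Qed.
End Circle.

(** [SB_circle] leaves a diagonal operator on one strand of [c0], and the colour of [c0] evaluates
    it at a. *)
Lemma SB_meridian (C : finType) (u v : word (label C)) s1 c0 d0 s2 c f P n a :
  let s := s1 ++ [:: (c0, d0)] ++ s2 in
  run [::] u = Some s -> run s v = Some [::] -> absent c u -> absent c v -> c0 != c ->
  conn c (u ++ circle c f (size s1) 1 ++ v) -> conn c0 (u ++ v) ->
  P c = chb n -> (n <= m)%N -> P c0 = chb a -> (a <= m)%N ->
  SB P (u ++ circle c f (size s1) 1 ++ v) =
  thf f n * sg n a / lam a * SB (fun c' => if c' == c then 1 else P c') (u ++ v).
Proof.
move=> s ru rv au av cc cn cn0 Pn nm Pa am.
pose B := \max_c' size (P c').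
have szP c' : (size (P c') <= B.+1)%N by apply/leqW; exact: (leq_bigmax c').
rewrite (@SB_circle C u v s1 [:: (c0, d0)] s2 ru rv c au av f P n B) //.
rewrite (@SBE _ _ _ B.+1); last by move=> c'; case: eqP; rewrite ?size_poly1.
apply: (@msum_comp _ c0) => // k; rewrite (negPf cc) Pa.
rewrite (pev_insertion ru rv cn0) //.
by have := szP c0; rewrite Pa size_chbE.
Qed.

(** * Invariance of the total *)

Section Unitary.
Variables (cj : {rmorphism F -> F}) (col : pred nat) (mu nu : F).
Hypotheses (cjA : cj A = A^-1) (cj_mu : cj mu = mu) (two_neq0 : 2%:R != 0 :> F).
Hypothesis mu_norm : mu ^+ 2 * nu * (- (2 * m.+2%:R) / (A ^+ 2 - A ^- 2) ^+ 2) = 1.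
(** The SU(2) and SO(3) cases. [nu] is the share of a reflection-invariant sum over the vertices
    that the colours carry. In the second case the conditions on A make n -> m - n a symmetry of
    [sg] and [th]; in the first, the value -1 separates the eigenvalues in [col_dist]. *)
Definition colour_set := ((forall n, col n = (n <= m)%N) /\ nu = 1 /\ A ^+ (2 * m.+2) = -1) \/
  [/\ odd m, forall n, col n = (n <= m)%N && ~~ odd n, nu = 2%:R^-1,
      A ^+ (2 * m.+2) = 1 & A ^+ (m.+2 ^ 2) = -1].
Hypothesis col_case : colour_set.

Lemma col_le n : col n -> (n <= m)%N.
Proof. by case: col_case => [[-> _]|[_ -> _ _ _ /andP[]]]. Qed.

Lemma col0 : col 0.
Proof. by case: col_case => [[-> _]|[_ -> _ _ _]]. Qed.

(** Colourings take values below r = m + 2, whereas the vertices stop at m. *)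
Lemma col_top (V : nmodType) (g : nat -> V) : \sum_(n < m.+2 | col n) g n = \sum_(n < m.+1 | col n) g n.
Proof.
rewrite big_mkcond big_ord_recr /= [RHS]big_mkcond /= (_ : col m.+1 = false) ?addr0 //.
by apply/negP => /col_le; rewrite ltnn.
Qed.

Section Symmetric.
Hypotheses (om : odd m) (Ar : A ^+ (2 * m.+2) = 1) (Arr : A ^+ (m.+2 ^ 2) = -1).

Lemma sg_rev n a : (n <= m)%N -> sg (m - n) a = sg n a.
Proof.
move=> nm; rewrite /sg /Sg; set M := (m - n).+1; set N := n.+1; set B := a.+1.
have MN : (M + N = m.+2)%N by rewrite /M /N; lia.
have E : A ^+ (2 * (M * B)) = A ^- (2 * (N * B)).
  apply: (mulIf (expf_neq0 (2 * (N * B)) A_neq0)).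
  rewrite mulVf ?expf_neq0 // -exprD (_ : _ + _ = 2 * m.+2 * B)%N; last by rewrite -MN; lia.
  by rewrite exprM Ar expr1n.
have S : (-1) ^+ (M + B) = - (-1) ^+ (N + B) :> F.
  rewrite -[LHS]signr_odd -[in RHS]signr_odd !oddD.
  have : odd (M + N) by rewrite MN /= negbK.
  by rewrite oddD; case: (odd M); case: (odd N); case: (odd B) => //= _; rewrite ?expr0 ?expr1 ?opprK.
by rewrite S E invrK; ring.
Qed.

Lemma lam_rev n : (n <= m)%N -> lam (m - n) = lam n.
Proof. by move=> nm; rewrite -!sg0 sg_sym sg_rev // sg_sym. Qed.

Lemma th_rev b n : (n <= m)%N -> th b (m - n) = th b n.
Proof.
move=> nm; suff H : th true (m - n) = th true n.
  by case: b => //; rewrite -[false]/(~~ true) !th_neg H.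
(* Multiplying by A completes the square: up to sign the twist becomes A to the power (n + 1)^2. *)
rewrite /th /=; apply: (mulIf A_neq0); rewrite -!mulrA -!exprSr.
have -> : ((m - n) ^ 2 + 2 * (m - n)).+1 = ((m - n).+1 ^ 2)%N by lia.
have -> : (n ^ 2 + 2 * n).+1 = (n.+1 ^ 2)%N by lia.
have -> : A ^+ ((m - n).+1 ^ 2) = - A ^+ (n.+1 ^ 2).
  have E : A ^+ ((m - n).+1 ^ 2) * A ^+ (2 * m.+2 * n.+1) = A ^+ (m.+2 ^ 2) * A ^+ (n.+1 ^ 2).
    rewrite -!exprD; congr (A ^+ _); have -> : m.+2 = ((m - n).+1 + n.+1)%N by lia.
    by set M := (m - n).+1; set N := n.+1; rewrite !expnS !expn0; lia.
  by move: E; rewrite exprM Ar expr1n mulr1 Arr mulN1r.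
rewrite mulrN -mulNr; congr (_ * _).
rewrite -[in LHS]signr_odd -[in RHS]signr_odd oddB // om.
by case: (odd n); rewrite ?expr0 ?expr1 ?opprK.
Qed.
End Symmetric.

Lemma col_sum g :
  (odd m -> A ^+ (2 * m.+2) = 1 -> A ^+ (m.+2 ^ 2) = -1 -> forall n, (n <= m)%N -> g (m - n)%N = g n) ->
  \sum_(n < m.+2 | col n) g n = nu * \sum_(n < m.+1) g n.
Proof.
rewrite col_top; case: col_case => [[cn [-> _]] _|[om cn -> Ar Arr] /(_ om Ar Arr) H].
  by rewrite mul1r; apply: eq_bigl => n; rewrite cn leq_ord.
have E : \sum_(n < m.+1) g n = 2%:R * \sum_(n < m.+1 | col n) g n.
  rewrite (bigID (fun n : 'I_m.+1 => col n)) /= mulr_natl mulr2n; congr (_ + _).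
  rewrite (reindex_inj rev_ord_inj) /=; apply: eq_big => n.
    rewrite !cn subSS leq_subr leq_ord /= oddB ?leq_ord // om.
    by case: (odd n).
  by move=> _; rewrite subSS H // leq_ord.
by rewrite E mulKf.
Qed.

Lemma A2_neq1 z : (0 < z < 2 * m.+2)%N -> z != m.+2 -> A ^+ (2 * z) != 1.
Proof.
move=> hz zm; apply/eqP => E.
have E4 : A ^+ (4 * z) = 1.
  have -> : (4 * z = 2 * z * 2)%N by lia.
  by rewrite exprM E expr1n.
have [zl|zl] := ltnP z m.+2.
  have hz' : (0 < z < m.+2)%N by lia.
  by have /negP[] := A_prim hz'; rewrite E4.
have hz' : (0 < z - m.+2 < m.+2)%N by lia.
have /negP[] := A_prim hz'; apply/eqP.
apply: (mulIf (oner_neq0 F)); rewrite -{1}A_order -exprD mul1r.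
by rewrite (_ : _ + _ = 4 * z)%N //; lia.
Qed.

(** With x and xy the two powers of A, the sums agree only if y = 1 or x^2 y = 1. The second needs a
    + c + 2 = m + 2, which the value -1 excludes for SU(2) and parity excludes for SO(3). *)
Lemma col_dist a c : col a -> col c -> a != c ->
  A ^+ (2 * a.+1) + A ^- (2 * a.+1) != A ^+ (2 * c.+1) + A ^- (2 * c.+1).
Proof.
wlog ac : a c / (a < c)%N.
  move=> W ca cc nac; case: (ltngtP a c) (nac) => // h _; first exact: W.
  by rewrite eq_sym; apply: W => //; rewrite eq_sym.
move=> ca cc _; have am := col_le ca; have cm := col_le cc.
have z1 : A ^+ (2 * (c - a)) != 1 by apply: A2_neq1; lia.
have z2 : A ^+ (2 * (a.+1 + c.+1)) != 1.
  have [E|E] := eqVneq (a.+1 + c.+1)%N m.+2; last by apply: A2_neq1 => //; lia.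
  case: col_case => [[_ [_ H]]|[om cn _ _ _]].
    rewrite E H; apply: contra two_neq0 => /eqP h.
    by rewrite mulr2n -{1}h addNr.
  have : odd (a.+1 + c.+1) by rewrite E /= negbK.
  move: ca cc; rewrite !cn => /andP[_ /negPf oa] /andP[_ /negPf oc].
  by rewrite oddD /= oa oc.
set x := A ^+ (2 * a.+1).
have -> : (2 * c.+1 = 2 * a.+1 + 2 * (c - a))%N by lia.
move: z2; rewrite (_ : 2 * (a.+1 + c.+1) = 2 * a.+1 + (2 * a.+1 + 2 * (c - a)))%N; last by lia.
rewrite (exprD A (2 * a.+1) (2 * a.+1 + 2 * (c - a))) !(exprD A (2 * a.+1) (2 * (c - a))) -/x.
set y := A ^+ (2 * (c - a)) in z1 * => z2.
have x0 : x != 0 by apply: expf_neq0.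
have y0 : y != 0 by apply: expf_neq0.
have h1 : 1 - y != 0 by rewrite subr_eq0 eq_sym.
have h2 : x * (x * y) - 1 != 0 by rewrite subr_eq0.
apply/eqP => E; have /eqP[] := mulf_neq0 h1 h2.
have -> : (1 - y) * (x * (x * y) - 1) = (x + x^-1 - (x * y + (x * y)^-1)) * (x * y).
  by field; rewrite x0 y0.
by rewrite E subrr mul0r.
Qed.

Definition U n a : F := mu * sg n a.

Lemma U_orth a c : col a -> col c ->
  \sum_(n < m.+2 | col n) U n a * U n c = (a == c)%:R.
Proof.
move=> ca cc; rewrite (col_sum (g := fun n => U n a * U n c)); last first.
  by move=> om Ar Arr n nm; rewrite /U !sg_rev.
have -> : \sum_(n < m.+1) U n a * U n c = mu ^+ 2 * \sum_(n < m.+1) sg n a * sg n c.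
  by rewrite mulr_sumr; apply: eq_bigr => n _; rewrite /U; ring.
have [->|nac] := eqVneq a c.
  by rewrite sg_norm ?col_le // mulrA [nu * _]mulrC mu_norm.
have /eqP := sg_orth (col_dist ca cc nac).
rewrite -mulr_sumr mulf_eq0 signr_eq0 /= => /eqP ->.
by rewrite !mulr0.
Qed.

Lemma cj_sign n : cj ((-1) ^+ n) = (-1) ^+ n.
Proof. by rewrite rmorphXn rmorphN1. Qed.

Lemma cj_sg n a : cj (sg n a) = sg n a.
Proof.
rewrite /sg [RHS](SgAb false) /Sg !rmorphM /= cj_sign fmorphV !rmorphB /= !fmorphV !rmorphXn /= cjA.
by rewrite !exprVn.
Qed.

Lemma cj_lam n : cj (lam n) = lam n.
Proof. by rewrite -sg0 cj_sg. Qed.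

Lemma cj_U n a : cj (U n a) = U n a.
Proof. by rewrite /U rmorphM cj_mu cj_sg. Qed.

Lemma cj_th b n : cj (th b n) = (th b n)^-1.
Proof.
suff H : cj (th true n) = (th true n)^-1.
  by case: b => //; rewrite -[false]/(~~ true) th_neg fmorphV H.
by rewrite /th /= rmorphM /= cj_sign rmorphXn /= cjA invfM invr_sign exprVn.
Qed.

Definition N2 x := x * cj x.

Lemma N2M x y : N2 (x * y) = N2 x * N2 y.
Proof. by rewrite /N2 rmorphM mulrACA. Qed.

Lemma N2_th b n : N2 (th b n) = 1.
Proof. by rewrite /N2 cj_th mulfV ?th_neq0. Qed.

Lemma N2_thf f n : N2 (thf f n) = 1.
Proof. by rewrite /thf /N2 rmorphXn -exprMn -/(N2 _) N2_th expr1n. Qed.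

Lemma U_unitary (y : nat -> F) :
  \sum_(x < m.+2 | col x) N2 (\sum_(n < m.+2 | col n) U x n * y n) =
  \sum_(n < m.+2 | col n) N2 (y n).
Proof.
transitivity (\sum_(x < m.+2 | col x) \sum_(n < m.+2 | col n) \sum_(n' < m.+2 | col n')
    (U x n * U x n') * (y n * cj (y n'))).
  apply: eq_bigr => x _; rewrite /N2 rmorph_sum big_distrlr /=.
  apply: eq_bigr => n _; apply: eq_bigr => n' _.
  by rewrite rmorphM cj_U mulrACA.
rewrite exchange_big; apply: eq_bigr => n cn /=.
rewrite exchange_big (bigD1 n) //= -mulr_suml U_orth // eqxx mul1r big1 ?addr0 //.
move=> n' /andP[cn' nn]; rewrite -mulr_suml U_orth //.
by rewrite (_ : (n : nat) == n' = false) ?mul0r // eq_sym; apply/negbTE.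
Qed.

(** The normalised Gauss sum. For b = [true] it is the bracket of the unknot of framing 1 with the
    Kirby color ([Uplus_bracket]). *)
Definition cb b := mu * nu * \sum_(n < m.+1) lam n * (lam n * th b n).

Lemma Omega_circle b x : (x <= m)%N ->
  \sum_(n < m.+2 | col n) mu * lam n * (th b n * sg n x / lam x) = cb b * (th b x)^-1.
Proof.
move=> xm; have l0 := lam_neq0 xm; have t0 : th b x != 0 := th_neq0 _ _.
rewrite (eq_bigr (fun n : 'I_m.+2 => mu / lam x * (lam n * (th b n * sg n x)))); last first.
  by move=> n _; field.
rewrite -mulr_sumr (col_sum (g := fun n => lam n * (th b n * sg n x))); last first.
  by move=> om Ar Arr n nm; rewrite lam_rev ?th_rev ?sg_rev.
by rewrite Omega_full // /cb; field; rewrite l0 t0.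
Qed.

(* Both sides of [Omega_circle] have the same norm, as functions of x. *)
Lemma cb_unit b : N2 (cb b) = 1.
Proof.
have D : \sum_(n < m.+2 | col n) (lam n * lam n) * mu ^+ 2 = 1.
  transitivity (\sum_(n < m.+2 | col n) U n 0 * U n 0); last by rewrite U_orth ?col0.
  apply: eq_bigr => n _.
  by rewrite /U sg_sym sg0; ring.
have NL x : N2 (lam x) = lam x * lam x by rewrite /N2 cj_lam.
have := U_unitary (fun n => lam n * th b n).
rewrite (eq_bigr (fun x : 'I_m.+2 => N2 (cb b) * (lam x * lam x))); last first.
  move=> x cx; have xm := col_le cx.
  have -> : \sum_(n < m.+2 | col n) U x n * (lam n * th b n) = cb b * (th b x)^-1 * lam x.
    rewrite -Omega_circle // mulr_suml; apply: eq_bigr => n _.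
    by rewrite /U sg_sym; field; rewrite lam_neq0.
  by rewrite (N2M _ (lam x)) (N2M (cb b)) NL -th_neg N2_th mulr1.
rewrite [RHS](eq_bigr (fun n : 'I_m.+2 => lam n * lam n)); last first.
  by move=> n _; rewrite N2M N2_th NL mulr1.
rewrite -mulr_sumr => H; apply: (mulIf (x := (\sum_(n < m.+2 | col n) (lam n * lam n)) * mu ^+ 2)).
  by rewrite mulr_suml D oner_neq0.
by rewrite mulrA H mul1r.
Qed.

Definition Om : {poly F} := \sum_(n < m.+2 | col n) (mu * lam n) *: chb n.

Lemma OmE : Om = \sum_(n < m.+1) (if col n then mu * lam n else 0) *: chb n.
Proof.
rewrite /Om (col_top (fun n => (mu * lam n) *: chb n)) big_mkcond; apply: eq_bigr => n _.
by case: (col n); rewrite ?scale0r.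
Qed.

Lemma Omega_hyp b x : (x <= m)%N ->
  \sum_(n < m.+1) (if col n then mu * lam n else 0) * (th b n * sg n x / lam x) = cb b * (th b x)^-1.
Proof.
move=> xm; rewrite -Omega_circle // (col_top (fun n => mu * lam n * (th b n * sg n x / lam x))) [RHS]big_mkcond.
by apply: eq_bigr => n _; case: (col n); rewrite ?mul0r.
Qed.

Lemma link_run (C : finType) (w : word (label C)) : link_diagram w -> run [::] w = Some [::].
Proof. by case/andP => /eqP. Qed.

Lemma link_conn (C : finType) (w : word (label C)) : link_diagram w -> forall c, conn c w.
Proof. by case/andP => _ /forallP H c; apply: knot_conn. Qed.

Definition colouring (X S : finType) (n : X -> nat) (c : X + S) : {poly F} :=
  match c with inl x => chb (n x) | inr _ => Om end.

Lemma on_surg_inj (X S S' : finType) (f : S -> S') : injective f -> injective (@on_surg X S S' f).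
Proof. by move=> fi [x|t] [y|t'] //= [] => [->|/fi ->]. Qed.

Lemma relabel_full_twist (C C' : finType) (g : C -> C') b p (ls : seq (label C)) :
  relabel g (full_twist b p ls) = full_twist b p [seq (g l.1, l.2) | l <- ls].
Proof.
rewrite /relabel /full_twist size_map map_cat; congr (_ ++ _).
  by rewrite map_flatten map_nseq -map_comp.
rewrite map_flatten; congr flatten.
elim: ls 0%N => //= l ls IH i; congr (_ :: _); exact: IH.
Qed.

Lemma relabel_cat (C C' : finType) (g : C -> C') (w w' : word (label C)) :
  relabel g (w ++ w') = relabel g w ++ relabel g w'.
Proof. exact: map_cat. Qed.

Lemma kirby_N2 (X : finType) (P Q : linkPair X) (n : X -> nat) : kirby_move P Q ->
  N2 (SB (colouring n) (diagram P)) = N2 (SB (colouring n) (diagram Q)).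
Proof.
case=> [S w w' hw hw' iso|S S' f w hw hw' fb|S u v b p ls hw hw'] /=.
- by congr N2; apply: SB_val => k; apply: val_isotopy iso; apply: link_run.
- rewrite SB_relabel; last 2 first.
    by apply: on_surg_inj; apply: bij_inj.
    case: fb => f' _ fK [x|t] /negP[]; apply/codomP; first by exists (inl x).
    by exists (inr (f' t)); rewrite /= fK.
  by congr (N2 (SB _ _)); apply: funext => -[].
pose g := on_surg (X := X) (@Some S); pose G (l : label (X + S)%type) : label _ := (g l.1, l.2).
have [s0 ru] := run_catP (link_run hw); case/run_catP => s0' rt rv.
have g_inj : injective g by apply: on_surg_inj => x y [].
have RR s w : run (map G s) (relabel g w) = omap (map G) (run s w) by apply: run_relabel.
have rgu : run [::] (relabel g u) = Some (map G s0) by have := RR [::] u; rewrite ru.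
have [s' rgu' /run_catP[s'' rc _]] := run_catP (link_run hw').
move: rgu'; rewrite rgu => -[Es']; subst s'.
(* The circle starts with a cup to the right of its strands; that it can be run shows that the line
   is long enough. *)
have pn : (p + size ls <= size s0)%N.
  case/run_consP: rc => t; rewrite /= size_map; by case: leqP.
have ps : (p <= size s0)%N by lia.
have [s1 [s3 [E0 E1]]] := split3 ps; subst s0.
have ns : (size ls <= size s3)%N by move: pn; rewrite size_cat E1; lia.
have [ls' [s2 [E3 E4]]] := split3 ns; subst s3.
rewrite -E1 in rt *; have [El Es _] := run_full_twist (fun=> 0%N) (esym E4) rt; subst ls' s0'.
have ru2 : run [::] (relabel g u) = Some (map G s1 ++ map G ls ++ map G s2) by rewrite rgu !map_cat.
have rv2 : run (map G s1 ++ map G ls ++ map G s2) (relabel g v) = Some [::].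
  by rewrite -!map_cat RR rv.
have off x : g x != inr None by case: x.
have au := absent_relabel u off; have av := absent_relabel v off.
have rt2 : run (map G s1 ++ map G ls ++ map G s2) (full_twist (~~ b) (size (map G s1)) (map G ls)) =
    Some (map G s1 ++ map G ls ++ map G s2).
  by rewrite size_map -relabel_full_twist -!map_cat RR rt.
have PO : colouring n (inr None : X + option S) =
    \sum_(i < m.+1) (if col i then mu * lam i else 0) *: chb i := OmE.
have cn2 : conn (inr None : (X + option S)%type) (relabel g u ++ circle (inr None)
    (if b then 1 else -1) (size (map G s1)) (size (map G ls)) ++ relabel g v).
  by rewrite !size_map E1; apply: (link_conn hw').
have := @SB_Omega _ _ _ _ _ _ ru2 rv2 _ au av b (fun i : nat => if col i then mu * lam i else 0)
  (cb b) (colouring n) (map G ls) erefl PO (Omega_hyp b) cn2 rt2.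
rewrite /= !size_map => ->.
rewrite N2M cb_unit mul1r -[map G ls]/([seq (g l.1, l.2) | l <- ls]) -relabel_full_twist -!relabel_cat.
rewrite SB_relabel //; last first.
  case=> [x|[t|]] //= /negP[]; apply/codomP; first by exists (inl x).
  by exists (inr t).
by congr (N2 (SB _ _)); apply: funext => -[].
Qed.

Definition total (X : finType) (P : linkPair X) : F :=
  \sum_(n : {ffun X -> 'I_m.+2} | [forall i, col (n i)])
     N2 (SB (colouring (fun i => n i : nat)) (diagram P)).

Lemma same_pair_total (X : finType) (P Q : linkPair X) : same_pair P Q -> total P = total Q.
Proof.
elim=> [P1 Q1 /kirby_N2 H|//|P1 Q1 _ ->//|P1 Q1 R1 _ -> _ ->//].
by apply: eq_bigr => n _; apply: H.
Qed.

(** * Adding the meridians one at a time *)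

Section FunSplit.
Variables (X : finType) (j : X).
Definition fupd (T : Type) (n : {ffun X -> T}) (a : T) : {ffun X -> T} :=
  [ffun x => if x == j then a else n x].

Lemma fupd_fupd (T : Type) (n : {ffun X -> T}) a b : fupd (fupd n a) b = fupd n b.
Proof. by apply/ffunP => x; rewrite !ffunE; case: eqP. Qed.

Lemma sum_fupd N (E : {ffun X -> 'I_N.+1} -> F) :
  \sum_n E n = \sum_(n : {ffun X -> 'I_N.+1} | n j == ord0) \sum_a E (fupd n a).
Proof.
rewrite (partition_big (fun n => fupd n ord0) (fun n : {ffun X -> 'I_N.+1} => n j == ord0)) /=.
  apply: eq_bigr => n0 /eqP n00.
  rewrite (reindex_onto (fupd n0) (fun n : {ffun X -> 'I_N.+1} => n j)) /=.
    apply: eq_bigl => a; rewrite [fupd n0 a j]ffunE !eqxx andbT.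
    apply/eqP/ffunP => x; rewrite !ffunE; by case: eqVneq => [->|].
  move=> n /eqP/ffunP nE; apply/ffunP => x; rewrite ffunE.
  by case: eqVneq => [->//|xj]; have := nE x; rewrite ffunE (negPf xj).
by move=> n _; rewrite ffunE eqxx.
Qed.

(** Unitarity in the j-th colour, the others being fixed. The phase t may depend on that colour, as
    it drops out of each modulus. *)
Lemma sum_unitary (G H : {ffun X -> 'I_m.+2} -> F) (t : nat -> F) :
  (forall x, N2 (t x) = 1) ->
  (forall n : {ffun X -> 'I_m.+2}, [forall i, col (n i)] ->
     G n = t (n j) * \sum_(a < m.+2 | col a) U (n j) a * H (fupd n a)) ->
  \sum_(n : {ffun X -> 'I_m.+2} | [forall i, col (n i)]) N2 (G n) =
  \sum_(n : {ffun X -> 'I_m.+2} | [forall i, col (n i)]) N2 (H n).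
Proof.
move=> t1 GH; rewrite big_mkcond [RHS]big_mkcond !sum_fupd; apply: eq_bigr => n _.
have colE (a : 'I_m.+2) : [forall i, col (fupd n a i)] = col a && [forall i, (i == j) || col (n i)].
  apply/forallP/andP => [h|[ca /forallP h] i].
    split; first by have := h j; rewrite ffunE eqxx.
    by apply/forallP => i; have := h i; rewrite ffunE; case: eqP.
  by have := h i; rewrite ffunE; case: eqP.
have [cn|ncn] := boolP [forall i, (i == j) || col (n i)]; last first.
  by rewrite !big1 // => a _; rewrite colE (negPf ncn) andbF.
pose y (b : nat) := H (fupd n (inord b)).
transitivity (\sum_(a < m.+2 | col a) N2 (\sum_(b < m.+2 | col b) U a b * y b)).
  rewrite [RHS]big_mkcond; apply: eq_bigr => a _; rewrite colE cn andbT.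
  case: ifP => // ca; rewrite GH ?colE ?ca //.
  rewrite [fupd n a j]ffunE eqxx N2M t1 mul1r; congr N2; apply: eq_bigr => b _.
  by rewrite fupd_fupd /y inord_val.
rewrite U_unitary big_mkcond; apply: eq_bigr => b _.
by rewrite colE cn andbT /y inord_val.
Qed.
End FunSplit.

Lemma onth_split (T : Type) (s : seq T) p x : onth s p = Some x ->
  exists s1 s2, s = s1 ++ x :: s2 /\ size s1 = p.
Proof.
elim: s p => [|y s IH] [|p] //= => [[->]|/IH[s1 [s2 [-> <-]]]]; first by exists [::], s.
by exists (y :: s1), s2.
Qed.

Section Meridians.
Variables (X S : finType) (I : {set X}).
Notation C := (X + (S + {x | x \in I}))%type.
Let h (x : X) : C := surger I (inl x : X + S).

(* The colours when only the meridians of [L_J] have been added: the components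
   [L_i], i in I, are already named as surgered ones. *)
Definition partial_colouring (J : {set X}) (n : X -> nat) (c : C) : {poly F} :=
  match c with
  | inl x => if (x \in I) && (x \notin J) then 1 else chb (n x)
  | inr (inl _) => Om
  | inr (inr i) => if val i \in J then Om else chb (n (val i))
  end.

Lemma absent_circle (D : finType) (c c' : D) f p n : c' != c -> absent c (circle c' f p n).
Proof.
move=> cc; have cr b (g : nat -> nat) l :
    all (fun e : slice (label D) => if e is Cup z _ then z.1 != c else true) [seq Cross b (g i) | i <- l].
  by elim: l.
rewrite /absent /circle /= cc !all_cat !cr /= andbT /kinks.
by elim: `|f|%N => //= k IH; rewrite cc.
Qed.

Lemma absent_meridians J w w' x : add_meridians h J w w' -> x \notin J ->
  absent (inl x) w -> absent (inl x) w'.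
Proof.
elim=> // {}J j w0 u v s p d f jJ _ IH ru os; rewrite in_setU1 negb_or => /andP[xj xJ] aw.
have := IH xJ aw; rewrite !absent_cat => /andP[-> ->].
by rewrite absent_circle //; apply: contra xj => /eqP[->].
Qed.

Lemma surgerT j (jI : j \in I) : h j = inr (inr (Sub j jI)).
Proof. by rewrite /h /surger; case: insubP => [i _ E|]; [congr (inr (inr _)); apply: val_inj; rewrite SubK|rewrite jI]. Qed.

(** The new meridian takes over the colour [n j], and the component that it encircles becomes
    coloured by [Om]. The weight [mu * lam a] of that sum cancels the [lam a] in the denominator of
    the meridian eigenvalue, which leaves the matrix [U]. *)
Lemma meridian_total J w w' : add_meridians h J w w' -> J \subset I ->
  (forall x, x \in I -> absent (inl x) w) ->
  run [::] w' = Some [::] -> (forall c, conn c w') ->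
  \sum_(n : {ffun X -> 'I_m.+2} | [forall i, col (n i)])
     N2 (SB (partial_colouring J (fun i => n i : nat)) w') =
  \sum_(n : {ffun X -> 'I_m.+2} | [forall i, col (n i)])
     N2 (SB (partial_colouring set0 (fun i => n i : nat)) w).
Proof.
elim=> // {}J j w0 u v s p d f jJ am IH ru os; rewrite subUset sub1set => /andP[jI JI] aw rw cn.
have [s1 [s2 [Es E1]]] := onth_split os; subst s p; rewrite -/(h j) (surgerT jI) in ru os.
set c0 := inr _ in ru os.
have ru' : run [::] u = Some (s1 ++ [:: (c0, d)] ++ s2) := ru.
have [Rc _] := run_circle (inl j : C) f s1 [:: (c0, d)] s2 (fun=> 0%N).
have rv : run (s1 ++ [:: (c0, d)] ++ s2) v = Some [::].
  have Rc' : run (s1 ++ [:: (c0, d)] ++ s2) (circle (inl j : C) f (size s1) 1) =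
    Some (s1 ++ [:: (c0, d)] ++ s2) := Rc.
  by move: rw; rewrite run_cat ru' obindE run_cat Rc'.
have cn1 c : conn c (u ++ v).
  by apply: (@conn_circle C c u v s1 [:: (c0, d)] s2 (inl j) f ru').
rewrite -IH //; last by rewrite run_cat ru'.
have := absent_meridians am jJ (aw _ jI); rewrite absent_cat => /andP[au av].
(* The framing of the meridian enters only through the phase [thf f]. *)
apply: (@sum_unitary _ j _ _ (thf f)) => [x|n cn'].
  exact: N2_thf.
have Pc0 : partial_colouring (j |: J) (fun i => n i : nat) c0 =
    \sum_(a < m.+2 | col a) (mu * lam a) *: chb a.
  by rewrite /= ?SubK in_setU1 eqxx.
rewrite (SB_lin _ Pc0) mulr_sumr; apply: eq_bigr => a ca.
have am' := col_le ca; have nm : (n j <= m)%N by apply: col_le; move/forallP: cn'.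
rewrite (@SB_meridian C u v s1 c0 d s2 (inl j) f _ (n j) a) //=; last 2 first.
- by rewrite setU11 /= andbF.
- by rewrite eqxx.
rewrite /U; have l0 := lam_neq0 am'.
rewrite [LHS](_ : _ = thf f (n j) * (mu * sg (n j) a * SB (fun c' : C => if c' == inl j then 1 else
  if c' == c0 then chb a else partial_colouring (j |: J) (fun i => n i : nat) c') (u ++ v))); last by field.
congr (_ * (_ * SB _ _)); apply: funext => -[x|[t|i]] //=.
- rewrite ffunE in_setU1 -[inl x == inl j]/(x == j); case: eqP => [->|] //=.
  by rewrite jI jJ.
rewrite -[inr (inr i) == c0]/(i == Sub j jI) -val_eqE ?SubK /= ffunE in_setU1.
by case: eqP => [->|] //=; rewrite (negPf jJ).
Qed.

(** The partial colouring interpolates: with no meridian it is the colouring of the original link,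
    with all of them that of the new link. *)
Lemma surgery_total (w : word (label (X + S)%type)) (hw : link_diagram w)
    (w' : word (label C)) (hw' : link_diagram w') :
  add_meridians h I (relabel (surger I) w) w' ->
  total (LinkPair hw) = total (LinkPair hw').
Proof.
move=> am; have surger_inj : injective (@surger X S I).
  move=> [x|t] [y|t'] /=; try by do ?case: insubP.
    case: insubP => [i _ Ei|_]; case: insubP => [i' _ Ei'|_] //= -[E].
    by rewrite -Ei -Ei' E.
    by rewrite E.
  by case=> ->.
have ab x : x \in I -> absent (inl x) (relabel (@surger X S I) w).
  move=> xI; apply: absent_relabel => -[y|t] //=.
  case: insubP => [//|yI]; apply: contra yI => /eqP[->]; exact: xI.
have := meridian_total am (subxx _) ab (link_run hw') (link_conn hw').
rewrite /total /= => H; transitivity (\sum_(n : {ffun X -> 'I_m.+2} | [forall i, col (n i)])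
     N2 (SB (partial_colouring set0 (fun i => n i : nat)) (relabel (surger I) w))).
  apply: eq_bigr => n _; rewrite SB_relabel //.
    congr (N2 (SB _ _)); apply: funext => -[x|t] //=.
    by case: insubP => [i xI <-|xI] /=; rewrite ?in_set0 // (negPf xI).
  case=> [x|[t|i]] //= nc; rewrite ?in_set0 /=.
  - rewrite ?andbT; case: ifP => // /negbT; rewrite ?andbT => xI; case/negP: nc; apply/codomP.
    by exists (inl x); rewrite /= insubN.
  - by case/negP: nc; apply/codomP; exists (inr t).
  - case/negP: nc; apply/codomP; exists (inl (val i)).
    by rewrite -/(h _) (surgerT (valP i)); congr (inr (inr _)); apply: val_inj; rewrite SubK.
rewrite -H; apply: eq_bigr => n _; congr (N2 (SB _ _)); apply: funext => -[x|[t|i]] //=.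
  by case: (x \in I).
by rewrite (valP i).
Qed.
End Meridians.

Lemma change_total (X : finType) (I : {set X}) (P Q : linkPair X) :
  change_of_pair I P Q -> total P = total Q.
Proof.
case=> S [w [hw [w' [hw' [/same_pair_total -> am /same_pair_total <-]]]]].
exact: surgery_total am.
Qed.

(** [Uplus] is a circle of framing 1 around no strand at all, so [SB_Omega] applies and leaves the
    empty diagram. *)
Lemma Uplus_bracket : SB (fun=> Om) Uplus = cb true.
Proof.
have E : Uplus = [::] ++ circle (tt : unit) 1 0 0 ++ [::] by [].
have lk : link_diagram Uplus.
  by apply/andP; split => //; apply/forallP => -[].
have cn : conn tt ([::] ++ circle (tt : unit) 1 0 0 ++ [::]) by rewrite -E; apply: link_conn.
have := @SB_Omega unit [::] [::] [::] [::] [::] erefl erefl tt isT isT true (fun n : nat => if col n then mu * lam n else 0) (cb true) (fun=> Om) [::] erefl OmE (Omega_hyp true) cn erefl.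
rewrite -E => ->; rewrite (_ : SB _ _ = 1) ?mulr1 //.
rewrite (@SBE _ _ _ 1) => [|[]]; last by rewrite eqxx size_poly1.
rewrite /msum (big_pred1 [ffun=> ord0]) => [|k]; last first.
  by rewrite /= -[RHS](_ : true = _) //; apply/esym/eqP/ffunP => x; rewrite !ord1.
by rewrite big1 ?mul1r // => c _; rewrite ffunE; case: c; rewrite eqxx coef1.
Qed.
End Unitary.
End PathModel.

(** * The roots of unity *)

Section Complex.
Variable R : realType.

Lemma cisD (s t : R) : cis (s + t) = cis s * cis t.
Proof.
by apply/eqP; rewrite eq_complex /= cosD sinD; apply/andP; split; apply/eqP; ring.
Qed.

Lemma cis0 : cis (0 : R) = 1.
Proof. by rewrite /cis cos0 sin0. Qed.

Lemma cispi : cis (pi : R) = -1.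
Proof. by apply/eqP; rewrite eq_complex /= cospi sinpi oppr0 !eqxx. Qed.

Lemma cisX n (t : R) : cis t ^+ n = cis (n%:R * t).
Proof.
elim: n => [|n IH]; first by rewrite mul0r cis0.
by rewrite exprS IH -cisD -natr1; congr cis; ring.
Qed.

Lemma cis_neq0 (t : R) : cis t != 0.
Proof.
apply/eqP => h; have := cisD t (- t); rewrite addrN cis0 h mul0r => /eqP.
by rewrite oner_eq0.
Qed.

Lemma cisN (t : R) : cis (- t) = (cis t)^-1.
Proof. by apply: (mulIf (cis_neq0 t)); rewrite mulVf ?cis_neq0 // -cisD addNr cis0. Qed.

Lemma cis_conj (t : R) : conjc (cis t) = (cis t)^-1.
Proof. by rewrite -cisN /cis cosN sinN. Qed.

Lemma cis2_neq1 (t : R) : 0 < t < pi -> cis (t + t) != 1.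
Proof.
move=> ht; apply/eqP => -[c1 _]; have s0 := sin_gt0_pi ht.
move: c1; rewrite cosD -!expr2 => c1; have c2 := cos2Dsin2 t.
have : sin t ^+ 2 = 0 by lra.
by move/eqP; rewrite sqrf_eq0 gt_eqF.
Qed.

Lemma cis_sub (t : R) : (cis t - (cis t)^-1) ^+ 2 = real_complex R (- 4%:R * sin t ^+ 2).
Proof.
rewrite -cisN /cis cosN sinN expr2; apply/eqP; rewrite eq_complex /=.
by apply/andP; split; apply/eqP; ring.
Qed.

Lemma norm_conj (x : R[i]) : `|x| ^+ 2 = x * conjc x.
Proof. exact: normCK. Qed.

Lemma chebE k : cheb R k = chb _ k.
Proof.
by elim/nat_ind2: k.
Qed.

Variables (th : theory) (m : nat).
Hypotheses (m_gt0 : (0 < m)%N) (odd_m : th = SO3 -> odd m).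
Let r := m.+2.
Let A := rootA R th r.
Let q := rootq R th r.

Let r_neq0 : r%:R != 0 :> R. Proof. by rewrite pnatr_eq0. Qed.

Lemma rootA2 : A ^+ 2 = q.
Proof.
rewrite /A /q; case: th => /=; rewrite cisX; congr cis; last by rewrite mulrA.
by field; rewrite ?r_neq0 ?pnatr_eq0.
Qed.

Let A_neq0 : A != 0.
Proof. by rewrite /A; case: th; apply: cis_neq0. Qed.

Let qE : q = cis ((if th is SU2 then 1 else 2%:R) * pi / r%:R).
Proof. by rewrite /q; case: th; rewrite /= ?mul1r. Qed.

Let ang_lt k : (0 < k < r)%N -> 0 < k%:R * (@pi R / r%:R) < @pi R.
Proof.
move=> /andP[k0 kr]; have p0 := pi_gt0 R; have r0 : 0 < r%:R :> R by rewrite ltr0n.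
rewrite mulr_gt0 ?ltr0n ?divr_gt0 //= mulrA ltr_pdivrMr // mulrC ltr_pM2l //.
by rewrite ltr_nat.
Qed.

Let AS : th = SU2 -> A ^+ (2 * r) = -1.
Proof.
move=> E; rewrite exprM rootA2 /q E /= cisX -cispi; congr cis.
by rewrite mulrC mulfVK.
Qed.

Let AO : th = SO3 -> A ^+ r = -1.
Proof.
by move=> E; rewrite /A E /= cisX -cispi; congr cis; rewrite mulrC mulfVK.
Qed.

Let AO2 : th = SO3 -> A ^+ (2 * r) = 1.
Proof. by move=> /AO E; rewrite mulnC exprM E sqrrN expr1n. Qed.

Let A_order : A ^+ (4 * r) = 1.
Proof.
have -> : (4 * r = 2 * r * 2)%N by lia.
rewrite exprM; move: AS AO2; case: th => [/(_ erefl) -> _|_ /(_ erefl) ->].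
  by rewrite sqrrN expr1n.
by rewrite expr1n.
Qed.

Let A_prim j : (0 < j < r)%N -> A ^+ (4 * j) != 1.
Proof.
move=> hj; have e4 : (4 * j = 2 * (2 * j))%N by lia.
case E : th; last first.
  (* For SO(3), A^2 is a primitive r-th root of unity. As r is odd, 2j is never r, and if larger it
     is reduced by r. *)
  have B k : (0 < k < r)%N -> A ^+ (2 * k) != 1.
    move=> hk; have := cis2_neq1 (ang_lt hk).
    rewrite exprM rootA2 /q E /= cisX; apply: contra_neq => <-; congr cis.
    by ring.
  have or : odd r by rewrite /r /= negbK; apply: odd_m.
  have [lt|ge] := ltnP (2 * j) r; first by rewrite e4 B //; lia.
  have ne : (2 * j != r)%N by apply/eqP => e; move: or; rewrite -e oddM.
  have hk : (0 < 2 * j - r < r)%N by lia.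
  have := B _ hk; apply: contra_neq => h.
  rewrite -h -[LHS]mulr1 -(AO2 E) -exprD; congr (A ^+ _); lia.
have := cis2_neq1 (ang_lt hj).
rewrite e4 exprM rootA2 /q E /= cisX; apply: contra_neq => <-; congr cis.
by rewrite natrM; ring.
Qed.

Definition cmu : R[i] := real_complex R (mu R th r).
Definition weight : R[i] := if th is SU2 then 1 else 2%:R^-1.

Let two_neq0 : 2%:R != 0 :> R[i]. Proof. by rewrite pnatr_eq0. Qed.

Let cjA : conjc A = A^-1.
Proof. by rewrite /A; case: th; apply: cis_conj. Qed.

Let cj_mu : conjc cmu = cmu.
Proof. by rewrite /cmu /conjc /= oppr0. Qed.

(** The denominator is -4 times the squared sine that occurs in [mu]; the weight 1/2 makes up for
    the constant 2 in place of the square root of 2 for SO(3). *)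
Let mu_norm : cmu ^+ 2 * weight * (- (2%:R * m.+2%:R) / (A ^+ 2 - A ^- 2) ^+ 2) = 1.
Proof.
rewrite -/r; have -> : A ^- 2 = q^-1 by rewrite -rootA2.
rewrite rootA2 qE; set x := _ * pi / _; have sx : sin x != 0.
  rewrite gt_eqF //; apply: sin_gt0_pi; have h1 : (0 < 1 < r)%N by [].
  have h2 : th = SO3 -> (0 < 2 < r)%N by rewrite /r => /odd_m; lia.
  rewrite /x; case: th h2 => [_|/(_ erefl) h2].
    by have := ang_lt h1; rewrite mulrA.
  by have := ang_lt h2; rewrite mulrA.
have -> : weight = real_complex R (if th is SU2 then 1 else 2%:R^-1).
  by rewrite /weight; case: th; rewrite ?rmorph1 ?fmorphV ?rmorph_nat.
rewrite cis_sub /cmu -!(rmorph_nat (real_complex R)) -rmorphXn -!rmorphM -rmorphN -fmorphV -!rmorphM.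
rewrite -[RHS](rmorph1 (real_complex R)); congr (real_complex R _).
have sr : Num.sqrt r%:R ^+ 2 = r%:R :> R by rewrite sqr_sqrtr // ler0n.
have s2 : Num.sqrt 2 ^+ 2 = 2 :> R by rewrite sqr_sqrtr // ler0n.
have sr0 : Num.sqrt r%:R != 0 :> R by rewrite sqrtr_eq0 -ltNge ltr0n.
have t0 : 2 != 0 :> R by rewrite pnatr_eq0.
rewrite /mu; set w := Num.sqrt r%:R in sr sr0 *; set t := Num.sqrt 2 in s2 *.
move: sx; rewrite /x; case: th => /=; rewrite ?mul1r; set y := sin _ => sx.
  transitivity (t ^+ 2 * r%:R / (2 * w ^+ 2)); first by field; rewrite sx sr0.
  by rewrite s2 sr mulfV // mulf_neq0.
transitivity (r%:R / w ^+ 2); first by field; rewrite sx sr0.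
by rewrite sr mulfV.
Qed.

Let col := color th r.

Let col_case : colour_set A m col weight.
Proof.
rewrite /colour_set /col /weight; move: AS AO AO2 odd_m; case: th => [/(_ erefl) a _ _ _|_ /(_ erefl) a /(_ erefl) b /(_ erefl) om].
  by left; split=> // n; rewrite /color /r !subSS subn0.
right; split=> //; last first.
  rewrite -/r expnS expn1 exprM a -signr_odd /r /= negbK om; exact: expr1.
move=> n; rewrite /color /r !subSS; case on : (odd n); rewrite ?andbF //= andbT.
(* An even n differs from the odd m, so n <= m amounts to n <= r - 3. *)
by apply/idP/idP => h; [|have : n != m by [apply: contraTneq om => <-; rewrite on]]; lia.
Qed.

Lemma OmegaE : Omega R th r = Om A m col cmu.
Proof.
rewrite /Omega /Om scaler_sumr; apply: eq_bigr => k _; rewrite scalerA chebE.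
congr (_ *: _); rewrite -/cmu; congr (_ * _).
by rewrite /lam /qint -/q -rootA2 mulrA -!exprM.
Qed.

Let cjr : {rmorphism R[i] -> R[i]} := @conjc R.

(** The signature correction is an integer power of [cb true], which [cb_unit] places on the unit
    circle. *)
Lemma RT_norm (X : finType) (P : linkPair X) (n : X -> nat) :
  `|RT R th r P n| ^+ 2 = cmu ^+ 2 * N2 cjr (SB A m (colouring A m col cmu n) (diagram P)).
Proof.
have lP := link_run (diagramP P).
have lU : run [::] Uplus = Some [::] by [].
have SE C := @skein_SB _ A m A_neq0 A_prim A_order m_gt0 C.
rewrite norm_conj /RT -/A -/cmu OmegaE (SE _ _ _ lU) (SE _ _ _ lP).
rewrite (Uplus_bracket A_neq0 A_prim A_order m_gt0 cmu two_neq0 col_case).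
have -> : (fun c : X + surg P => match c with inl x => cheb R (n x) | inr _ => Om A m col cmu end) =
    colouring A m col cmu n.
  by apply: funext => -[x|t] //=; rewrite chebE.
set x := SB _ _ _ _; set y := cb _ _ _ _ _; set z := - _.
have U := cb_unit A_neq0 A_prim A_order m_gt0 (cj := cjr) cjA cj_mu two_neq0 mu_norm col_case true.
have Uz : y ^ z * conjc (y ^ z) = 1.
  by rewrite -[conjc _]/(cjr _) fmorphXz -expfzMl -[y * _]/(N2 cjr y) U exp1rz.
have cM a b : conjc (a * b) = conjc a * conjc b :> R[i] := rmorphM cjr a b.
rewrite !cM cj_mu.
by rewrite mulrACA Uz mulr1 mulrACA expr2.
Qed.

Lemma RT_total (n : nat) (P : linkPair 'I_n) :
  \sum_(k : {ffun 'I_n -> 'I_r} | [forall i, color th r (k i)]) `|RT R th r P (fun i => k i : nat)| ^+ 2 =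
  cmu ^+ 2 * total A m cjr col cmu P.
Proof.
by rewrite /total mulr_sumr; apply: eq_bigr => k _; apply: RT_norm.
Qed.

Lemma RT_change (n : nat) (I : {set 'I_n}) (P Q : linkPair 'I_n) : change_of_pair I P Q ->
  \sum_(k : {ffun 'I_n -> 'I_r} | [forall i, color th r (k i)]) `|RT R th r P (fun i => k i : nat)| ^+ 2 =
  \sum_(k : {ffun 'I_n -> 'I_r} | [forall i, color th r (k i)]) `|RT R th r Q (fun i => k i : nat)| ^+ 2.
Proof.
move=> PQ; rewrite !RT_total; congr (_ * _).
exact: (change_total A_neq0 A_prim A_order m_gt0 (cj := cjr) cjA cj_mu two_neq0 mu_norm col_case PQ).
Qed.
End Complex.

Theorem proposition1p6 (R : realType) (n : nat) (I : {set 'I_n})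
    (P Q : linkPair 'I_n) (hPQ : change_of_pair I P Q) :
  (forall r : nat, (3 <= r)%N ->
     \sum_(m : {ffun 'I_n -> 'I_r} | [forall i, color SU2 r (m i)])
        `|RT R SU2 r P (fun i => m i : nat)| ^+ 2 =
     \sum_(m : {ffun 'I_n -> 'I_r} | [forall i, color SU2 r (m i)])
        `|RT R SU2 r Q (fun i => m i : nat)| ^+ 2) /\
  (forall r : nat, (3 <= r)%N -> odd r ->
     \sum_(m : {ffun 'I_n -> 'I_r} | [forall i, color SO3 r (m i)])
        `|RT R SO3 r P (fun i => m i : nat)| ^+ 2 =
     \sum_(m : {ffun 'I_n -> 'I_r} | [forall i, color SO3 r (m i)])
        `|RT R SO3 r Q (fun i => m i : nat)| ^+ 2).
Proof.
(* Here r is [m.+3], while the path model has r = m + 2; it is used with [m.+1], which is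
   positive. *)
split=> -[|[|[|m]]] // _ => [|om].
  have o1 : SU2 = SO3 -> odd m.+1 by [].
  exact: (@RT_change R SU2 m.+1 isT o1 n I P Q hPQ).
have o2 : SO3 = SO3 -> odd m.+1 by move: om; rewrite /= negbK.
exact: (@RT_change R SO3 m.+1 isT o2 n I P Q hPQ).
Qed.
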